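(* An arc-length parametrized curve $\gamma\in C^\infty([a,b];\mathbb{R}^3)$ with bending stiffness $\varrho\in C^\infty([a,b];\mathbb{R}_{>0})$ is holonomy constrained elastic if and only if its curvature function $\kappa\in C^\infty([a,b];\mathbb{R}^2)$ satisfies $$\begin{cases}0=(\varrho\kappa)''+\tfrac12\varrho\langle\kappa,\kappa\rangle\kappa+\mu J\kappa'-\Lambda\kappa,\\ 0=\Lambda'+\tfrac12\varrho'\langle\kappa,\kappa\rangle\end{cases}$$ for some $\Lambda\in C^\infty([a,b];\mathbb{R})$ and $\mu\in\mathbb{R}$, where $J=\begin{pmatrix}0&-1\\1&0\end{pmatrix}$.
   Context: A curve is a map $\gamma\in C^\infty([a,b];\mathbb{R}^3)$ with $\gamma'\ne0$ everywhere; it is arc-length parametrized if $|\gamma'|\equiv1$. For a function $g$ along $\gamma$, $\frac{dg}{ds}:=g'/|\gamma'|$ and $ds=|\gamma'|\,dx$; $T:=\frac{d\gamma}{ds}$. The bending energy of $\gamma$ with bending stiffness $\varrho\in C^\infty([a,b];\mathbb{R}_{>0})$ is $\mathcal B_\varrho(\gamma):=\frac12\int_a^b\varrho\,\langle\frac{dT}{ds},\frac{dT}{ds}\rangle\,ds$ ($\varrho$ is a fixed function on $[a,b]$, not varied). Holonomy: a normal field $Z$ along $\gamma$ ($\langle Z,T\rangle=0$) is parallel if $Z'=\lambda T$ for some smooth function $\lambda$; every normal vector at $\gamma(a)$ extends uniquely to a parallel normal field, whose value at $b$ is its parallel transport along $\gamma$. For unit vectors $W_a\in T(a)^\perp$,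 $W_b\in T(b)^\perp$ and $W=(W_a,W_b)$, the holonomy of $\gamma$ with respect to $W$ is the unique angle $\mathcal T_W\in\mathbb{R}/2\pi\mathbb{Z}$ with $Z_b=\cos(\mathcal T_W)W_b+\sin(\mathcal T_W)\,T(b)\times W_b$, where $Z_b$ is the parallel transport of $W_a$ along $\gamma$. A smooth variation of $\gamma$ is a smooth one-parameter family $\gamma_t$, $t\in[-\epsilon,\epsilon]$, with $\gamma_0=\gamma$; its variational vector field is $\mathring\gamma:=\frac{d}{dt}|_{t=0}\gamma_t$, and for a functional $\mathcal F$, $d\mathcal F(\mathring\gamma):=\frac{d}{dt}|_{t=0}\mathcal F(\gamma_t)$. $C_0^\infty([a,b];\mathbb{R}^3)$ denotes the smooth maps with compact support in the interior of $[a,b]$; variations with compact support in the interior leave $\gamma$ unchanged near the end points, and $d\mathcal T_W(\mathring\gamma)$ is then independent of the choice of $W$. Variations and variational vector fields are treated as synonyms. An arc-length parametrized curve $\gamma$ with bending stiffness $\varrho$ is called holonomy constrained elastic if it is a critical point of $\mathcal B_\varrho$ under all variations $\mathring\gamma\in C_0^\infty([a,b];\mathbb{R}^3)$ constraining the arc-length and the holonomy, i.e. $d\mathcal B_\varrho(\mathring\gamma)=0$ for all $\mathring\gamma\in C_0^\infty([a,b];\mathbb{R}^3)$ satisfying pointwise $\langle\mathring\gamma',\gamma'\rangle=0$ and $d\mathcal T_W(\mathring\gamma)=0$. Curvature function: let $N=[N_1,N_2]$ be made of parallel unit normal fields along $\gamma$ with $\det(T,N_1,N_2)=1$. The curvature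 function $\kappa\in C^\infty([a,b];\mathbb{R}^2)$ of the arc-length parametrized curve $\gamma$ (with respect to such a fixed choice of $N$) is defined by $T'=-N\kappa$. The matrix $J$ corresponds to the $90^\circ$ rotation around $T$ in the normal space. *)

(* Defs.v *)
From Stdlib Require Import Reals ClassicalEpsilon.
From Coquelicot Require Import Coquelicot.

Open Scope R_scope.

(* A map defined on [[a, b]] is represented by a total function on [R] whose
    values outside [[a, b]] are never used: derivatives are relative to
    [[a, b]], hence one-sided at the end points. *)
Definition Icc (a b x : R) : Prop := a <= x <= b.

(* Coquelicot's [is_derive] with [locally x] restricted to [[a, b]]. *)
Definition is_derive_on (a b : R) {V : NormedModule R_AbsRing}
    (f : R -> V) (x : R) (l : V) : Prop :=
  filterdiff f (within (Icc a b) (locally x)) (fun h : R => scal h l).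

(* For [a < b] and [x] in [[a, b]] the derivative is unique when it exists;
   the value is unspecified otherwise. *)
Definition Derive_on (a b : R) {V : NormedModule R_AbsRing}
    (f : R -> V) (x : R) : V :=
  epsilon (inhabits zero) (is_derive_on a b f x).

(* [F n] is the n-th derivative of [f] on [[a, b]]. *)
Definition smooth_on (a b : R) {V : NormedModule R_AbsRing} (f : R -> V) : Prop :=
  exists F : nat -> R -> V,
    (forall x, Icc a b x -> F O x = f x) /\
    (forall n x, Icc a b x -> is_derive_on a b (F n) x (F (S n) x)).

(* [F i j] is the continuous partial derivative of order [i] in the first and
   [j] in the second variable of [f] on [[t0, t1] x [a, b]]. *)
Definition smooth_on2 (t0 t1 a b : R) {V : NormedModule R_AbsRing}
    (f : R -> R -> V) : Prop :=
  exists F : nat -> nat -> R -> R -> V,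
    (forall t x, Icc t0 t1 t -> Icc a b x -> F O O t x = f t x) /\
    (forall i j t x, Icc t0 t1 t -> Icc a b x ->
       is_derive_on t0 t1 (fun u => F i j u x) t (F (S i) j t x) /\
       is_derive_on a b (fun y => F i j t y) x (F i (S j) t x) /\
       filterlim (fun p : R * R => F i j (fst p) (snd p))
         (within (fun p : R * R => Icc t0 t1 (fst p) /\ Icc a b (snd p))
                 (locally (t, x)))
         (locally (F i j t x))).

Definition dot2 (u v : R * R) : R := fst u * fst v + snd u * snd v.

Definition dot3 (u v : R * R * R) : R :=
  fst (fst u) * fst (fst v) + snd (fst u) * snd (fst v) + snd u * snd v.

Definition norm3 (u : R * R * R) : R := sqrt (dot3 u u).

Definition cross (u v : R * R * R) : R * R * R :=
  (snd (fst u) * snd v - snd u * snd (fst v),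
   snd u * fst (fst v) - fst (fst u) * snd v,
   fst (fst u) * snd (fst v) - snd (fst u) * fst (fst v)).

Definition det3 (u v w : R * R * R) : R := dot3 u (cross v w).

(* The matrix ((0, -1), (1, 0)). *)
Definition J (u : R * R) : R * R := (- snd u, fst u).

Definition is_curve (a b : R) (g : R -> R * R * R) : Prop :=
  smooth_on a b g /\ forall x, Icc a b x -> Derive_on a b g x <> zero.

Definition speed (a b : R) (g : R -> R * R * R) (x : R) : R :=
  norm3 (Derive_on a b g x).

Definition arc_length_parametrized (a b : R) (g : R -> R * R * R) : Prop :=
  forall x, Icc a b x -> speed a b g x = 1.

(* d/ds along [g] *)
Definition dds (a b : R) (g : R -> R * R * R) {V : NormedModule R_AbsRing}
    (f : R -> V) (x : R) : V :=
  scal (/ speed a b g x) (Derive_on a b f x).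

Definition tangent (a b : R) (g : R -> R * R * R) : R -> R * R * R :=
  dds a b g g.

Definition bending_energy (a b : R) (rho : R -> R) (g : R -> R * R * R) : R :=
  1 / 2 * RInt (fun x =>
    rho x * dot3 (dds a b g (tangent a b g) x) (dds a b g (tangent a b g) x)
      * speed a b g x) a b.

Definition normal_field (a b : R) (g Z : R -> R * R * R) : Prop :=
  smooth_on a b Z /\ forall x, Icc a b x -> dot3 (Z x) (tangent a b g x) = 0.

Definition parallel_normal_field (a b : R) (g Z : R -> R * R * R) : Prop :=
  normal_field a b g Z /\
  exists lam : R -> R, smooth_on a b lam /\
    forall x, Icc a b x ->
      Derive_on a b Z x = scal (lam x) (tangent a b g x).

Definition unit_normal (a b : R) (g : R -> R * R * R) (x : R)
    (w : R * R * R) : Prop :=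
  norm3 w = 1 /\ dot3 w (tangent a b g x) = 0.

(* [theta] represents, modulo [2 * PI], the holonomy of [g] with respect to
   [(Wa, Wb)]. *)
Definition is_holonomy (a b : R) (g : R -> R * R * R) (Wa Wb : R * R * R)
    (theta : R) : Prop :=
  exists Z : R -> R * R * R,
    parallel_normal_field a b g Z /\ Z a = Wa /\
    Z b = plus (scal (cos theta) Wb)
               (scal (sin theta) (cross (tangent a b g b) Wb)).

Definition compactly_supported (a b : R) (v : R -> R * R * R) : Prop :=
  exists c d : R, a < c /\ c <= d /\ d < b /\
    forall x, Icc a b x -> x < c \/ d < x -> v x = zero.

(* [G t], for [t] in [[-eps, eps]], is a smooth variation of [g], supported in
   a fixed compact subset of the open interval, with variational field [v]. *)
Definition is_variation (a b : R) (g v : R -> R * R * R) (eps : R)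
    (G : R -> R -> R * R * R) : Prop :=
  0 < eps /\
  smooth_on2 (- eps) eps a b G /\
  (forall t, Icc (- eps) eps t -> is_curve a b (G t)) /\
  (forall x, Icc a b x -> G 0 x = g x) /\
  (exists c d : R, a < c /\ c <= d /\ d < b /\
     forall t x, Icc (- eps) eps t -> Icc a b x -> x < c \/ d < x ->
       G t x = g x) /\
  (forall x, Icc a b x -> is_derive (fun t => G t x) 0 (v x)).

Definition is_bending_variation (a b : R) (rho : R -> R)
    (G : R -> R -> R * R * R) (l : R) : Prop :=
  is_derive (fun t => bending_energy a b rho (G t)) 0 l.

(* The derivative of an angle in R / 2 PI Z is that of a real-valued lift; two
   lifts that are continuous at 0 differ by a constant near 0. *)
Definition is_holonomy_variation (a b : R) (Wa Wb : R * R * R)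
    (G : R -> R -> R * R * R) (l : R) : Prop :=
  exists theta : R -> R,
    locally 0 (fun t => is_holonomy a b (G t) Wa Wb (theta t)) /\
    is_derive theta 0 l.

Definition holonomy_constrained_elastic (a b : R) (rho : R -> R)
    (Wa Wb : R * R * R) (g : R -> R * R * R) : Prop :=
  forall v : R -> R * R * R,
    smooth_on a b v -> compactly_supported a b v ->
    (forall x, Icc a b x ->
       dot3 (Derive_on a b v x) (Derive_on a b g x) = 0) ->
    forall (eps : R) (G : R -> R -> R * R * R),
      is_variation a b g v eps G ->
      is_holonomy_variation a b Wa Wb G 0 ->
      is_bending_variation a b rho G 0.

Definition parallel_frame (a b : R) (g N1 N2 : R -> R * R * R) : Prop :=
  parallel_normal_field a b g N1 /\ parallel_normal_field a b g N2 /\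
  forall x, Icc a b x ->
    norm3 (N1 x) = 1 /\ norm3 (N2 x) = 1 /\
    det3 (tangent a b g x) (N1 x) (N2 x) = 1.

(* [T' = - N kappa] *)
Definition is_curvature_function (a b : R) (g N1 N2 : R -> R * R * R)
    (kappa : R -> R * R) : Prop :=
  smooth_on a b kappa /\
  forall x, Icc a b x ->
    Derive_on a b (tangent a b g) x =
      opp (plus (scal (fst (kappa x)) (N1 x)) (scal (snd (kappa x)) (N2 x))).

(* Main.v *)
Require Import Defs.
From Stdlib Require Import Reals Lra ClassicalEpsilon FunctionalExtensionality.
From Coquelicot Require Import Coquelicot.
Open Scope R_scope.

(* Let w = v' for a variational field v with <v', T> = 0, and p_i = <w, N_i>.  To first order the
   arc length is constant, so the bending energy varies by
   int rho <T', w'> = int <(rho kappa)', p>.  Along any curve g the holonomy is, up to constants,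
   minus the integral of <M1', M2> for an orthonormal frame (T, M1, M2); with M1 proportional to
   N2 x g' this is an explicit function of g' and g'', so no differential equation has to be solved
   and its variation is found by differentiating under the integral: it is int <J kappa, p>.
   As v vanishes at the ends, p ranges over the compactly supported functions with
   int (p_1 N_1 + p_2 N_2) = 0 and int <J kappa, p> = 0.  Hence gamma is elastic if and only if
   (rho kappa)' = (<N_1, c>, <N_2, c>) - mu J kappa for some constants c and mu (the fundamental
   lemma with four linear constraints).  Differentiating once, with N_i' = kappa_i T, gives the
   system, where Lambda = <T, c> + rho <kappa, kappa> / 2; conversely the system says precisely that
   the corresponding vector c is constant along gamma. *)

(** * One-sided derivatives *)

(** The product [N2 x g'] is automatically normal to [g'], equals [N1] for the unvaried curve, and
    equals [N1] at both ends for every curve of a variation, because these leave the ends unchanged.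
    So the frame angles of [Wa] and [Wb] do not depend on the parameter, and the whole variation of
    the holonomy sits in one integral. The product may vanish for large parameters; by compactness
    it does not for small ones, which is enough for a derivative at 0. The constraints are imposed
    only to first order. Necessity can therefore use the straight variations [gamma + t v], although
    these preserve arc length only to first order; sufficiency has to treat arbitrary variations, so
    both first variations are computed for these. The vector [c] is the multiplier of the condition
    that the primitive [v] of a given field closes up with compact support, and [mu] is the
    multiplier of the holonomy. Since derivatives are relative to the interval, two devices carry
    two-sided calculus over to it: extension of a function by a tangent line, and composition with
    the retraction of the line onto the interval. *)

Lemma is_derive_fst {U V : NormedModule R_AbsRing} (f : R -> U * V) (x : R) (l : U * V) :
  is_derive f x l -> is_derive (fun y => fst (f y)) x (fst l).
Proof.
  intros H. unfold is_derive.
  eapply filterdiff_ext_lin.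
  - apply (filterdiff_comp' f (fun u : U * V => fst u) x _ (fun u : U * V => fst u) H).
    apply filterdiff_linear, is_linear_fst.
  - reflexivity.
Qed.

Lemma is_derive_snd {U V : NormedModule R_AbsRing} (f : R -> U * V) (x : R) (l : U * V) :
  is_derive f x l -> is_derive (fun y => snd (f y)) x (snd l).
Proof.
  intros H. unfold is_derive.
  eapply filterdiff_ext_lin.
  - apply (filterdiff_comp' f (fun u : U * V => snd u) x _ (fun u : U * V => snd u) H).
    apply filterdiff_linear, is_linear_snd.
  - reflexivity.
Qed.

Lemma is_derive_pair {U V : NormedModule R_AbsRing} (f : R -> U) (g : R -> V) (x : R) (l : U) (m : V) :
  is_derive f x l -> is_derive g x m -> is_derive (fun y => (f y, g y)) x (l, m).
Proof.
  intros Hf Hg. unfold is_derive.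
  eapply filterdiff_ext_lin.
  - apply (filterdiff_comp'_2 f g (fun u v => (u, v)) x _ _ (fun u v => (u, v)) Hf Hg).
    apply (filterdiff_ext (fun t => t)); [now intros [u v]|].
    eapply filterdiff_ext_lin; [apply filterdiff_id | now intros [u v]].
  - reflexivity.
Qed.

Lemma minus_plus_cancel {G : AbelianGroup} (u w : G) : minus (minus (plus u w) u) w = zero.
Proof.
  unfold minus. rewrite (plus_comm u w), <- (plus_assoc w u), plus_opp_r, plus_zero_r.
  apply plus_opp_r.
Qed.

Lemma minus_minus_cancel {G : AbelianGroup} (u v w : G) :
  minus (minus u v) (minus u w) = minus w v.
Proof.
  rewrite (minus_trans u w v), <- (opp_minus u w). unfold minus at 1. apply plus_comm.
Qed.

Lemma minus_eq_zero_eq {G : AbelianGroup} (u v : G) : minus u v = zero -> u = v.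
Proof.
  intros h. apply (plus_reg_r (opp v)). etransitivity; [exact h|]. symmetry. apply plus_opp_r.
Qed.

Section OneSidedDerivatives.
Variables (a b : R).

(** [filterdiff] quantifies over all limits of its filter; for the restricted filter the only limit
    is [x], which leaves the usual epsilon estimate at points of the interval. *)
Lemma is_derive_on_iff {V : NormedModule R_AbsRing} (f : R -> V) (x : R) (l : V) :
  Icc a b x ->
  is_derive_on a b f x l <->
  forall eps : posreal, locally x (fun y => Icc a b y ->
    norm (minus (minus (f y) (f x)) (scal (minus y x) l)) <= eps * norm (minus y x)).
Proof.
  intros hx. split.
  - intros [_ H] eps.
    apply (H x). intros P HP. unfold within. revert HP. apply filter_imp. auto.
  - intros H. split; [exact (is_linear_scal_l (K := R_AbsRing) l)|].
    intros y Hy eps.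
    (* A ball around another point [y] of half the distance to [x] misses [x], whereas [x] itself
       lies in every set of the restricted filter. *)
    assert (hxy : y = x).
    { destruct (Req_dec y x) as [e|ne]; [exact e|exfalso].
      assert (hp : 0 < Rabs (x - y) / 2).
      { apply Rdiv_lt_0_compat; [apply Rabs_pos_lt; lra|lra]. }
      assert (HP : locally y (fun z => Rabs (z - y) < Rabs (x - y) / 2)).
      { exists (mkposreal _ hp). intros z Hz. exact Hz. }
      specialize (Hy _ HP). unfold within in Hy.
      specialize (locally_singleton _ _ Hy hx). simpl. intros Q. lra. }
    subst y. exact (H eps).
Qed.

Lemma is_derive_on_of_is_derive {V : NormedModule R_AbsRing} (f : R -> V) (x : R) (l : V) :
  Icc a b x -> is_derive f x l -> is_derive_on a b f x l.
Proof.
  intros hx [_ H]. apply is_derive_on_iff; [exact hx|].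
  intros eps. generalize (H x (fun P HP => HP) eps). apply filter_imp. auto.
Qed.

(** Outside the interval [f] is replaced by its first-order expansion at [x], whose remainder is
    zero, so two-sided differentiability at [x] comes for free. The extension depends on [x], which
    is harmless for rules about a single point. *)
Lemma is_derive_on_extend {V : NormedModule R_AbsRing} (f : R -> V) (x : R) (l : V) :
  Icc a b x -> is_derive_on a b f x l ->
  exists g : R -> V, (forall y, Icc a b y -> g y = f y) /\ is_derive g x l.
Proof.
  intros hx H.
  exists (fun y => if excluded_middle_informative (Icc a b y) then f y
                   else plus (f x) (scal (minus y x) l)).
  assert (E : forall y, Icc a b y ->
    (if excluded_middle_informative (Icc a b y) then f y
     else plus (f x) (scal (minus y x) l)) = f y).
  { intros y hy. destruct (excluded_middle_informative (Icc a b y)); tauto. }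
  split; [exact E|].
  split; [exact (is_linear_scal_l (K := R_AbsRing) l)|].
  intros y Hy. pose proof
    (is_filter_lim_locally_unique (K := R_AbsRing) (V := R_NormedModule) x y Hy). subst y.
  intros eps. rewrite (E x hx).
  rewrite is_derive_on_iff in H by exact hx.
  generalize (H eps). apply filter_imp. intros y Ky.
  destruct (excluded_middle_informative (Icc a b y)) as [hy|hy]; [exact (Ky hy)|].
  eapply Rle_trans; [right; etransitivity;
    [apply f_equal, (minus_plus_cancel (G := NormedModule.AbelianGroup R_AbsRing V)
      (f x) (scal (minus y x) l))|exact (norm_zero (V := V))]|].
  apply Rmult_le_pos; [apply Rlt_le, cond_pos|apply norm_ge_0].
Qed.

Lemma is_derive_on_ext_loc {V : NormedModule R_AbsRing} (f g : R -> V) (x : R) (l : V) :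
  Icc a b x -> locally x (fun y => Icc a b y -> f y = g y) ->
  is_derive_on a b f x l -> is_derive_on a b g x l.
Proof.
  intros hx E H. rewrite is_derive_on_iff in H |- * by exact hx.
  intros eps. generalize (filter_and _ _ E (H eps)). apply filter_imp.
  intros y [e h] hy. rewrite <- e, <- (locally_singleton _ _ E hx); auto.
Qed.

Lemma is_derive_on_ext {V : NormedModule R_AbsRing} (f g : R -> V) (x : R) (l : V) :
  Icc a b x -> (forall y, Icc a b y -> f y = g y) ->
  is_derive_on a b f x l -> is_derive_on a b g x l.
Proof.
  intros hx E. apply is_derive_on_ext_loc; [exact hx|].
  apply filter_forall. exact E.
Qed.

(** Transfer principle: a two-sided differentiation rule at [x] for an operation [h] that acts
    pointwise yields the one-sided rule, by applying it to an extension of [f]. Binary rules follow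
    by taking [f] with values in a product. *)
Lemma is_derive_on_lift {U V : NormedModule R_AbsRing} (h : (R -> U) -> R -> V)
    (f : R -> U) (x : R) (l : U) (m : V) :
  (forall (f1 f2 : R -> U) y, f1 y = f2 y -> h f1 y = h f2 y) ->
  (forall g : R -> U, g x = f x -> is_derive g x l -> is_derive (h g) x m) ->
  Icc a b x -> is_derive_on a b f x l -> is_derive_on a b (h f) x m.
Proof.
  intros Hh H hx Hf.
  destruct (is_derive_on_extend f x l hx Hf) as [g [E Hg]].
  apply (is_derive_on_ext (h g)); [exact hx| |].
  - intros y hy. apply Hh. auto.
  - apply is_derive_on_of_is_derive; auto.
Qed.

Lemma is_derive_on_pair {U V : NormedModule R_AbsRing} (f : R -> U) (g : R -> V)
    (x : R) (l : U) (m : V) :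
  Icc a b x -> is_derive_on a b f x l -> is_derive_on a b g x m ->
  is_derive_on a b (fun y => (f y, g y)) x (l, m).
Proof.
  intros hx Hf Hg.
  destruct (is_derive_on_extend f x l hx Hf) as [f1 [Ef Hf1]].
  destruct (is_derive_on_extend g x m hx Hg) as [g1 [Eg Hg1]].
  apply (is_derive_on_ext (fun y => (f1 y, g1 y))); [exact hx| |].
  - intros y hy. now rewrite Ef, Eg.
  - apply is_derive_on_of_is_derive; [exact hx|]. now apply is_derive_pair.
Qed.

Lemma is_derive_on_fst {U V : NormedModule R_AbsRing} (f : R -> U * V) (x : R) (l : U * V) :
  Icc a b x -> is_derive_on a b f x l -> is_derive_on a b (fun y => fst (f y)) x (fst l).
Proof.
  apply (is_derive_on_lift (fun f y => fst (f y))).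
  - intros ? ? ? e. now rewrite e.
  - intros g _. apply is_derive_fst.
Qed.

Lemma is_derive_on_snd {U V : NormedModule R_AbsRing} (f : R -> U * V) (x : R) (l : U * V) :
  Icc a b x -> is_derive_on a b f x l -> is_derive_on a b (fun y => snd (f y)) x (snd l).
Proof.
  apply (is_derive_on_lift (fun f y => snd (f y))).
  - intros ? ? ? e. now rewrite e.
  - intros g _. apply is_derive_snd.
Qed.

Lemma is_derive_on_comp {V : NormedModule R_AbsRing} (h : R -> V) (f : R -> R) (x l : R) (m : V) :
  Icc a b x -> is_derive_on a b f x l -> is_derive h (f x) m ->
  is_derive_on a b (fun y => h (f y)) x (scal l m).
Proof.
  intros hx Hf Hh.
  refine (is_derive_on_lift (fun f y => h (f y)) f x l _ _ _ hx Hf).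
  - intros ? ? ? e. now rewrite e.
  - intros g e Hg. apply (is_derive_comp h g x m l); [now rewrite e|exact Hg].
Qed.

Lemma is_derive_on_const {V : NormedModule R_AbsRing} (c : V) (x : R) :
  Icc a b x -> is_derive_on a b (fun _ => c) x zero.
Proof. intros hx. apply is_derive_on_of_is_derive; [exact hx|]. exact (is_derive_const c x). Qed.

Lemma is_derive_on_plus {V : NormedModule R_AbsRing} (f g : R -> V) (x : R) (l m : V) :
  Icc a b x -> is_derive_on a b f x l -> is_derive_on a b g x m ->
  is_derive_on a b (fun y => plus (f y) (g y)) x (plus l m).
Proof.
  intros hx Hf Hg.
  refine (is_derive_on_lift (fun h y => plus (fst (h y)) (snd (h y))) (fun y => (f y, g y))
            x (l, m) _ _ _ hx _).
  - intros ? ? ? e. now rewrite e.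
  - intros h _ H. apply (is_derive_plus (fun y => fst (h y)) (fun y => snd (h y)));
      [apply (is_derive_fst h x (l, m) H)|apply (is_derive_snd h x (l, m) H)].
  - now apply is_derive_on_pair.
Qed.

Lemma is_derive_on_mult (f g : R -> R) (x l m : R) :
  Icc a b x -> is_derive_on a b f x l -> is_derive_on a b g x m ->
  is_derive_on a b (fun y => f y * g y) x (l * g x + f x * m).
Proof.
  intros hx Hf Hg.
  refine (is_derive_on_lift (fun h y => fst (h y) * snd (h y)) (fun y => (f y, g y))
            x (l, m) _ _ _ hx _).
  - intros ? ? ? e. now rewrite e.
  - intros h e H.
    replace (g x) with (snd (h x)) by now rewrite e.
    replace (f x) with (fst (h x)) by now rewrite e.
    apply (is_derive_mult (fun y => fst (h y)) (fun y => snd (h y)) x l m);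
      [apply (is_derive_fst h x (l, m) H)|apply (is_derive_snd h x (l, m) H)|].
    intros; apply Rmult_comm.
  - now apply is_derive_on_pair.
Qed.

Lemma is_derive_on_continuous {V : NormedModule R_AbsRing} (f : R -> V) (x : R) (l : V) :
  Icc a b x -> is_derive_on a b f x l ->
  filterlim f (within (Icc a b) (locally x)) (locally (f x)).
Proof.
  intros hx H. destruct (is_derive_on_extend f x l hx H) as [g [E Hg]].
  assert (C : continuous g x). { apply ex_derive_continuous. now exists l. }
  rewrite <- (E x hx).
  intros P HP. specialize (C P HP). unfold filtermap in *. unfold within.
  revert C. apply filter_imp. intros y hy iy. now rewrite <- E.
Qed.

Hypothesis hab : a < b.

Lemma is_derive_on_unique {V : NormedModule R_AbsRing} (f : R -> V) (x : R) (l m : V) :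
  Icc a b x -> is_derive_on a b f x l -> is_derive_on a b f x m -> l = m.
Proof.
  intros hx Hl Hm. rewrite is_derive_on_iff in Hl, Hm by exact hx.
  cut (norm (minus l m) = 0).
  { intros h. apply minus_eq_zero_eq, norm_eq_zero, h. }
  apply Rle_antisym; [|apply norm_ge_0].
  apply le_epsilon. intros eps heps. rewrite Rplus_0_l.
  assert (he : 0 < eps / 2) by lra.
  destruct (filter_and _ _ (Hl (mkposreal _ he)) (Hm (mkposreal _ he))) as [d Hd].
  assert (exists y, Icc a b y /\ y <> x /\ Rabs (y - x) < d) as [y [hy [hne hd]]].
  (* The comparison point lies to the right of [x] unless [x = b], and then to the left; the minimum
     keeps it in the interval. *)
  { destruct d as [d hdp]. unfold Icc in *. simpl.
    destruct (Rlt_le_dec x b) as [h|h].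
    - exists (x + Rmin (d / 2) (b - x)).
      assert (0 < Rmin (d / 2) (b - x)) by (apply Rmin_glb_lt; lra).
      assert (Rmin (d / 2) (b - x) <= d / 2) by apply Rmin_l.
      assert (Rmin (d / 2) (b - x) <= b - x) by apply Rmin_r.
      repeat split; try lra. rewrite Rabs_pos_eq; lra.
    - exists (x - Rmin (d / 2) (x - a)).
      assert (0 < Rmin (d / 2) (x - a)) by (apply Rmin_glb_lt; lra).
      assert (Rmin (d / 2) (x - a) <= d / 2) by apply Rmin_l.
      assert (Rmin (d / 2) (x - a) <= x - a) by apply Rmin_r.
      repeat split; try lra. rewrite Rabs_left; lra. }
  destruct (Hd y hd) as [H1 H2]. specialize (H1 hy). specialize (H2 hy). simpl in H1, H2.
  set (u := minus (f y) (f x)) in *.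
  assert (hpos : 0 < Rabs (y - x)) by (apply Rabs_pos_lt; lra).
  change (norm (minus y x)) with (Rabs (y - x)) in H1, H2.
  (* The lower bound on the norm comes from applying [norm_scal] to the inverse scalar. *)
  assert (N : norm (scal (minus y x) (minus l m)) = Rabs (y - x) * norm (minus l m)).
  { apply Rle_antisym; [apply (norm_scal (minus y x))|].
    set (w := minus l m).
    assert (W : norm w <= Rabs (/ (y - x)) * norm (scal (minus y x) w)).
    { eapply Rle_trans; [|apply (norm_scal (/ (y - x)))].
      right. apply f_equal. rewrite scal_assoc. symmetry.
      etransitivity; [|exact (scal_one w)]. apply f_equal2; [|reflexivity].
      unfold mult, minus, plus, opp, one; simpl. field. lra. }
    rewrite Rabs_inv in W.
    apply Rmult_le_compat_l with (r := Rabs (y - x)) in W; [|lra].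
    rewrite <- Rmult_assoc, Rinv_r, Rmult_1_l in W by lra. exact W. }
  assert (S : norm (scal (minus y x) (minus l m)) <= eps * Rabs (y - x)).
  { replace (scal (minus y x) (minus l m)) with
      (minus (minus u (scal (minus y x) m)) (minus u (scal (minus y x) l))).
    - unfold minus at 1. eapply Rle_trans; [apply norm_triangle|]. rewrite norm_opp. lra.
    - rewrite minus_minus_cancel. symmetry.
      exact (scal_minus_distr_l (V := NormedModule.ModuleSpace R_AbsRing V) (minus y x) l m). }
  rewrite N in S. apply Rmult_le_reg_l with (Rabs (y - x)); lra.
Qed.

Lemma Derive_on_eq {V : NormedModule R_AbsRing} (f : R -> V) (x : R) (l : V) :
  Icc a b x -> is_derive_on a b f x l -> Derive_on a b f x = l.
Proof.
  intros hx H. apply (is_derive_on_unique f x _ _ hx); [|exact H].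
  unfold Derive_on. apply epsilon_spec. now exists l.
Qed.

End OneSidedDerivatives.

(** * Smooth functions on an interval *)

(** Dependent choice, used to assemble the sequence of all derivatives from the existence of one
    further derivative at each stage. *)
Lemma dependent_sequence {X : Type} (P : X -> Prop) (step : X -> X -> Prop) (x0 : X) :
  P x0 -> (forall x, P x -> exists y, P y /\ step x y) ->
  exists u : nat -> X, u O = x0 /\ forall n, step (u n) (u (S n)).
Proof.
  intros h0 hs.
  assert (hs' : forall x : {x | P x}, exists y : {x | P x}, step (proj1_sig x) (proj1_sig y)).
  { intros [x hx]. destruct (hs x hx) as [y [hy s]]. now exists (exist _ y hy). }
  set (next := fun x => proj1_sig (constructive_indefinite_description _ (hs' x))).
  set (u := fix u n := match n with O => exist P x0 h0 | S m => next (u m) end).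
  exists (fun n => proj1_sig (u n)). split; [reflexivity|].
  intros n. exact (proj2_sig (constructive_indefinite_description _ (hs' (u n)))).
Qed.

Section SmoothFunctions.
Variables (a b : R).

(** Smoothness by coinduction: it is enough to find a class that contains [f] and is stable under
    derivation. This spares explicit formulas for the higher derivatives of products and
    composites. *)
Lemma smooth_on_of_closed {V : NormedModule R_AbsRing} (C : (R -> V) -> Prop) (f : R -> V) :
  C f ->
  (forall f, C f -> exists f', C f' /\ forall x, Icc a b x -> is_derive_on a b f x (f' x)) ->
  smooth_on a b f.
Proof.
  intros hf hC.
  destruct (dependent_sequence C _ f hf hC) as [F [F0 HF]].
  exists F. split; [now rewrite F0|exact HF].
Qed.

Lemma smooth_on_of_derive {V : NormedModule R_AbsRing} (f g : R -> V) :
  (forall x, Icc a b x -> is_derive_on a b f x (g x)) -> smooth_on a b g ->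
  smooth_on a b f.
Proof.
  intros hf [F [F0 HF]].
  exists (fun n => match n with O => f | S m => F m end). split; [reflexivity|].
  intros [|n] x hx; [|auto]. rewrite F0; auto.
Qed.

Lemma smooth_on_ext {V : NormedModule R_AbsRing} (f g : R -> V) :
  (forall x, Icc a b x -> f x = g x) -> smooth_on a b f -> smooth_on a b g.
Proof.
  intros e [F [F0 HF]]. exists F. split; [|exact HF].
  intros x hx. rewrite F0, e; auto.
Qed.

Lemma smooth_on_ext_R (f g : R -> R) :
  (forall x, Icc a b x -> f x = g x) -> smooth_on a b f -> smooth_on a b g.
Proof. apply smooth_on_ext. Qed.

Lemma smooth_on_const {V : NormedModule R_AbsRing} (c : V) : smooth_on a b (fun _ => c).
Proof.
  exists (fun n _ => match n with O => c | S _ => zero end). split; [reflexivity|].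
  intros [|n] x hx; now apply is_derive_on_const.
Qed.

Lemma smooth_on_pair {U V : NormedModule R_AbsRing} (f : R -> U) (g : R -> V) :
  smooth_on a b f -> smooth_on a b g -> smooth_on a b (fun x => (f x, g x)).
Proof.
  intros [F [F0 HF]] [G [G0 HG]]. exists (fun n x => (F n x, G n x)). split.
  - intros x hx. now rewrite F0, G0.
  - intros n x hx. apply is_derive_on_pair; auto.
Qed.

Lemma smooth_on_fst {U V : NormedModule R_AbsRing} (f : R -> U * V) :
  smooth_on a b f -> smooth_on a b (fun x => fst (f x)).
Proof.
  intros [F [F0 HF]]. exists (fun n x => fst (F n x)). split.
  - intros x hx. now rewrite F0.
  - intros n x hx. apply (is_derive_on_fst a b (F n) x (F (S n) x)); auto.
Qed.

Lemma smooth_on_snd {U V : NormedModule R_AbsRing} (f : R -> U * V) :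
  smooth_on a b f -> smooth_on a b (fun x => snd (f x)).
Proof.
  intros [F [F0 HF]]. exists (fun n x => snd (F n x)). split.
  - intros x hx. now rewrite F0.
  - intros n x hx. apply (is_derive_on_snd a b (F n) x (F (S n) x)); auto.
Qed.

(* Contains the smooth functions and is closed under algebra and under substitution into
   functions [H 0] that have derivatives [H n] of all orders on [D]; being closed under
   derivation, it consists of smooth functions. *)
Inductive smooth_closure : (R -> R) -> Prop :=
| smooth_closure_base f : smooth_on a b f -> smooth_closure f
| smooth_closure_plus f g :
    smooth_closure f -> smooth_closure g -> smooth_closure (fun x => f x + g x)
| smooth_closure_mult f g :
    smooth_closure f -> smooth_closure g -> smooth_closure (fun x => f x * g x)
| smooth_closure_comp (D : R -> Prop) (H : nat -> R -> R) (n : nat) f :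
    (forall m y, D y -> is_derive (H m) y (H (S m) y)) ->
    (forall x, Icc a b x -> D (f x)) ->
    smooth_closure f -> smooth_closure (fun x => H n (f x)).

Lemma smooth_on_closure (f : R -> R) : smooth_closure f -> smooth_on a b f.
Proof.
  intros hf. apply (smooth_on_of_closed smooth_closure); [exact hf|].
  clear f hf. intros f hf. induction hf as
    [f [F [F0 HF]]|f g _ [f' [cf' df']] _ [g' [cg' dg']]
    |f g cf [f' [cf' df']] cg [g' [cg' dg']]|D H n f dH hD cf [f' [cf' df']]].
  - exists (F 1%nat). split.
    + apply smooth_closure_base. exists (fun n => F (S n)). split; auto.
    + intros x hx. apply (is_derive_on_ext a b (F O)); auto.
  - exists (fun x => f' x + g' x). split; [now apply smooth_closure_plus|].
    intros x hx. apply (is_derive_on_plus a b f g); auto.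
  - exists (fun x => f' x * g x + f x * g' x). split.
    + apply smooth_closure_plus; now apply smooth_closure_mult.
    + intros x hx. apply is_derive_on_mult; auto.
  - exists (fun x => f' x * H (S n) (f x)). split.
    + apply smooth_closure_mult; [exact cf'|]. now apply (smooth_closure_comp D H (S n) f).
    + intros x hx. apply (is_derive_on_comp a b (H n) f); auto.
Qed.

Lemma smooth_on_plus (f g : R -> R) :
  smooth_on a b f -> smooth_on a b g -> smooth_on a b (fun x => f x + g x).
Proof.
  intros hf hg. apply smooth_on_closure, smooth_closure_plus; now apply smooth_closure_base.
Qed.

Lemma smooth_on_mult (f g : R -> R) :
  smooth_on a b f -> smooth_on a b g -> smooth_on a b (fun x => f x * g x).
Proof.
  intros hf hg. apply smooth_on_closure, smooth_closure_mult; now apply smooth_closure_base.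
Qed.

Lemma smooth_on_comp (D : R -> Prop) (H : nat -> R -> R) (f : R -> R) :
  (forall m y, D y -> is_derive (H m) y (H (S m) y)) ->
  (forall x, Icc a b x -> D (f x)) ->
  smooth_on a b f -> smooth_on a b (fun x => H O (f x)).
Proof.
  intros hH hD hf. apply smooth_on_closure. apply (smooth_closure_comp D H O f); auto.
  now apply smooth_closure_base.
Qed.

Lemma smooth_on_opp (f : R -> R) : smooth_on a b f -> smooth_on a b (fun x => - f x).
Proof.
  intros hf. apply (smooth_on_ext_R (fun x => -1 * f x)); [intros; ring|].
  apply smooth_on_mult; [apply (smooth_on_const (V := R_NormedModule))|exact hf].
Qed.

Lemma smooth_on_minus (f g : R -> R) :
  smooth_on a b f -> smooth_on a b g -> smooth_on a b (fun x => f x - g x).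
Proof. intros hf hg. apply smooth_on_plus; [exact hf|now apply smooth_on_opp]. Qed.

Lemma smooth_on_inv (f : R -> R) :
  (forall x, Icc a b x -> f x <> 0) -> smooth_on a b f -> smooth_on a b (fun x => / f x).
Proof.
  intros h hf.
  (* [c n] is (-1)^n n!, so that [H n] is the n-th derivative of 1/y. *)
  set (c := fix c n := match n with O => 1 | S m => - (c m * INR (S m)) end).
  set (H := fun n y => c n * (/ y) ^ S n).
  apply (smooth_on_ext_R (fun x => H O (f x))); [intros; unfold H; simpl; ring|].
  apply (smooth_on_comp (fun y => y <> 0)); [|exact h|exact hf].
  intros m y hy. unfold H. auto_derive; [exact hy|].
  change (Init.Nat.pred (S m)) with m. change (c (S m)) with (- (c m * INR (S m))).
  rewrite <- !tech_pow_Rmult. change (match m with O => 1 | S _ => INR m + 1 end) with (INR (S m)).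
  field. exact hy.
Qed.

Lemma smooth_on_sqrt (f : R -> R) :
  (forall x, Icc a b x -> 0 < f x) -> smooth_on a b f -> smooth_on a b (fun x => sqrt (f x)).
Proof.
  intros h hf.
  (* [c n] is the falling product (1/2)(1/2 - 1)...(1/2 - n + 1), so that [H n] is the n-th
     derivative of the square root. *)
  set (c := fix c n := match n with O => 1 | S m => c m * (1 / 2 - INR m) end).
  set (H := fun n y => c n * sqrt y * (/ y) ^ n).
  apply (smooth_on_ext_R (fun x => H O (f x))); [intros; unfold H; simpl; ring|].
  apply (smooth_on_comp (fun y => 0 < y)); [|exact h|exact hf].
  intros m y hy. unfold H.
  assert (hs : sqrt y <> 0) by (apply Rgt_not_eq, sqrt_lt_R0, hy).
  auto_derive; [repeat split; lra|].
  assert (e : / (2 * sqrt y) = sqrt y * / y / 2).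
  { rewrite <- (sqrt_sqrt y) at 3 by lra. field. exact hs. }
  rewrite e. change (c (S m)) with (c m * (1 / 2 - INR m)).
  destruct m as [|m]; simpl pow.
  - simpl. field. lra.
  - change (Init.Nat.pred (S m)) with m. field. lra.
Qed.

Lemma smooth_on_cos (f : R -> R) : smooth_on a b f -> smooth_on a b (fun x => cos (f x)).
Proof.
  intros hf.
  (* Each derivative of the cosine is a shift by a quarter turn. *)
  set (H := fun n y => cos (y + INR n * (PI / 2))).
  apply (smooth_on_ext_R (fun x => H O (f x))).
  { intros. unfold H. f_equal. simpl. ring. }
  apply (smooth_on_comp (fun _ => True)); [|auto|exact hf].
  intros m y _. unfold H. auto_derive; [exact I|].
  rewrite S_INR. replace (y + (INR m + 1) * (PI / 2)) with (PI / 2 + (y + INR m * (PI / 2))) by ring.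
  rewrite sin_cos. ring.
Qed.

Lemma smooth_on_sin (f : R -> R) : smooth_on a b f -> smooth_on a b (fun x => sin (f x)).
Proof.
  intros hf. apply (smooth_on_ext_R (fun x => - cos (PI / 2 + f x))).
  { intros. symmetry. apply sin_cos. }
  apply smooth_on_opp, smooth_on_cos, smooth_on_plus; [|exact hf].
  apply (smooth_on_const (V := R_NormedModule)).
Qed.

(** * Continuity, primitives and integrals of smooth functions on the interval *)

Hypothesis hab : a < b.

Lemma smooth_on_is_derive {V : NormedModule R_AbsRing} (f : R -> V) (x : R) :
  smooth_on a b f -> Icc a b x -> is_derive_on a b f x (Derive_on a b f x).
Proof.
  intros [F [F0 HF]] hx. unfold Derive_on. apply epsilon_spec. exists (F 1%nat x).
  apply (is_derive_on_ext a b (F O)); auto.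
Qed.

Lemma smooth_on_Derive {V : NormedModule R_AbsRing} (f : R -> V) :
  smooth_on a b f -> smooth_on a b (Derive_on a b f).
Proof.
  intros [F [F0 HF]]. exists (fun n => F (S n)). split; [|auto].
  intros x hx. symmetry. apply Derive_on_eq; [exact hab|exact hx|].
  apply (is_derive_on_ext a b (F O)); auto.
Qed.

(** The retraction of the line onto the interval. Composing with it replaces relative continuity by
    continuity on the whole line without changing integrals over the interval. *)
Definition clamp (x : R) : R := Rmax a (Rmin b x).

Lemma clamp_Icc (x : R) : Icc a b (clamp x).
Proof.
  unfold clamp, Icc. split; [apply Rmax_l|]. apply Rmax_lub; [lra|apply Rmin_l].
Qed.

Lemma clamp_id (x : R) : Icc a b x -> clamp x = x.
Proof. intros [h1 h2]. unfold clamp. rewrite Rmin_right, Rmax_right; lra. Qed.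

Lemma clamp_lipschitz (x y : R) : Rabs (clamp y - clamp x) <= Rabs (y - x).
Proof.
  unfold clamp, Rmax, Rmin.
  repeat destruct (Rle_dec _ _); unfold Rabs; repeat destruct (Rcase_abs _); lra.
Qed.

Lemma continuous_clamp (x : R) : continuous clamp x.
Proof.
  intros P [e He]. exists e. intros y hy. apply He.
  eapply Rle_lt_trans; [apply clamp_lipschitz|exact hy].
Qed.

Lemma continuous_comp_clamp {V : UniformSpace} (f : R -> V) (x : R) :
  filterlim f (within (Icc a b) (locally (clamp x))) (locally (f (clamp x))) ->
  continuous (fun y => f (clamp y)) x.
Proof.
  intros H P HP. specialize (H P HP). unfold filtermap, within in *.
  generalize (continuous_clamp x _ H). unfold filtermap. apply filter_imp.
  intros y hy. apply hy, clamp_Icc.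
Qed.

Lemma smooth_on_continuous (f : R -> R) (x : R) :
  smooth_on a b f -> continuous (fun y => f (clamp y)) x.
Proof.
  intros hf. apply continuous_comp_clamp.
  apply (is_derive_on_continuous (V := R_NormedModule) a b f (clamp x) (Derive_on a b f (clamp x)) (clamp_Icc x)).
  apply smooth_on_is_derive; [exact hf|apply clamp_Icc].
Qed.

(** The function is [f] continued by its tangent lines at the two ends: inside the interval the
    correction term is zero, outside it is the linear part. Unlike [is_derive_on_extend], one
    extension serves all points, so the mean value theorem and the fundamental theorem of calculus
    apply to it. *)
Lemma is_derive_affine_extension (f df : R -> R) (x : R) :
  (forall y, Icc a b y -> is_derive_on a b f y (df y)) ->
  is_derive (fun y => f (clamp y) + (y - clamp y) * df (clamp y)) x (df (clamp x)).
Proof.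
  intros Hf.
  assert (C : forall x, (x < a /\ clamp x = a) \/ Icc a b x \/ (b < x /\ clamp x = b)).
  { intros y. destruct (Rlt_le_dec y a) as [h|h]; [|destruct (Rlt_le_dec b y) as [k|k]].
    - left. split; [exact h|]. unfold clamp. rewrite Rmin_right, Rmax_left; lra.
    - right. right. split; [exact k|]. unfold clamp. rewrite Rmin_left, Rmax_right; lra.
    - right. left. now split. }
  assert (near : forall (P : R -> Prop) d, 0 < d ->
    (forall y, Rabs (y - x) < d -> P y) -> locally x P).
  { intros P d hd HP. exists (mkposreal d hd). exact HP. }
  assert (aff : forall u v w : R, is_derive (fun y => u + (y - v) * w) x w).
  { intros u v w. auto_derive; [exact I|ring]. }
  destruct (C x) as [[h e]|[h|[h e]]].
  - rewrite e. apply (is_derive_ext_loc (fun y => f a + (y - a) * df a)); [|apply aff].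
    apply (near _ (a - x)); [lra|]. intros y hy.
    destruct (C y) as [[k e']|[k|[k e']]];
      [now rewrite e'|unfold Icc in k|]; apply Rabs_def2 in hy; lra.
  - rewrite (clamp_id x h).
    destruct (is_derive_on_extend a b f x (df x) h (Hf x h)) as [g [Eg Hg]].
    split; [apply is_linear_scal_l|]. intros z Hz.
    pose proof
    (is_filter_lim_locally_unique (K := R_AbsRing) (V := R_NormedModule) x z Hz).
    subst z. intros eps.
    assert (L : forall u v w : R, is_domin (Ku := R_AbsRing) (Kv := R_AbsRing) (locally x)
      (fun y : R => minus y x)
      (fun y => minus (minus (u + (y - v) * w) (u + (x - v) * w)) (scal (minus y x) w))).
    { intros u v w. apply (proj2 (aff u v w) x Hz). }
    generalize (filter_and _ _ (proj2 Hg x Hz eps) (filter_and _ _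
      (L (f a) a (df a) eps) (L (f b) b (df b) eps))).
    (* Close to [x], points beyond an end of the interval occur only if [x] is that end; there the
       tangent line at [x] is used. *)
    assert (away : locally x (fun y => (y < a -> x = a) /\ (b < y -> x = b))).
    { unfold Icc in h.
      destruct (Req_dec x a) as [ea|na]; destruct (Req_dec x b) as [eb|nb].
      - apply filter_forall. auto.
      - apply (near _ (b - x)); [lra|]. intros y hy. apply Rabs_def2 in hy. split; lra.
      - apply (near _ (x - a)); [lra|]. intros y hy. apply Rabs_def2 in hy. split; lra.
      - apply (near _ (Rmin (x - a) (b - x))); [apply Rmin_glb_lt; lra|].
        intros y hy. pose proof (Rmin_l (x - a) (b - x)). pose proof (Rmin_r (x - a) (b - x)).
        apply Rabs_def2 in hy. split; lra. }
    intros H. generalize (filter_and _ _ away H). apply filter_imp.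
    intros y [[wa wb] [Ha [Hb Hc]]]. rewrite (clamp_id x h).
    destruct (C y) as [[k e']|[k|[k e']]].
    + rewrite e'. specialize (wa k). subst x. exact Hb.
    + rewrite (clamp_id y k). rewrite !Eg in Ha by assumption.
      replace (f y + (y - y) * df y) with (f y) by ring.
      replace (f x + (x - x) * df x) with (f x) by ring. exact Ha.
    + rewrite e'. specialize (wb k). subst x. exact Hc.
  - rewrite e. apply (is_derive_ext_loc (fun y => f b + (y - b) * df b)); [|apply aff].
    apply (near _ (x - b)); [lra|]. intros y hy.
    destruct (C y) as [[k e']|[k|[k e']]];
      [|unfold Icc in k|now rewrite e']; apply Rabs_def2 in hy; lra.
Qed.

Lemma is_derive_on_zero_const (f : R -> R) (x y : R) :
  (forall z, Icc a b z -> is_derive_on a b f z 0) -> Icc a b x -> Icc a b y -> f x = f y.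
Proof.
  intros Hf.
  assert (lt : forall u v, u < v -> Icc a b u -> Icc a b v -> f u = f v).
  { intros u v huv hu hv.
    pose proof (eq_is_derive (V := R_NormedModule)
      (fun y => f (clamp y) + (y - clamp y) * 0) u v
      (fun t _ => is_derive_affine_extension f (fun _ => 0) t Hf) huv) as E.
    simpl in E. rewrite !clamp_id in E by assumption. lra. }
  intros hx hy. destruct (Rtotal_order x y) as [h|[h|h]].
  - now apply lt.
  - now rewrite h.
  - symmetry. now apply lt.
Qed.

Lemma RInt_clamp (f : R -> R) : RInt (fun y => f (clamp y)) a b = RInt f a b.
Proof.
  apply RInt_ext. intros x. rewrite Rmin_left, Rmax_right by lra. intros hx.
  now rewrite clamp_id by (unfold Icc; lra).
Qed.

Lemma ex_RInt_smooth (f : R -> R) : smooth_on a b f -> ex_RInt f a b.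
Proof.
  intros hf. apply (ex_RInt_ext (fun y => f (clamp y))).
  - intros x. rewrite Rmin_left, Rmax_right by lra. intros hx.
    now rewrite clamp_id by (unfold Icc; lra).
  - apply (ex_RInt_continuous (V := R_CompleteNormedModule)).
    intros z _. now apply smooth_on_continuous.
Qed.

Lemma RInt_derive_on (f df : R -> R) :
  (forall x, Icc a b x -> is_derive_on a b f x (df x)) -> smooth_on a b df ->
  RInt df a b = f b - f a.
Proof.
  intros Hf Hdf. rewrite <- RInt_clamp. apply is_RInt_unique.
  pose proof (is_RInt_derive (V := R_CompleteNormedModule)
    (fun y => f (clamp y) + (y - clamp y) * df (clamp y)) (fun y => df (clamp y)) a b
    (fun x _ => is_derive_affine_extension f df x Hf)
    (fun x _ => smooth_on_continuous df x Hdf)) as H.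
  assert (Icc a b a /\ Icc a b b) as [ia ib] by (unfold Icc; lra).
  cbv beta in H. rewrite (clamp_id a ia), (clamp_id b ib) in H.
  replace (f b - f a) with (minus (f b + (b - b) * df b) (f a + (a - a) * df a)); [exact H|].
  unfold minus, plus, opp; simpl. ring.
Qed.

Lemma smooth_on_primitive (f : R -> R) : smooth_on a b f ->
  exists F, smooth_on a b F /\ F a = 0 /\ forall x, Icc a b x -> is_derive_on a b F x (f x).
Proof.
  intros hf. exists (fun x => RInt (fun y => f (clamp y)) a x).
  assert (D : forall x, Icc a b x ->
    is_derive_on a b (fun x => RInt (fun y => f (clamp y)) a x) x (f x)).
  { intros x hx. apply is_derive_on_of_is_derive; [exact hx|].
    replace (f x) with (f (clamp x)) by now rewrite clamp_id.
    apply (is_derive_RInt (V := R_NormedModule) (fun y => f (clamp y)) _ a x).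
    - apply filter_forall. intros z. apply (RInt_correct (V := R_CompleteNormedModule)).
      apply (ex_RInt_continuous (V := R_CompleteNormedModule)).
      intros; now apply smooth_on_continuous.
    - now apply smooth_on_continuous. }
  split; [now apply (smooth_on_of_derive _ f)|]. split; [|exact D].
  apply (RInt_point (V := R_CompleteNormedModule)).
Qed.

End SmoothFunctions.

Lemma is_derive_on_restrict {V : NormedModule R_AbsRing} (a b a' b' : R) (f : R -> V)
    (x : R) (l : V) :
  a <= a' -> b' <= b -> Icc a' b' x -> is_derive_on a b f x l -> is_derive_on a' b' f x l.
Proof.
  intros ha hb hx H. assert (ix : Icc a b x) by (unfold Icc in *; lra).
  rewrite is_derive_on_iff in H |- * by assumption. intros eps. generalize (H eps).
  apply filter_imp. intros y K hy. apply K. unfold Icc in *. lra.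
Qed.

(** The primitive vanishing at [a] also vanishes at [b] because the total integral is zero, and it
    is constant where [f] is zero, hence zero on both outer pieces. *)
Lemma smooth_on_compact_primitive (a b c d : R) (f : R -> R) :
  a < c -> d < b -> c <= d -> smooth_on a b f ->
  (forall x, Icc a b x -> x < c \/ d < x -> f x = 0) -> RInt f a b = 0 ->
  exists F, smooth_on a b F /\ (forall x, Icc a b x -> is_derive_on a b F x (f x)) /\
    forall x, Icc a b x -> x < c \/ d < x -> F x = 0.
Proof.
  intros hc hd hcd sf hf h0. assert (hab : a < b) by lra.
  destruct (smooth_on_primitive a b hab f sf) as [F [sF [Fa dF]]].
  exists F. split; [exact sF|]. split; [exact dF|].
  assert (Fb : F b = 0) by (pose proof (RInt_derive_on a b hab F f dF sf); lra).
  intros x hx [h|h].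
  - destruct (Req_dec x a) as [e|ne]; [now rewrite e|]. rewrite <- Fa.
    assert (hax : a < x) by (unfold Icc in hx; lra).
    apply (is_derive_on_zero_const a x hax); [|unfold Icc; lra|unfold Icc; lra].
    intros z hz. apply (is_derive_on_restrict a b); [lra|apply hx|exact hz|].
    assert (iz : Icc a b z) by (unfold Icc in *; lra).
    rewrite <- (hf z iz); [now apply dF|unfold Icc in hz; lra].
  - destruct (Req_dec x b) as [e|ne]; [now rewrite e|]. rewrite <- Fb.
    assert (hxb : x < b) by (unfold Icc in hx; lra).
    apply (is_derive_on_zero_const x b hxb); [|unfold Icc; lra|unfold Icc; lra].
    intros z hz. apply (is_derive_on_restrict a b); [apply hx|lra|exact hz|].
    assert (iz : Icc a b z) by (unfold Icc in *; lra).
    rewrite <- (hf z iz); [now apply dF|unfold Icc in hz; lra].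
Qed.

(** * Vector calculus and orthonormal frames *)

Lemma pair3_eq (u v : R * R * R) :
  fst (fst u) = fst (fst v) -> snd (fst u) = snd (fst v) -> snd u = snd v -> u = v.
Proof. destruct u as [[? ?] ?], v as [[? ?] ?]; simpl; congruence. Qed.

Ltac unfold_vectors :=
  unfold det3, cross, dot3, dot2, J, minus; simpl;
  repeat (progress unfold plus, scal, mult, opp, zero; simpl).

(* The structures of Coquelicot can leave an equation at a type only convertible to [R]. *)
Ltac eq_in_R := match goal with |- ?l = ?r => change (@eq R l r) end.

Ltac vector_ring :=
  intros; try apply pair3_eq;
  unfold_vectors; ring.

Lemma dot3_comm (u v : R * R * R) : dot3 u v = dot3 v u.
Proof. vector_ring. Qed.

Lemma dot3_plus_l (u v w : R * R * R) : dot3 (plus u v) w = dot3 u w + dot3 v w.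
Proof. vector_ring. Qed.

Lemma dot3_scal_l (k : R) (u w : R * R * R) : dot3 (scal k u) w = k * dot3 u w.
Proof. vector_ring. Qed.

Lemma dot3_opp_l (u w : R * R * R) : dot3 (opp u) w = - dot3 u w.
Proof. vector_ring. Qed.

Lemma dot3_plus_r (u v w : R * R * R) : dot3 w (plus u v) = dot3 w u + dot3 w v.
Proof. vector_ring. Qed.

Lemma dot3_scal_r (k : R) (u w : R * R * R) : dot3 w (scal k u) = k * dot3 w u.
Proof. vector_ring. Qed.

Lemma dot3_opp_r (u w : R * R * R) : dot3 w (opp u) = - dot3 w u.
Proof. vector_ring. Qed.

Lemma dot3_zero_l (u : R * R * R) : dot3 zero u = 0.
Proof. vector_ring. Qed.

Lemma dot3_self_ge_0 (u : R * R * R) : 0 <= dot3 u u.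
Proof. unfold dot3. nra. Qed.

Lemma dot3_self_eq_0 (u : R * R * R) : dot3 u u = 0 -> u = zero.
Proof.
  destruct u as [[x y] z]. unfold dot3; simpl. intros h.
  apply pair3_eq; simpl; unfold zero; simpl; nra.
Qed.

Lemma norm3_eq_1 (u : R * R * R) : norm3 u = 1 -> dot3 u u = 1.
Proof.
  unfold norm3. intros h. rewrite <- (sqrt_sqrt (dot3 u u)), h by apply dot3_self_ge_0. ring.
Qed.

(* Triple product expansion of [n x (w x n)] for [n = u x v]. *)
Lemma cross_expand (u v w : R * R * R) :
  scal (dot3 u u * dot3 v v - dot3 u v * dot3 u v) w =
  plus (plus (scal (dot3 w u * dot3 v v - dot3 w v * dot3 u v) u)
             (scal (dot3 w v * dot3 u u - dot3 w u * dot3 u v) v))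
       (scal (dot3 w (cross u v)) (cross u v)).
Proof. vector_ring. Qed.

Lemma cos_sin_of_unit (x y : R) : x * x + y * y = 1 -> exists t, cos t = x /\ sin t = y.
Proof.
  intros h. assert (hx : -1 <= x <= 1) by nra.
  assert (hs : sqrt (1 - x²) = Rabs y).
  { rewrite <- sqrt_Rsqr_abs. f_equal. unfold Rsqr. lra. }
  destruct (Rle_lt_dec 0 y) as [hy|hy].
  - exists (acos x). rewrite cos_acos, sin_acos, hs, Rabs_pos_eq; auto.
  - exists (- acos x). rewrite cos_neg, sin_neg, cos_acos, sin_acos, hs, Rabs_left; auto.
    split; [auto|ring].
Qed.

Lemma cos_sin_of_diff (x y : R) :
  sin (x - y) = 0 -> cos (x - y) = 1 -> cos x = cos y /\ sin x = sin y.
Proof.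
  intros hs hc. replace x with (y + (x - y)) by ring.
  rewrite cos_plus, sin_plus, hs, hc. split; ring.
Qed.

Section OrthonormalFrame.
Variables (T M1 M2 : R * R * R).
Hypotheses (hT : dot3 T T = 1) (hM : dot3 M1 M1 = 1) (hMT : dot3 M1 T = 0).
Hypothesis hM2 : M2 = cross T M1.

Lemma frame_dot_M2_M2 : dot3 M2 M2 = 1.
Proof.
  subst M2. transitivity (dot3 T T * dot3 M1 M1 - dot3 M1 T * dot3 M1 T); [vector_ring|].
  rewrite hT, hM, hMT. ring.
Qed.

Lemma frame_dot_M2_T : dot3 M2 T = 0.
Proof. subst M2. vector_ring. Qed.

Lemma frame_dot_M1_M2 : dot3 M1 M2 = 0.
Proof. subst M2. vector_ring. Qed.

Lemma frame_cross_T_M2 : cross T M2 = opp M1.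
Proof.
  subst M2. transitivity (minus (scal (dot3 M1 T) T) (scal (dot3 T T) M1)); [vector_ring|].
  rewrite hT, hMT. vector_ring.
Qed.

Lemma frame_expand (w : R * R * R) :
  w = plus (plus (scal (dot3 w T) T) (scal (dot3 w M1) M1)) (scal (dot3 w M2) M2).
Proof.
  pose proof (cross_expand T M1 w) as E. rewrite hT, hM, (dot3_comm T M1), hMT, <- hM2 in E.
  replace (1 * 1 - 0 * 0) with 1 in E by ring.
  replace (dot3 w T * 1 - dot3 w M1 * 0) with (dot3 w T) in E by ring.
  replace (dot3 w M1 * 1 - dot3 w T * 0) with (dot3 w M1) in E by ring.
  rewrite <- E. vector_ring.
Qed.

Lemma frame_dot (u w : R * R * R) :
  dot3 u w = dot3 u T * dot3 w T + dot3 u M1 * dot3 w M1 + dot3 u M2 * dot3 w M2.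
Proof.
  rewrite (frame_expand w) at 1. rewrite !dot3_plus_r, !dot3_scal_r. ring.
Qed.

Lemma frame_unit_angle (w : R * R * R) :
  dot3 w w = 1 -> dot3 w T = 0 ->
  exists t, w = plus (scal (cos t) M1) (scal (sin t) M2).
Proof.
  intros hw hwT. rewrite frame_dot, hwT in hw.
  destruct (cos_sin_of_unit (dot3 w M1) (dot3 w M2)) as [t [hc hs]]; [lra|].
  exists t. rewrite (frame_expand w) at 1. rewrite hwT, hc, hs. vector_ring.
Qed.

End OrthonormalFrame.

Lemma is_derive_affine (u v : R * R * R) (t : R) :
  is_derive (fun s => plus u (scal s v)) t v.
Proof.
  assert (D : forall p q : R, is_derive (fun s => p + s * q) t q).
  { intros p q. auto_derive; [exact I|ring]. }
  destruct u as [[u1 u2] u3], v as [[v1 v2] v3].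
  exact (is_derive_pair _ _ t _ _ (is_derive_pair _ _ t _ _ (D u1 v1) (D u2 v2)) (D u3 v3)).
Qed.

Section VectorCalculus.
Variables (a b : R).

Lemma is_derive_on_eq {V : NormedModule R_AbsRing} (f : R -> V) (x : R) (l m : V) :
  is_derive_on a b f x l -> l = m -> is_derive_on a b f x m.
Proof. now intros H <-. Qed.

Lemma is_derive_on_eq_R (f : R -> R) (x l m : R) :
  is_derive_on a b f x l -> l = m -> is_derive_on a b f x m.
Proof. now intros H <-. Qed.

Lemma is_derive_on_plus_R (f g : R -> R) (x l m : R) :
  Icc a b x -> is_derive_on a b f x l -> is_derive_on a b g x m ->
  is_derive_on a b (fun y => f y + g y) x (l + m).
Proof. apply (is_derive_on_plus a b f g). Qed.

Lemma is_derive_on_opp_R (f : R -> R) (x l : R) :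
  Icc a b x -> is_derive_on a b f x l -> is_derive_on a b (fun y => - f y) x (- l).
Proof.
  intros hx hf. apply (is_derive_on_ext a b (fun y => -1 * f y)); [exact hx| |].
  - intros y _. simpl. ring.
  - eapply is_derive_on_eq_R; [apply (is_derive_on_mult a b (fun _ => -1) f x 0 l hx)|].
    + apply (is_derive_on_const (V := R_NormedModule) a b (-1) x hx).
    + exact hf.
    + ring.
Qed.

Lemma is_derive_on_components (f : R -> R * R * R) (x : R) (l : R * R * R) :
  Icc a b x ->
  is_derive_on a b f x l <->
  is_derive_on a b (fun y => fst (fst (f y))) x (fst (fst l)) /\
  is_derive_on a b (fun y => snd (fst (f y))) x (snd (fst l)) /\
  is_derive_on a b (fun y => snd (f y)) x (snd l).
Proof.
  intros hx. split.
  - intros H.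
    pose proof (is_derive_on_fst a b f x l hx H) as H1.
    split; [apply (is_derive_on_fst a b _ x _ hx H1)|].
    split; [apply (is_derive_on_snd a b _ x _ hx H1)|].
    apply (is_derive_on_snd a b f x l hx H).
  - intros [H1 [H2 H3]].
    pose proof (is_derive_on_pair a b _ _ x _ _ hx (is_derive_on_pair a b _ _ x _ _ hx H1 H2) H3)
      as H. simpl in H.
    destruct l as [[l1 l2] l3]. simpl in H. revert H.
    apply is_derive_on_ext; [exact hx|]. intros y _. now destruct (f y) as [[? ?] ?].
Qed.

Lemma smooth_on_components (f : R -> R * R * R) :
  smooth_on a b f <->
  smooth_on a b (fun y => fst (fst (f y))) /\
  smooth_on a b (fun y => snd (fst (f y))) /\ smooth_on a b (fun y => snd (f y)).
Proof.
  split.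
  - intros H. pose proof (smooth_on_fst a b f H) as H1.
    split; [apply (smooth_on_fst a b _ H1)|].
    split; [apply (smooth_on_snd a b _ H1)|]. apply (smooth_on_snd a b f H).
  - intros [H1 [H2 H3]].
    pose proof (smooth_on_pair a b _ _ (smooth_on_pair a b _ _ H1 H2) H3) as H.
    revert H. apply smooth_on_ext. intros y _. now destruct (f y) as [[? ?] ?].
Qed.

Lemma is_derive_on_dot3 (f g : R -> R * R * R) (x : R) (l m : R * R * R) :
  Icc a b x -> is_derive_on a b f x l -> is_derive_on a b g x m ->
  is_derive_on a b (fun y => dot3 (f y) (g y)) x (dot3 l (g x) + dot3 (f x) m).
Proof.
  intros hx Hf Hg.
  apply (is_derive_on_components f x l hx) in Hf. destruct Hf as [f1 [f2 f3]].
  apply (is_derive_on_components g x m hx) in Hg. destruct Hg as [g1 [g2 g3]].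
  eapply is_derive_on_eq_R.
  - apply is_derive_on_plus_R; [exact hx| |].
    + apply is_derive_on_plus_R; [exact hx| |];
        apply is_derive_on_mult; [exact hx|exact f1|exact g1|exact hx|exact f2|exact g2].
    + apply is_derive_on_mult; [exact hx|exact f3|exact g3].
  - unfold dot3. simpl. ring.
Qed.

Lemma is_derive_on_minor (f g h k : R -> R) (x f' g' h' k' : R) :
  Icc a b x -> is_derive_on a b f x f' -> is_derive_on a b g x g' ->
  is_derive_on a b h x h' -> is_derive_on a b k x k' ->
  is_derive_on a b (fun y => f y * g y - h y * k y) x
    (f' * g x - h' * k x + (f x * g' - h x * k')).
Proof.
  intros hx Hf Hg Hh Hk. eapply is_derive_on_eq_R.
  - apply is_derive_on_plus_R; [exact hx| |apply is_derive_on_opp_R; [exact hx|]];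
      apply is_derive_on_mult; eassumption.
  - ring.
Qed.

Lemma is_derive_on_cross (f g : R -> R * R * R) (x : R) (l m : R * R * R) :
  Icc a b x -> is_derive_on a b f x l -> is_derive_on a b g x m ->
  is_derive_on a b (fun y => cross (f y) (g y)) x (plus (cross l (g x)) (cross (f x) m)).
Proof.
  intros hx Hf Hg.
  apply (is_derive_on_components f x l hx) in Hf. destruct Hf as [f1 [f2 f3]].
  apply (is_derive_on_components g x m hx) in Hg. destruct Hg as [g1 [g2 g3]].
  apply is_derive_on_components; [exact hx|].
  split; [|split]; simpl; now apply is_derive_on_minor.
Qed.

Lemma is_derive_on_scal (c : R -> R) (f : R -> R * R * R) (x dc : R) (l : R * R * R) :
  Icc a b x -> is_derive_on a b c x dc -> is_derive_on a b f x l ->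
  is_derive_on a b (fun y => scal (c y) (f y)) x (plus (scal dc (f x)) (scal (c x) l)).
Proof.
  intros hx Hc Hf.
  apply (is_derive_on_components f x l hx) in Hf. destruct Hf as [f1 [f2 f3]].
  apply is_derive_on_components; [exact hx|].
  split; [|split]; simpl; now apply is_derive_on_mult.
Qed.

Lemma smooth_on_dot3 (f g : R -> R * R * R) :
  smooth_on a b f -> smooth_on a b g -> smooth_on a b (fun x => dot3 (f x) (g x)).
Proof.
  intros Hf Hg.
  apply smooth_on_components in Hf. destruct Hf as [f1 [f2 f3]].
  apply smooth_on_components in Hg. destruct Hg as [g1 [g2 g3]].
  unfold dot3. apply smooth_on_plus; [apply smooth_on_plus|]; now apply smooth_on_mult.
Qed.

Lemma smooth_on_cross (f g : R -> R * R * R) :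
  smooth_on a b f -> smooth_on a b g -> smooth_on a b (fun x => cross (f x) (g x)).
Proof.
  intros Hf Hg.
  apply smooth_on_components in Hf. destruct Hf as [f1 [f2 f3]].
  apply smooth_on_components in Hg. destruct Hg as [g1 [g2 g3]].
  apply smooth_on_components.
  split; [|split]; simpl; apply smooth_on_minus; now apply smooth_on_mult.
Qed.

Lemma smooth_on_scal (c : R -> R) (f : R -> R * R * R) :
  smooth_on a b c -> smooth_on a b f -> smooth_on a b (fun x => scal (c x) (f x)).
Proof.
  intros Hc Hf. apply smooth_on_components in Hf. destruct Hf as [f1 [f2 f3]].
  apply smooth_on_components. split; [|split]; simpl; now apply smooth_on_mult.
Qed.

Lemma smooth_on_plus3 (f g : R -> R * R * R) :
  smooth_on a b f -> smooth_on a b g -> smooth_on a b (fun x => plus (f x) (g x)).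
Proof.
  intros Hf Hg.
  apply smooth_on_components in Hf. destruct Hf as [f1 [f2 f3]].
  apply smooth_on_components in Hg. destruct Hg as [g1 [g2 g3]].
  apply smooth_on_components. split; [|split]; simpl; now apply smooth_on_plus.
Qed.

End VectorCalculus.

(** * Parallel transport and holonomy *)

Section CurveFrame.
Variables (a b : R) (g : R -> R * R * R).
Hypotheses (hab : a < b) (hg : is_curve a b g).

Local Notation A := (Derive_on a b g).
Local Notation T := (tangent a b g).

Lemma curve_dot_pos (x : R) : Icc a b x -> 0 < dot3 (A x) (A x).
Proof.
  intros hx. destruct (Rle_lt_or_eq_dec _ _ (dot3_self_ge_0 (A x))) as [h|h]; [exact h|].
  exfalso. apply (proj2 hg x hx). now apply dot3_self_eq_0.
Qed.

Lemma curve_speed_pos (x : R) : Icc a b x -> 0 < speed a b g x.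
Proof. intros hx. now apply sqrt_lt_R0, curve_dot_pos. Qed.

Lemma curve_speed_sqr (x : R) :
  Icc a b x -> speed a b g x * speed a b g x = dot3 (A x) (A x).
Proof. intros hx. apply sqrt_sqrt. left. now apply curve_dot_pos. Qed.

Lemma smooth_on_speed : smooth_on a b (speed a b g).
Proof.
  apply smooth_on_sqrt; [exact curve_dot_pos|].
  apply smooth_on_dot3; apply smooth_on_Derive; [exact hab|apply hg|exact hab|apply hg].
Qed.

Lemma smooth_on_inv_speed : smooth_on a b (fun x => / speed a b g x).
Proof.
  apply smooth_on_inv; [|exact smooth_on_speed].
  intros x hx. now apply Rgt_not_eq, curve_speed_pos.
Qed.

Lemma smooth_on_tangent : smooth_on a b T.
Proof.
  apply (smooth_on_scal a b (fun x => / speed a b g x) A); [exact smooth_on_inv_speed|].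
  apply smooth_on_Derive; [exact hab|apply hg].
Qed.

Lemma tangent_unit (x : R) : Icc a b x -> dot3 (T x) (T x) = 1.
Proof.
  intros hx. unfold tangent, dds. rewrite dot3_scal_l, dot3_scal_r.
  rewrite <- (curve_speed_sqr x hx). field. now apply Rgt_not_eq, curve_speed_pos.
Qed.

Lemma is_derive_on_dot3_const (U V : R -> R * R * R) (c x : R) :
  Icc a b x -> smooth_on a b U -> smooth_on a b V ->
  (forall y, Icc a b y -> dot3 (U y) (V y) = c) ->
  dot3 (Derive_on a b U x) (V x) + dot3 (U x) (Derive_on a b V x) = 0.
Proof.
  intros hx hU hV h.
  apply (is_derive_on_unique a b hab (fun y => dot3 (U y) (V y)) x); [exact hx| |].
  - apply is_derive_on_dot3; [exact hx| |]; now apply smooth_on_is_derive.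
  - apply (is_derive_on_ext a b (fun _ => c)); [exact hx| |].
    + intros y hy. symmetry. now apply h.
    + apply (is_derive_on_const (V := R_NormedModule) a b c x hx).
Qed.

Variables (M1 M2 : R -> R * R * R).
Hypotheses (sM1 : smooth_on a b M1) (sM2 : smooth_on a b M2).
Hypothesis uM1 : forall x, Icc a b x -> dot3 (M1 x) (M1 x) = 1.
Hypothesis M1_T : forall x, Icc a b x -> dot3 (M1 x) (T x) = 0.
Hypothesis M2_eq : forall x, Icc a b x -> M2 x = cross (T x) (M1 x).

(** Angular speed of the frame in the normal plane; [M1] is parallel exactly when it vanishes. *)
Local Notation omega := (fun x => dot3 (Derive_on a b M1 x) (M2 x)).

Lemma smooth_on_frame_rotation : smooth_on a b omega.
Proof. apply smooth_on_dot3; [now apply smooth_on_Derive|exact sM2]. Qed.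

Lemma frame_derive_M1 (x : R) : Icc a b x ->
  Derive_on a b M1 x =
  plus (scal (dot3 (Derive_on a b M1 x) (T x)) (T x)) (scal (omega x) (M2 x)).
Proof.
  intros hx.
  rewrite (frame_expand (T x) (M1 x) (M2 x) (tangent_unit x hx) (uM1 x hx) (M1_T x hx)
    (M2_eq x hx) (Derive_on a b M1 x)) at 1.
  pose proof (is_derive_on_dot3_const M1 M1 1 x hx sM1 sM1 uM1) as h.
  rewrite (dot3_comm (M1 x)) in h.
  replace (dot3 (Derive_on a b M1 x) (M1 x)) with 0 by lra. vector_ring.
Qed.

Lemma frame_derive_M2 (x : R) : Icc a b x ->
  Derive_on a b M2 x =
  plus (scal (dot3 (Derive_on a b M2 x) (T x)) (T x)) (scal (- omega x) (M1 x)).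
Proof.
  intros hx.
  pose proof (tangent_unit x hx) as hT.
  rewrite (frame_expand (T x) (M1 x) (M2 x) hT (uM1 x hx) (M1_T x hx)
    (M2_eq x hx) (Derive_on a b M2 x)) at 1.
  assert (u2 : forall y, Icc a b y -> dot3 (M2 y) (M2 y) = 1).
  { intros y hy. apply (frame_dot_M2_M2 (T y) (M1 y)); auto. now apply tangent_unit. }
  assert (u12 : forall y, Icc a b y -> dot3 (M1 y) (M2 y) = 0).
  { intros y hy. apply (frame_dot_M1_M2 (T y)); auto. }
  pose proof (is_derive_on_dot3_const M2 M2 1 x hx sM2 sM2 u2) as h.
  pose proof (is_derive_on_dot3_const M1 M2 0 x hx sM1 sM2 u12) as h'.
  rewrite (dot3_comm (M2 x)) in h. rewrite (dot3_comm (M1 x)) in h'.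
  replace (dot3 (Derive_on a b M2 x) (M2 x)) with 0 by lra.
  replace (dot3 (Derive_on a b M2 x) (M1 x)) with (- omega x) by (simpl; lra). vector_ring.
Qed.

Section Transport.
Variable phi : R -> R.
Hypothesis sphi : smooth_on a b phi.
Hypothesis dphi : forall x, Icc a b x -> is_derive_on a b phi x (- omega x).

Lemma is_derive_on_cos_phi (x : R) : Icc a b x ->
  is_derive_on a b (fun y => cos (phi y)) x (omega x * sin (phi x)).
Proof.
  intros hx. eapply is_derive_on_eq_R.
  - apply (is_derive_on_comp a b cos phi x (- omega x) (- sin (phi x)) hx (dphi x hx)).
    apply is_derive_cos.
  - unfold scal, mult; simpl. unfold mult; simpl. ring.
Qed.

Lemma is_derive_on_sin_phi (x : R) : Icc a b x ->
  is_derive_on a b (fun y => sin (phi y)) x (- omega x * cos (phi x)).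
Proof.
  intros hx.
  apply (is_derive_on_comp a b sin phi x (- omega x) (cos (phi x)) hx (dphi x hx)).
  apply is_derive_sin.
Qed.

(** Turning the frame with angular speed [- omega] cancels its own rotation: the normal parts of the
    derivative cancel in pairs and only a multiple of the tangent is left. *)
Lemma rotated_frame_parallel :
  parallel_normal_field a b g
    (fun x => plus (scal (cos (phi x)) (M1 x)) (scal (sin (phi x)) (M2 x))).
Proof.
  split; [split|].
  - apply smooth_on_plus3; apply smooth_on_scal; auto; [now apply smooth_on_cos|now apply smooth_on_sin].
  - intros x hx. rewrite dot3_plus_l, !dot3_scal_l, M1_T, (frame_dot_M2_T _ _ _ (M2_eq x hx)) by auto.
    ring.
  - exists (fun x => cos (phi x) * dot3 (Derive_on a b M1 x) (T x)
                     + sin (phi x) * dot3 (Derive_on a b M2 x) (T x)).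
    split.
    + apply smooth_on_plus; apply smooth_on_mult.
      * now apply smooth_on_cos.
      * apply smooth_on_dot3; [now apply smooth_on_Derive|exact smooth_on_tangent].
      * now apply smooth_on_sin.
      * apply smooth_on_dot3; [now apply smooth_on_Derive|exact smooth_on_tangent].
    + intros x hx. apply Derive_on_eq; [exact hab|exact hx|].
      pose proof (is_derive_on_scal a b _ M1 x _ _ hx (is_derive_on_cos_phi x hx)
        (smooth_on_is_derive a b M1 x sM1 hx)) as D1.
      pose proof (is_derive_on_scal a b _ M2 x _ _ hx (is_derive_on_sin_phi x hx)
        (smooth_on_is_derive a b M2 x sM2 hx)) as D2.
      pose proof (is_derive_on_plus a b _ _ x _ _ hx D1 D2) as D.
      rewrite (frame_derive_M1 x hx), (frame_derive_M2 x hx) in D.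
      match type of D with is_derive_on _ _ _ _ ?l =>
        match goal with |- is_derive_on _ _ _ _ ?m => replace m with l; [exact D|] end end.
      generalize (dot3 (Derive_on a b M1 x) (T x)) (dot3 (Derive_on a b M2 x) (T x)) (omega x).
      vector_ring.
Qed.

(* The frame coordinates of a parallel field rotate with the frame, so they are constant in the
   frame rotated by [phi]. *)
Lemma parallel_field_constant_coordinates (Z : R -> R * R * R) :
  parallel_normal_field a b g Z ->
  dot3 (Z b) (M1 b) * cos (phi b) + dot3 (Z b) (M2 b) * sin (phi b) =
  dot3 (Z a) (M1 a) * cos (phi a) + dot3 (Z a) (M2 a) * sin (phi a) /\
  dot3 (Z b) (M2 b) * cos (phi b) - dot3 (Z b) (M1 b) * sin (phi b) =
  dot3 (Z a) (M2 a) * cos (phi a) - dot3 (Z a) (M1 a) * sin (phi a).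
Proof.
  intros [[sZ ZT] [lam [_ hlam]]].
  assert (ia : Icc a b a) by (unfold Icc; lra).
  assert (ib : Icc a b b) by (unfold Icc; lra).
  assert (D1 : forall x, Icc a b x ->
    is_derive_on a b (fun y => dot3 (Z y) (M1 y)) x (omega x * dot3 (Z x) (M2 x))).
  { intros x hx. eapply is_derive_on_eq_R.
    - apply is_derive_on_dot3; [exact hx| |]; apply smooth_on_is_derive; auto.
    - rewrite (hlam x hx). rewrite (frame_derive_M1 x hx) at 1.
      rewrite dot3_plus_r, !dot3_scal_r, dot3_scal_l, (ZT x hx), (dot3_comm (T x)), M1_T by auto.
      ring. }
  assert (D2 : forall x, Icc a b x ->
    is_derive_on a b (fun y => dot3 (Z y) (M2 y)) x (- omega x * dot3 (Z x) (M1 x))).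
  { intros x hx. eapply is_derive_on_eq_R.
    - apply is_derive_on_dot3; [exact hx| |]; apply smooth_on_is_derive; auto.
    - rewrite (hlam x hx), (frame_derive_M2 x hx).
      rewrite dot3_plus_r, !dot3_scal_r, dot3_scal_l, (ZT x hx), (dot3_comm (T x)),
        (frame_dot_M2_T _ _ _ (M2_eq x hx)).
      ring. }
  split.
  - apply (is_derive_on_zero_const a b hab (fun x =>
      dot3 (Z x) (M1 x) * cos (phi x) + dot3 (Z x) (M2 x) * sin (phi x))); auto.
    intros x hx. eapply is_derive_on_eq_R.
    + apply is_derive_on_plus_R; [exact hx| |]; apply is_derive_on_mult.
      * exact hx. * exact (D1 x hx). * exact (is_derive_on_cos_phi x hx).
      * exact hx. * exact (D2 x hx). * exact (is_derive_on_sin_phi x hx).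
    + simpl. ring.
  - apply (is_derive_on_zero_const a b hab (fun x =>
      dot3 (Z x) (M2 x) * cos (phi x) - dot3 (Z x) (M1 x) * sin (phi x))); auto.
    intros x hx. eapply is_derive_on_eq_R.
    + apply is_derive_on_plus_R; [exact hx| |apply is_derive_on_opp_R; [exact hx|]];
        apply is_derive_on_mult.
      * exact hx. * exact (D2 x hx). * exact (is_derive_on_cos_phi x hx).
      * exact hx. * exact (D1 x hx). * exact (is_derive_on_sin_phi x hx).
    + simpl. ring.
Qed.

End Transport.

(** The transport of [Wa] has frame angle [alpha] at [a] and, the frame itself having turned by the
    integral of [omega], the angle [alpha] minus that integral at [b]. Turning [Wb] by [theta] gives
    the angle [theta + beta]. The rotated frame field shows existence of the transport, and
    constancy of coordinates shows that no other field has to be considered. *)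
Lemma is_holonomy_iff (Wa Wb : R * R * R) (alpha beta theta : R) :
  Wa = plus (scal (cos alpha) (M1 a)) (scal (sin alpha) (M2 a)) ->
  Wb = plus (scal (cos beta) (M1 b)) (scal (sin beta) (M2 b)) ->
  is_holonomy a b g Wa Wb theta <->
  cos (theta + beta) = cos (alpha - RInt omega a b) /\
  sin (theta + beta) = sin (alpha - RInt omega a b).
Proof.
  intros hWa hWb.
  assert (ia : Icc a b a) by (unfold Icc; lra).
  assert (ib : Icc a b b) by (unfold Icc; lra).
  (* [phi] is the solution of [phi' = - omega] with [phi a = alpha]. *)
  destruct (smooth_on_primitive a b hab omega smooth_on_frame_rotation) as [F [sF [F0 dF]]].
  set (phi := fun x => alpha - F x).
  assert (sphi : smooth_on a b phi).
  { apply smooth_on_minus; [exact (smooth_on_const (V := R_NormedModule) a b alpha)|exact sF]. }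
  assert (dphi : forall x, Icc a b x -> is_derive_on a b phi x (- omega x)).
  { intros x hx. eapply is_derive_on_eq_R.
    - apply is_derive_on_plus_R; [exact hx|exact (is_derive_on_const (V := R_NormedModule) a b alpha x hx)|].
      apply is_derive_on_opp_R; [exact hx|now apply dF].
    - unfold zero; simpl. ring. }
  assert (phia : phi a = alpha) by (unfold phi; rewrite F0; ring).
  assert (phib : phi b = alpha - RInt omega a b).
  { unfold phi. rewrite (RInt_derive_on a b hab F omega dF smooth_on_frame_rotation), F0. ring. }
  pose proof (tangent_unit a ia) as hTa. pose proof (tangent_unit b ib) as hTb.
  pose proof (frame_dot_M2_M2 _ _ _ hTa (uM1 a ia) (M1_T a ia) (M2_eq a ia)) as u2a.
  pose proof (frame_dot_M2_M2 _ _ _ hTb (uM1 b ib) (M1_T b ib) (M2_eq b ib)) as u2b.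
  pose proof (frame_dot_M1_M2 _ _ _ (M2_eq a ia)) as u12a.
  pose proof (frame_dot_M1_M2 _ _ _ (M2_eq b ib)) as u12b.
  assert (E : plus (scal (cos theta) Wb) (scal (sin theta) (cross (tangent a b g b) Wb)) =
              plus (scal (cos (theta + beta)) (M1 b)) (scal (sin (theta + beta)) (M2 b))).
  { rewrite hWb.
    assert (C : cross (T b) (plus (scal (cos beta) (M1 b)) (scal (sin beta) (M2 b))) =
                plus (scal (cos beta) (M2 b)) (scal (- sin beta) (M1 b))).
    { transitivity (plus (scal (cos beta) (cross (T b) (M1 b)))
                         (scal (sin beta) (cross (T b) (M2 b)))); [vector_ring|].
      rewrite (frame_cross_T_M2 _ _ _ hTb (M1_T b ib) (M2_eq b ib)), <- (M2_eq b ib).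
      vector_ring. }
    rewrite C, cos_plus, sin_plus. vector_ring. }
  unfold is_holonomy. rewrite E. split.
  - intros [Z [pZ [Za Zb]]].
    destruct (parallel_field_constant_coordinates phi dphi Z pZ) as [H1 H2].
    rewrite Za, Zb, hWa, phia, phib in H1, H2.
    rewrite !dot3_plus_l, !dot3_scal_l in H1, H2.
    rewrite uM1, uM1, u2a, u2b, (dot3_comm (M2 a)), (dot3_comm (M2 b)), u12a, u12b in H1, H2 by auto.
    pose proof (sin2_cos2 alpha) as pa. unfold Rsqr in pa.
    (* The constant coordinates say that the two angles at [b] differ by an angle with cosine 1 and
       sine 0. *)
    apply cos_sin_of_diff.
    + rewrite sin_minus. lra.
    + rewrite cos_minus. lra.
  - intros [Hc Hs].
    exists (fun x => plus (scal (cos (phi x)) (M1 x)) (scal (sin (phi x)) (M2 x))).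
    split; [now apply rotated_frame_parallel|]. cbv beta.
    rewrite phia, phib, Hc, Hs. auto.
Qed.

End CurveFrame.

(** * Differentiation of integrals depending on a parameter *)

Section ParameterIntegrals.
Variables (a b : R).
Hypothesis hab : a < b.

(** Clamping the second variable turns continuity relative to the strip into ordinary continuity in
    the plane. *)
Definition jointly_continuous (d : R) (f : R -> R -> R) : Prop :=
  forall t x, Rabs t < d ->
    continuous (fun p : R * R => f (fst p) (clamp a b (snd p))) (t, x).

(** Exactly the data needed to differentiate under the integral sign, packaged so as to be stable
    under sums, products, inverses and square roots. The derivative of a composite density is then
    produced by composing these rules. *)
Definition param_derive (d : R) (f df : R -> R -> R) : Prop :=
  jointly_continuous d f /\ jointly_continuous d df /\
  forall t x, Rabs t < d -> Icc a b x -> is_derive (fun u => f u x) t (df t x).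

Lemma jointly_continuous_plus (d : R) (f g : R -> R -> R) :
  jointly_continuous d f -> jointly_continuous d g ->
  jointly_continuous d (fun t x => f t x + g t x).
Proof.
  intros hf hg t x ht. exact (continuous_plus (V := R_NormedModule) _ _ _ (hf t x ht) (hg t x ht)).
Qed.

Lemma jointly_continuous_mult (d : R) (f g : R -> R -> R) :
  jointly_continuous d f -> jointly_continuous d g ->
  jointly_continuous d (fun t x => f t x * g t x).
Proof.
  intros hf hg t x ht. exact (continuous_mult (K := R_AbsRing) _ _ _ (hf t x ht) (hg t x ht)).
Qed.

Lemma jointly_continuous_opp (d : R) (f : R -> R -> R) :
  jointly_continuous d f -> jointly_continuous d (fun t x => - f t x).
Proof.
  intros hf t x ht. exact (continuous_opp (V := R_NormedModule) _ _ (hf t x ht)).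
Qed.

Lemma jointly_continuous_comp (d : R) (h : R -> R) (f : R -> R -> R) :
  (forall t x, Rabs t < d -> Icc a b x -> continuous h (f t x)) ->
  jointly_continuous d f -> jointly_continuous d (fun t x => h (f t x)).
Proof.
  intros hh hf t x ht.
  apply (continuous_comp (fun p : R * R => f (fst p) (clamp a b (snd p))) h).
  - now apply hf.
  - apply hh; [exact ht|now apply clamp_Icc].
Qed.

Lemma param_derive_plus (d : R) (f df g dg : R -> R -> R) :
  param_derive d f df -> param_derive d g dg ->
  param_derive d (fun t x => f t x + g t x) (fun t x => df t x + dg t x).
Proof.
  intros [cf [cdf hf]] [cg [cdg hg]].
  split; [now apply jointly_continuous_plus|]. split; [now apply jointly_continuous_plus|].
  intros t x ht hx. exact (is_derive_plus (V := R_NormedModule) _ _ _ _ _ (hf t x ht hx) (hg t x ht hx)).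
Qed.

Lemma param_derive_mult (d : R) (f df g dg : R -> R -> R) :
  param_derive d f df -> param_derive d g dg ->
  param_derive d (fun t x => f t x * g t x) (fun t x => df t x * g t x + f t x * dg t x).
Proof.
  intros [cf [cdf hf]] [cg [cdg hg]].
  split; [now apply jointly_continuous_mult|].
  split; [apply jointly_continuous_plus; now apply jointly_continuous_mult|].
  intros t x ht hx.
  exact (is_derive_mult (K := R_AbsRing) _ _ _ _ _ (hf t x ht hx) (hg t x ht hx) Rmult_comm).
Qed.

Lemma param_derive_opp (d : R) (f df : R -> R -> R) :
  param_derive d f df -> param_derive d (fun t x => - f t x) (fun t x => - df t x).
Proof.
  intros [cf [cdf hf]].
  split; [now apply jointly_continuous_opp|]. split; [now apply jointly_continuous_opp|].
  intros t x ht hx. exact (is_derive_opp (V := R_NormedModule) _ _ _ (hf t x ht hx)).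
Qed.

Lemma param_derive_minus (d : R) (f df g dg : R -> R -> R) :
  param_derive d f df -> param_derive d g dg ->
  param_derive d (fun t x => f t x - g t x) (fun t x => df t x - dg t x).
Proof. intros hf hg. apply param_derive_plus; [exact hf|now apply param_derive_opp]. Qed.

Lemma param_derive_comp (d : R) (h dh : R -> R) (f df : R -> R -> R) :
  (forall t x, Rabs t < d -> Icc a b x ->
     is_derive h (f t x) (dh (f t x)) /\ continuous dh (f t x)) ->
  param_derive d f df ->
  param_derive d (fun t x => h (f t x)) (fun t x => df t x * dh (f t x)).
Proof.
  intros hh [cf [cdf hf]]. split; [|split].
  - apply jointly_continuous_comp; [|exact cf]. intros t x ht hx.
    apply (ex_derive_continuous (V := R_NormedModule)). exists (dh (f t x)). now apply hh.
  - apply jointly_continuous_mult; [exact cdf|].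
    apply jointly_continuous_comp; [|exact cf]. intros t x ht hx. now apply hh.
  - intros t x ht hx.
    apply (is_derive_comp (V := R_NormedModule) h (fun u => f u x) t); [now apply hh|auto].
Qed.

Lemma param_derive_inv (d : R) (f df : R -> R -> R) :
  (forall t x, Rabs t < d -> Icc a b x -> f t x <> 0) -> param_derive d f df ->
  param_derive d (fun t x => / f t x) (fun t x => df t x * (- (/ f t x * / f t x))).
Proof.
  intros h. apply (param_derive_comp d Rinv (fun y => - (/ y * / y))).
  intros t x ht hx. specialize (h t x ht hx). split.
  - auto_derive; [exact h|]. field. exact h.
  - apply (continuous_opp (V := R_NormedModule) (fun y => / y * / y)).
    apply (continuous_mult (K := R_AbsRing) Rinv Rinv); now apply continuous_Rinv.
Qed.

Lemma param_derive_sqrt (d : R) (f df : R -> R -> R) :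
  (forall t x, Rabs t < d -> Icc a b x -> 0 < f t x) -> param_derive d f df ->
  param_derive d (fun t x => sqrt (f t x)) (fun t x => df t x * / (2 * sqrt (f t x))).
Proof.
  intros h. apply (param_derive_comp d sqrt (fun y => / (2 * sqrt y))).
  intros t x ht hx. specialize (h t x ht hx).
  pose proof (sqrt_lt_R0 _ h) as hs. split.
  - auto_derive; [exact h|]. field. lra.
  - apply (continuous_Rinv_comp (fun y => 2 * sqrt y)); [|lra].
    apply (continuous_mult (K := R_AbsRing) (fun _ => 2) sqrt);
      [apply continuous_const|apply continuous_sqrt].
Qed.

Lemma jointly_continuous_const (d : R) (f : R -> R) :
  smooth_on a b f -> jointly_continuous d (fun _ x => f x).
Proof.
  intros hf t x _.
  apply (continuous_comp (fun p : R * R => snd p) (fun y => f (clamp a b y))).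
  - apply continuous_snd.
  - now apply smooth_on_continuous.
Qed.

Lemma param_derive_const (d : R) (f : R -> R) :
  smooth_on a b f -> param_derive d (fun _ x => f x) (fun _ _ => 0).
Proof.
  intros hf. split; [now apply jointly_continuous_const|].
  split; [intros t x _; apply continuous_const|].
  intros t x _ _. apply (is_derive_const (V := R_NormedModule)).
Qed.

Lemma param_derive_weaken (d d' : R) (f df : R -> R -> R) :
  d' <= d -> param_derive d f df -> param_derive d' f df.
Proof.
  intros h [cf [cdf hf]].
  split; [intros t x ht; apply cf; lra|]. split; [intros t x ht; apply cdf; lra|].
  intros t x ht hx. apply hf; [lra|exact hx].
Qed.

Lemma locally_Rabs_lt (d t : R) : Rabs t < d -> locally t (fun u => Rabs u < d).
Proof.
  intros h. assert (hp : 0 < d - Rabs t) by lra.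
  exists (mkposreal _ hp). intros u hu. change (Rabs (u - t) < d - Rabs t) in hu.
  replace u with (t + (u - t)) by ring.
  eapply Rle_lt_trans; [apply Rabs_triang|lra].
Qed.

Lemma continuity_2d_pt_clamp (d : R) (f : R -> R -> R) (t x : R) :
  jointly_continuous d f -> Rabs t < d ->
  continuity_2d_pt (fun t x => f t (clamp a b x)) t x.
Proof. intros hf ht. apply continuity_2d_pt_filterlim. exact (hf t x ht). Qed.

(** Uniform continuity over the compact interval gives one parameter radius for all [x] on which [f]
    stays within 1/2 of the value 1. *)
Lemma jointly_continuous_pos (d : R) (f : R -> R -> R) :
  0 < d -> jointly_continuous d f -> (forall x, Icc a b x -> f 0 x = 1) ->
  exists d', 0 < d' /\ d' <= d /\ forall t x, Rabs t < d' -> Icc a b x -> 0 < f t x.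
Proof.
  intros hd hf h1.
  assert (h : 0 < 1 / 2) by lra.
  destruct (uniform_continuity_2d_1d (fun x t => f t (clamp a b x)) a b 0) with
    (eps := mkposreal _ h) as [e He].
  { intros x hx. apply continuity_2d_pt_filterlim.
    apply (filterlim_comp _ _ _ (fun p : R * R => (snd p, fst p))
      (fun p : R * R => f (fst p) (clamp a b (snd p))) _ (locally (0, x))).
    - apply (continuous_comp_2 (fun p : R * R => snd p) (fun p : R * R => fst p)
        (fun u v => (u, v)) (x, 0)); [apply continuous_snd|apply continuous_fst|].
      apply (continuous_ext (fun p : R * R => p)); [now intros [u v]|apply continuous_id].
    - apply hf. rewrite Rabs_R0. exact hd. }
  exists (Rmin e d). split; [apply Rmin_glb_lt; [apply cond_pos|exact hd]|].
  split; [apply Rmin_r|]. intros t x ht hx.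
  pose proof (Rmin_l e d). assert (ht' : Rabs t < e) by lra. apply Rabs_def2 in ht'.
  pose proof (cond_pos e) as he.
  assert (hz : Rabs (x - x) < e) by (rewrite Rminus_diag, Rabs_R0; exact he).
  assert (H0 : 0 - e <= 0 <= 0 + e) by lra.
  assert (Ht : 0 - e <= t <= 0 + e) by lra.
  specialize (He x 0 x t hx H0 hx Ht hz). simpl in He.
  rewrite (clamp_id a b x hx), (h1 x hx) in He. apply Rabs_def2 in He. lra.
Qed.

Lemma is_derive_RInt_smooth_param (d : R) (f df : R -> R -> R) :
  0 < d -> param_derive d f df ->
  is_derive (fun t => RInt (f t) a b) 0 (RInt (df 0) a b).
Proof.
  intros hd [cf [cdf hf]].
  assert (h0 : Rabs 0 < d) by (rewrite Rabs_R0; exact hd).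
  assert (D : forall t x, Rabs t < d ->
    is_derive (fun u => f u (clamp a b x)) t (df t (clamp a b x))).
  { intros t x ht. apply hf; [exact ht|now apply clamp_Icc]. }
  pose proof (is_derive_RInt_param (fun t x => f t (clamp a b x)) a b 0) as H.
  rewrite <- (RInt_clamp a b hab (df 0)).
  replace (RInt (fun y => df 0 (clamp a b y)) a b) with
    (RInt (fun x => Derive (fun u => f u (clamp a b x)) 0) a b)
    by (apply RInt_ext; intros x _; apply is_derive_unique, D, h0).
  apply (is_derive_ext (fun t => RInt (fun x => f t (clamp a b x)) a b)).
  { intros t. apply (RInt_clamp a b hab (f t)). }
  apply H; clear H.
  - generalize (locally_Rabs_lt d 0 h0). apply filter_imp.
    intros t ht x _. exists (df t (clamp a b x)). now apply D.
  - intros x _. apply (continuity_2d_pt_ext_loc (fun t x => df t (clamp a b x))).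
    + assert (hp : 0 < d) by exact hd. exists (mkposreal d hp). intros u v hu _.
      rewrite Rminus_0_r in hu. symmetry. now apply is_derive_unique, D.
    + now apply (continuity_2d_pt_clamp d).
  - generalize (locally_Rabs_lt d 0 h0). apply filter_imp.
    intros t ht. apply (ex_RInt_continuous (V := R_CompleteNormedModule)). intros x _.
    apply (continuous_comp_2 (fun _ : R => t) (fun x : R => x)
      (fun t x => f t (clamp a b x)) x); [apply continuous_const|apply continuous_id|].
    now apply cf.
Qed.

Definition param_derive3 (d : R) (f df : R -> R -> R * R * R) : Prop :=
  param_derive d (fun t x => fst (fst (f t x))) (fun t x => fst (fst (df t x))) /\
  param_derive d (fun t x => snd (fst (f t x))) (fun t x => snd (fst (df t x))) /\
  param_derive d (fun t x => snd (f t x)) (fun t x => snd (df t x)).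

Lemma param_derive_ext_derive (d : R) (f df df' : R -> R -> R) :
  (forall t x, df t x = df' t x) -> param_derive d f df -> param_derive d f df'.
Proof.
  intros e. replace df' with df; [auto|].
  apply functional_extensionality. intros t. now apply functional_extensionality.
Qed.

Lemma param_derive_dot3 (d : R) (f df g dg : R -> R -> R * R * R) :
  param_derive3 d f df -> param_derive3 d g dg ->
  param_derive d (fun t x => dot3 (f t x) (g t x))
    (fun t x => dot3 (df t x) (g t x) + dot3 (f t x) (dg t x)).
Proof.
  intros [f1 [f2 f3]] [g1 [g2 g3]].
  eapply param_derive_ext_derive.
  2:{ apply param_derive_plus; [apply param_derive_plus|];
        apply param_derive_mult; eassumption. }
  intros t x. unfold dot3. ring.
Qed.

Lemma param_derive3_cross (d : R) (f df g dg : R -> R -> R * R * R) :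
  param_derive3 d f df -> param_derive3 d g dg ->
  param_derive3 d (fun t x => cross (f t x) (g t x))
    (fun t x => plus (cross (df t x) (g t x)) (cross (f t x) (dg t x))).
Proof.
  intros [f1 [f2 f3]] [g1 [g2 g3]].
  split; [|split]; (eapply param_derive_ext_derive;
    [|apply param_derive_minus; apply param_derive_mult; eassumption]);
    intros t x; simpl; unfold plus; simpl; ring.
Qed.

Lemma param_derive3_plus (d : R) (f df g dg : R -> R -> R * R * R) :
  param_derive3 d f df -> param_derive3 d g dg ->
  param_derive3 d (fun t x => plus (f t x) (g t x)) (fun t x => plus (df t x) (dg t x)).
Proof.
  intros [f1 [f2 f3]] [g1 [g2 g3]]. split; [|split]; now apply param_derive_plus.
Qed.

Lemma param_derive3_const (d : R) (f : R -> R * R * R) :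
  smooth_on a b f -> param_derive3 d (fun _ x => f x) (fun _ _ => zero).
Proof.
  intros hf. apply smooth_on_components in hf. destruct hf as [f1 [f2 f3]].
  split; [|split]; now apply param_derive_const.
Qed.

(** For [Rabs t < d] the clamped point lies in the strip, so the relative limit becomes an ordinary
    one. [c] stands for a coordinate projection. *)
Lemma smooth_on2_jointly_continuous (d : R) (f : R -> R -> R * R * R) (c : R * R * R -> R) :
  (forall u, continuous c u) ->
  (forall t x, Icc (- d) d t -> Icc a b x ->
     filterlim (fun p : R * R => f (fst p) (snd p))
       (within (fun p : R * R => Icc (- d) d (fst p) /\ Icc a b (snd p)) (locally (t, x)))
       (locally (f t x))) ->
  jointly_continuous d (fun t x => c (f t x)).
Proof.
  intros hc hf t x ht P HP.
  assert (it : Icc (- d) d t). { apply Rabs_def2 in ht. unfold Icc. lra. }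
  specialize (hf t (clamp a b x) it (clamp_Icc a b hab x) _ (hc _ P HP)).
  unfold filtermap, within in hf |- *.
  assert (C : continuous (fun p : R * R => (fst p, clamp a b (snd p))) (t, x)).
  { apply (continuous_comp_2 (fun p : R * R => fst p) (fun p : R * R => clamp a b (snd p))
      (fun u v => (u, v)) (t, x)).
    - apply continuous_fst.
    - apply (continuous_comp (fun p : R * R => snd p) (clamp a b));
        [apply continuous_snd|now apply continuous_clamp].
    - apply (continuous_ext (fun p : R * R => p)); [now intros [u v]|apply continuous_id]. }
  pose proof (C _ hf) as H1. unfold filtermap in H1.
  pose proof (continuous_fst t x _ (locally_Rabs_lt d t ht)) as H2. unfold filtermap in H2.
  generalize (filter_and _ _ H1 H2). apply filter_imp. intros [u v] [K1 K2]. simpl in *.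
  apply K1. split; [|now apply clamp_Icc]. apply Rabs_def2 in K2. unfold Icc. lra.
Qed.

Lemma is_derive_of_is_derive_on {V : NormedModule R_AbsRing} (u v : R) (f : R -> V) (x : R) (l : V) :
  u < x < v -> is_derive_on u v f x l -> is_derive f x l.
Proof.
  intros hx H. assert (ix : Icc u v x) by (unfold Icc; lra).
  destruct (is_derive_on_extend u v f x l ix H) as [g [Eg Hg]].
  apply (is_derive_ext_loc g); [|exact Hg].
  assert (hp : 0 < Rmin (x - u) (v - x)) by (apply Rmin_glb_lt; lra).
  exists (mkposreal _ hp). intros y hy. apply Eg.
  change (Rabs (y - x) < Rmin (x - u) (v - x)) in hy.
  pose proof (Rmin_l (x - u) (v - x)). pose proof (Rmin_r (x - u) (v - x)).
  apply Rabs_def2 in hy. unfold Icc. lra.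
Qed.

Lemma smooth_on2_param_derive3 (d : R) (F : nat -> nat -> R -> R -> R * R * R) (i j : nat) :
  (forall i j t x, Icc (- d) d t -> Icc a b x ->
     is_derive_on (- d) d (fun u => F i j u x) t (F (S i) j t x) /\
     is_derive_on a b (fun y => F i j t y) x (F i (S j) t x) /\
     filterlim (fun p : R * R => F i j (fst p) (snd p))
       (within (fun p : R * R => Icc (- d) d (fst p) /\ Icc a b (snd p)) (locally (t, x)))
       (locally (F i j t x))) ->
  param_derive3 d (F i j) (F (S i) j).
Proof.
  intros HF.
  assert (c1 : forall u : R * R * R, continuous (fun u : R * R * R => fst (fst u)) u).
  { intros [[x y] z]. apply (continuous_comp (fun u : R * R * R => fst u) (fun u : R * R => fst u));
      apply continuous_fst. }
  assert (c2 : forall u : R * R * R, continuous (fun u : R * R * R => snd (fst u)) u).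
  { intros [[x y] z]. apply (continuous_comp (fun u : R * R * R => fst u) (fun u : R * R => snd u));
      [apply continuous_fst|apply continuous_snd]. }
  assert (c3 : forall u : R * R * R, continuous (fun u : R * R * R => snd u) u).
  { intros [[x y] z]. apply continuous_snd. }
  assert (JC : forall (c : R * R * R -> R) i j, (forall u, continuous c u) ->
    jointly_continuous d (fun t x => c (F i j t x))).
  { intros c i' j' hc. apply smooth_on2_jointly_continuous; [exact hc|].
    intros t x ht hx. now apply HF. }
  assert (D : forall t x, Rabs t < d -> Icc a b x ->
    is_derive (fun u => F i j u x) t (F (S i) j t x)).
  { intros t x ht hx. apply Rabs_def2 in ht. apply (is_derive_of_is_derive_on (- d) d); [lra|].
    apply HF; [unfold Icc; lra|exact hx]. }
  split; [|split].
  - split; [now apply (JC (fun u => fst (fst u)))|]. split; [now apply (JC (fun u => fst (fst u)))|]. intros t x ht hx.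
    apply (is_derive_fst (fun u => fst (F i j u x)) t (fst (F (S i) j t x))).
    apply (is_derive_fst (fun u => F i j u x) t (F (S i) j t x)). now apply D.
  - split; [now apply (JC (fun u => snd (fst u)))|]. split; [now apply (JC (fun u => snd (fst u)))|].
    intros t x ht hx.
    apply (is_derive_snd (fun u => fst (F i j u x)) t (fst (F (S i) j t x))).
    apply (is_derive_fst (fun u => F i j u x) t (F (S i) j t x)). now apply D.
  - split; [now apply (JC (fun u => snd u))|]. split; [now apply (JC (fun u => snd u))|]. intros t x ht hx.
    apply (is_derive_snd (fun u => F i j u x) t (F (S i) j t x)). now apply D.
Qed.

End ParameterIntegrals.

(** * Explicit rotation and bending density of a curve *)

Section ProjectedFrame.
Variables (a b : R) (g N : R -> R * R * R).
Hypotheses (hab : a < b) (hg : is_curve a b g) (sN : smooth_on a b N).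

Local Notation A := (Derive_on a b g).
Local Notation T := (tangent a b g).

(** Later [N] is the field [N2] of the unvaried curve, kept fixed while [g] varies; along the
    unvaried curve the product is [N1]. *)
Definition normal_cross (x : R) : R * R * R := cross (N x) (A x).

Definition projected_normal (x : R) : R * R * R :=
  scal (/ sqrt (dot3 (normal_cross x) (normal_cross x))) (normal_cross x).

Definition projected_binormal (x : R) : R * R * R := cross (T x) (projected_normal x).

Hypothesis hpos : forall x, Icc a b x -> 0 < dot3 (normal_cross x) (normal_cross x).

Lemma smooth_on_derive_curve : smooth_on a b A.
Proof. apply smooth_on_Derive; [exact hab|apply hg]. Qed.

Lemma smooth_on_normal_cross : smooth_on a b normal_cross.
Proof. apply smooth_on_cross; [exact sN|exact smooth_on_derive_curve]. Qed.

Lemma smooth_on_projected_scale :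
  smooth_on a b (fun x => / sqrt (dot3 (normal_cross x) (normal_cross x))).
Proof.
  apply smooth_on_inv.
  - intros x hx. now apply Rgt_not_eq, sqrt_lt_R0, hpos.
  - apply smooth_on_sqrt; [exact hpos|]. apply smooth_on_dot3; exact smooth_on_normal_cross.
Qed.

Lemma smooth_on_projected_normal : smooth_on a b projected_normal.
Proof. apply smooth_on_scal; [exact smooth_on_projected_scale|exact smooth_on_normal_cross]. Qed.

Lemma smooth_on_projected_binormal : smooth_on a b projected_binormal.
Proof.
  apply smooth_on_cross; [now apply smooth_on_tangent|exact smooth_on_projected_normal].
Qed.

Lemma projected_normal_unit (x : R) : Icc a b x ->
  dot3 (projected_normal x) (projected_normal x) = 1.
Proof.
  intros hx. pose proof (hpos x hx) as hpx. unfold projected_normal.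
  rewrite dot3_scal_l, dot3_scal_r. pose proof (sqrt_lt_R0 _ hpx).
  rewrite <- (sqrt_sqrt (dot3 (normal_cross x) (normal_cross x))) at 3 by lra. field. lra.
Qed.

Lemma projected_normal_tangent (x : R) : Icc a b x -> dot3 (projected_normal x) (T x) = 0.
Proof.
  intros hx. unfold projected_normal, tangent, dds, normal_cross.
  rewrite dot3_scal_l, dot3_scal_r.
  replace (dot3 (cross (N x) (A x)) (A x)) with 0 by vector_ring. ring.
Qed.

(** The derivative of the normalizing factor multiplies [normal_cross], which is orthogonal to the
    binormal, so it drops out. What remains is algebraic in [N], [N'], [g'] and [g''], apart from
    one square root. *)
Lemma projected_frame_rotation (x : R) : Icc a b x ->
  dot3 (Derive_on a b projected_normal x) (projected_binormal x) =
  dot3 (plus (cross (Derive_on a b N x) (A x)) (cross (N x) (Derive_on a b A x)))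
       (cross (A x) (normal_cross x))
  * / sqrt (dot3 (A x) (A x)) * / dot3 (normal_cross x) (normal_cross x).
Proof.
  intros hx. pose proof (hpos x hx) as hpx.
  pose proof (is_derive_on_cross a b N A x _ _ hx (smooth_on_is_derive a b N x sN hx)
    (smooth_on_is_derive a b A x smooth_on_derive_curve hx)) as DQ.
  pose proof (is_derive_on_scal a b _ _ x _ _ hx
    (smooth_on_is_derive a b _ x smooth_on_projected_scale hx) DQ) as D.
  rewrite (Derive_on_eq a b hab projected_normal x _ hx D).
  unfold projected_binormal, projected_normal, tangent, dds, speed, norm3.
  fold (normal_cross x) in *.
  pose proof (sqrt_lt_R0 _ hpx) as hs.
  pose proof (sqrt_lt_R0 _ (curve_dot_pos a b g hg x hx)) as hq.
  replace (/ dot3 (normal_cross x) (normal_cross x)) with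
    (/ sqrt (dot3 (normal_cross x) (normal_cross x)) * / sqrt (dot3 (normal_cross x) (normal_cross x))).
  2:{ rewrite <- (sqrt_sqrt (dot3 (normal_cross x) (normal_cross x))) at 3 by lra. field. lra. }
  set (s := / sqrt (dot3 (normal_cross x) (normal_cross x))).
  set (s' := Derive_on a b _ x).
  set (k := / sqrt (dot3 (A x) (A x))).
  generalize (normal_cross x) (A x) (N x) (Derive_on a b N x) (Derive_on a b A x).
  vector_ring.
Qed.

End ProjectedFrame.

Section BendingDensity.
Variables (a b : R) (g : R -> R * R * R).
Hypotheses (hab : a < b) (hg : is_curve a b g).

Local Notation A := (Derive_on a b g).
Local Notation T := (tangent a b g).

(* [T' = k g' + g'' / |g'|] for some [k], which [<T', T> = 0] determines. *)
Lemma bending_density (x : R) : Icc a b x ->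
  dot3 (dds a b g T x) (dds a b g T x) * speed a b g x =
  (dot3 (A x) (A x) * dot3 (Derive_on a b A x) (Derive_on a b A x)
   - dot3 (A x) (Derive_on a b A x) * dot3 (A x) (Derive_on a b A x))
  * / (dot3 (A x) (A x) * dot3 (A x) (A x) * dot3 (A x) (A x)) * sqrt (dot3 (A x) (A x)).
Proof.
  intros hx.
  assert (sA : smooth_on a b A) by (apply smooth_on_Derive; [exact hab|apply hg]).
  pose proof (is_derive_on_scal a b _ _ x _ _ hx
    (smooth_on_is_derive a b _ x (smooth_on_inv_speed a b g hab hg) hx)
    (smooth_on_is_derive a b A x sA hx)) as D.
  pose proof (smooth_on_tangent a b g hab hg) as sT.
  pose proof (is_derive_on_dot3_const a b hab T T 1 x hx sT sT (tangent_unit a b g hg)) as h.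
  pose proof (Derive_on_eq a b hab T x _ hx D) as E.
  unfold dds at 1 2. rewrite E in h |- *.
  pose proof (curve_speed_pos a b g hg x hx) as hs.
  pose proof (curve_speed_sqr a b g hg x hx) as hq.
  change (sqrt (dot3 (A x) (A x))) with (speed a b g x).
  set (k := Derive_on a b (fun y => / speed a b g y) x : R) in *.
  unfold tangent, dds in h.
  rewrite !dot3_scal_l, !dot3_scal_r, !dot3_plus_l, !dot3_plus_r, !dot3_scal_l, !dot3_scal_r in h.
  rewrite !dot3_scal_l, !dot3_scal_r, !dot3_plus_l, !dot3_plus_r, !dot3_scal_l, !dot3_scal_r.
  rewrite (dot3_comm (Derive_on a b A x) (A x)) in *.
  rewrite <- hq in *.
  set (s := speed a b g x) in *. set (m := dot3 (A x) (Derive_on a b A x)) in *.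
  set (r := dot3 (Derive_on a b A x) (Derive_on a b A x)) in *.
  assert (hk : (k : R) = - m * / s * / s * / s).
  { assert (h2 : 2 * (k * s + m * / s * / s) = 0).
    { rewrite <- h. field. lra. }
    replace (k : R) with ((k * s + m * / s * / s) * / s - m * / s * / s * / s) by (field; lra).
    replace (k * s + m * / s * / s) with 0 by lra. ring. }
  rewrite hk. field. lra.
Qed.

End BendingDensity.

(** * Test functions and linear constraints *)

(** The powers of 1/x are included so that the linear span is stable under derivation; [flat 0] is
    the classical function exp(-1/x) continued by zero. *)
Definition flat (k : nat) (x : R) : R :=
  if Rlt_dec 0 x then (/ x) ^ k * exp (- / x) else 0.

Lemma flat_pos (k : nat) (x : R) : 0 < x -> 0 < flat k x.
Proof.
  intros h. unfold flat. destruct (Rlt_dec 0 x) as [_|n]; [|contradiction].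
  apply Rmult_lt_0_compat; [apply pow_lt, Rinv_0_lt_compat, h|apply exp_pos].
Qed.

Lemma flat_nonpos (k : nat) (x : R) : x <= 0 -> flat k x = 0.
Proof. intros h. unfold flat. destruct (Rlt_dec 0 x); [lra|reflexivity]. Qed.

Lemma pow_le_exp (k : nat) : exists C, 0 < C /\ forall z, 0 <= z -> z ^ k <= C * exp z.
Proof.
  induction k as [|k [C [hC IH]]].
  - exists 1. split; [lra|]. intros z hz. simpl.
    pose proof (exp_ineq1_le z). lra.
  - exists (2 ^ S k * C). split; [apply Rmult_lt_0_compat; [apply pow_lt; lra|exact hC]|].
    intros z hz. assert (h2 : 0 <= z / 2) by lra. specialize (IH (z / 2) h2).
    pose proof (exp_ineq1_le (z / 2)) as e.
    replace (exp z) with (exp (z / 2) * exp (z / 2)) by (rewrite <- exp_plus; f_equal; field).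
    replace (z ^ S k) with (2 ^ S k * ((z / 2) ^ k * (z / 2)))
      by (replace ((z / 2) ^ k * (z / 2)) with ((z / 2) ^ S k) by (simpl; ring);
          rewrite <- Rpow_mult_distr; f_equal; field).
    rewrite (Rmult_assoc (2 ^ S k)). apply Rmult_le_compat_l; [apply pow_le; lra|].
    rewrite <- Rmult_assoc. apply Rmult_le_compat; [apply pow_le; exact h2|exact h2|exact IH|lra].
Qed.

Lemma is_derive_flat (k : nat) (x : R) :
  is_derive (flat k) x (- INR k * flat (S k) x + flat (S (S k)) x).
Proof.
  destruct (Rtotal_order x 0) as [h|[h|h]].
  - apply (is_derive_ext_loc (fun _ => 0)).
    + assert (hp : 0 < - x) by lra. exists (mkposreal _ hp). intros y hy.
      change (Rabs (y - x) < - x) in hy. apply Rabs_def2 in hy. symmetry. apply flat_nonpos. lra.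
    + rewrite !flat_nonpos by lra. replace (- INR k * 0 + 0) with 0 by ring.
      apply (is_derive_const (V := R_NormedModule)).
  - subst x. rewrite !flat_nonpos by lra. replace (- INR k * 0 + 0) with 0 by ring.
    (* The exponent [k + 2] is chosen so that a factor y^2 splits off: [flat k y <= C * y^2] for
       [y > 0], hence the derivative at 0 is 0. *)
    destruct (pow_le_exp (S (S k))) as [C [hC HC]].
    split; [exact (is_linear_scal_l (K := R_AbsRing) 0)|].
    intros y Hy eps.
    pose proof
    (is_filter_lim_locally_unique (K := R_AbsRing) (V := R_NormedModule) 0 y Hy).
    subst y. assert (hp : 0 < eps / C) by (apply Rdiv_lt_0_compat; [apply cond_pos|exact hC]).
    exists (mkposreal _ hp). intros y hy. change (Rabs (y - 0) < eps / C) in hy.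
    change (Rabs (flat k y - flat k 0 - (y - 0) * 0) <= eps * Rabs (y - 0)).
    rewrite Rminus_0_r in *. rewrite (flat_nonpos k 0) by lra.
    replace (flat k y - 0 - y * 0) with (flat k y) by ring.
    destruct (Rle_lt_dec y 0) as [hy0|hy0].
    + rewrite flat_nonpos, Rabs_R0 by lra.
      apply Rmult_le_pos; [left; apply cond_pos|apply Rabs_pos].
    + rewrite (Rabs_pos_eq (flat k y)) by (left; now apply flat_pos).
      rewrite (Rabs_pos_eq y) in * by lra.
      assert (F : flat k y = y * y * ((/ y) ^ S (S k) * exp (- / y))).
      { unfold flat. destruct (Rlt_dec 0 y); [|lra]. simpl. field. lra. }
      assert (B : (/ y) ^ S (S k) * exp (- / y) <= C).
      { pose proof (HC (/ y) (Rlt_le _ _ (Rinv_0_lt_compat _ hy0))) as B.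
        rewrite exp_Ropp. pose proof (exp_pos (/ y)) as ep.
        apply (Rmult_le_reg_r (exp (/ y))); [exact ep|].
        rewrite Rmult_assoc, Rinv_l by lra. lra. }
      rewrite F, Rmult_assoc, (Rmult_comm eps).
      apply Rmult_le_compat_l; [lra|].
      apply Rle_trans with (y * C).
      * apply Rmult_le_compat_l; [lra|exact B].
      * apply (Rmult_le_reg_r (/ C)); [now apply Rinv_0_lt_compat|].
        rewrite Rmult_assoc, Rinv_r by lra. unfold Rdiv in hy. lra.
  - apply (is_derive_ext_loc (fun y => (/ y) ^ k * exp (- / y))).
    + exists (mkposreal _ h). intros y hy.
      change (Rabs (y - x) < x) in hy. apply Rabs_def2 in hy.
      unfold flat. destruct (Rlt_dec 0 y); [reflexivity|lra].
    + unfold flat. destruct (Rlt_dec 0 x) as [_|n]; [|contradiction].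
      auto_derive; [lra|].
      destruct k as [|k]; [simpl; field; lra|].
      change (Init.Nat.pred (S k)) with k.
      change (match k with O => 1 | S _ => INR k + 1 end) with (INR (S k)).
      rewrite <- !tech_pow_Rmult. field. lra.
Qed.

Inductive flat_span : (R -> R) -> Prop :=
| flat_span_base k : flat_span (flat k)
| flat_span_comb c f g : flat_span f -> flat_span g -> flat_span (fun x => c * f x + g x).

Lemma flat_derivatives : exists H : nat -> R -> R,
  H O = flat 0 /\ forall n x, is_derive (H n) x (H (S n) x).
Proof.
  apply (dependent_sequence flat_span (fun f g => forall x, is_derive f x (g x)) (flat 0)).
  - apply flat_span_base.
  - intros f hf. induction hf as [k|c f g _ [f' [cf df]] _ [g' [cg dg]]].
    + exists (fun x => - INR k * flat (S k) x + flat (S (S k)) x).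
      split; [|exact (is_derive_flat k)].
      apply flat_span_comb; apply flat_span_base.
    + exists (fun x => c * f' x + g' x). split; [now apply flat_span_comb|].
      intros x. apply (is_derive_plus (V := R_NormedModule) (fun x => c * f x) g); [|apply dg].
      apply (is_derive_scal f x c), df.
Qed.

Lemma smooth_bump (a b c d : R) : c < d ->
  exists psi : R -> R, smooth_on a b psi /\ (forall x, 0 <= psi x) /\
    (forall x, c < x < d -> 0 < psi x) /\ (forall x, x <= c \/ d <= x -> psi x = 0).
Proof.
  intros hcd. destruct flat_derivatives as [H [H0 dH]].
  assert (sid : smooth_on a b (fun x : R => x)).
  { apply (smooth_on_of_derive a b (fun x : R => x) (fun _ => 1));
      [|exact (smooth_on_const (V := R_NormedModule) a b 1)].
    intros x hx. apply is_derive_on_of_is_derive; [exact hx|].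
    apply (is_derive_id (K := R_AbsRing)). }
  exists (fun x => flat 0 (x - c) * flat 0 (d - x)).
  split; [|split; [|split]].
  - rewrite <- H0. apply smooth_on_mult.
    + apply (smooth_on_comp a b (fun _ => True) H); [auto|auto|].
      apply smooth_on_minus; [exact sid|exact (smooth_on_const (V := R_NormedModule) a b c)].
    + apply (smooth_on_comp a b (fun _ => True) H); [auto|auto|].
      apply smooth_on_minus; [exact (smooth_on_const (V := R_NormedModule) a b d)|exact sid].
  - assert (p : forall y, 0 <= flat 0 y).
    { intros y. destruct (Rle_lt_dec y 0) as [h|h].
      - rewrite flat_nonpos; lra.
      - left. now apply flat_pos. }
    intros x. now apply Rmult_le_pos.
  - intros x hx. apply Rmult_lt_0_compat; apply flat_pos; lra.
  - intros x [hx|hx].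
    + rewrite (flat_nonpos 0 (x - c)) by lra. ring.
    + rewrite (flat_nonpos 0 (d - x)) by lra. ring.
Qed.

(** The integral over each initial piece is squeezed to zero between nonnegative summands, so its
    derivative [f x] is zero. End points are excluded because the derivative in the upper limit is
    taken two-sidedly. *)
Lemma RInt_nonneg_eq_zero (a b : R) (f : R -> R) (x : R) :
  a < b -> smooth_on a b f -> (forall y, Icc a b y -> 0 <= f y) -> RInt f a b = 0 ->
  a < x < b -> f x = 0.
Proof.
  intros hab sf hf h0 hx.
  set (g := fun y => f (clamp a b y)).
  assert (cg : forall y, continuous g y) by (intros y; now apply smooth_on_continuous).
  assert (eg : forall u v, ex_RInt g u v).
  { intros u v. apply (ex_RInt_continuous (V := R_CompleteNormedModule)). auto. }
  assert (pg : forall y, 0 <= g y) by (intros y; apply hf; now apply clamp_Icc).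
  assert (Z : forall y, a < y < b -> RInt g a y = 0).
  { intros y hy.
    pose proof (RInt_ge_0 g a y ltac:(lra) (eg a y) (fun z _ => pg z)) as p1.
    pose proof (RInt_ge_0 g y b ltac:(lra) (eg y b) (fun z _ => pg z)) as p2.
    pose proof (RInt_Chasles (V := R_CompleteNormedModule) g a y b (eg a y) (eg y b)) as C.
    change (RInt g a y + RInt g y b = RInt g a b) in C.
    unfold g in C at 3. rewrite (RInt_clamp a b hab f), h0 in C. lra. }
  assert (D : is_derive (fun y => RInt g a y) x (g x)).
  { apply (is_derive_RInt (V := R_NormedModule) g _ a x); [|apply cg].
    apply filter_forall. intros z. now apply (RInt_correct (V := R_CompleteNormedModule)). }
  assert (D0 : is_derive (fun y => RInt g a y) x 0).
  { apply (is_derive_ext_loc (fun _ => 0)); [|apply (is_derive_const (V := R_NormedModule))].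
    assert (hp : 0 < Rmin (x - a) (b - x)) by (apply Rmin_glb_lt; lra).
    exists (mkposreal _ hp). intros y hy. symmetry. apply Z.
    change (Rabs (y - x) < Rmin (x - a) (b - x)) in hy.
    pose proof (Rmin_l (x - a) (b - x)). pose proof (Rmin_r (x - a) (b - x)).
    apply Rabs_def2 in hy. lra. }
  transitivity (g x); [unfold g; now rewrite clamp_id by (unfold Icc; lra)|].
  rewrite <- (is_derive_unique _ _ _ D). exact (is_derive_unique _ _ _ D0).
Qed.

Lemma smooth_on_zero_closure (a b : R) (f : R -> R) (x : R) :
  a < b -> smooth_on a b f -> (forall y, a < y < b -> f y = 0) -> Icc a b x -> f x = 0.
Proof.
  intros hab sf h hx.
  destruct (Req_dec (f x) 0) as [e|ne]; [exact e|exfalso].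
  pose proof (smooth_on_continuous a b hab f x sf) as C.
  assert (hp : 0 < Rabs (f x)) by now apply Rabs_pos_lt.
  destruct (C (fun z => Rabs (z - f x) < Rabs (f x))) as [e He].
  { exists (mkposreal _ hp). rewrite (clamp_id a b x hx). intros z hz. exact hz. }
  set (m := (a + b) / 2).
  assert (exists y, a < y < b /\ Rabs (y - x) < e) as [y [hy hye]].
  { pose proof (cond_pos e) as ep. unfold Icc in hx.
    destruct (Rle_lt_dec x m) as [l|l]; unfold m in l.
    - exists (x + Rmin (e / 2) ((b - a) / 4)).
      assert (0 < Rmin (e / 2) ((b - a) / 4)) by (apply Rmin_glb_lt; lra).
      pose proof (Rmin_l (e / 2) ((b - a) / 4)). pose proof (Rmin_r (e / 2) ((b - a) / 4)).
      split; [lra|]. rewrite Rabs_pos_eq; lra.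
    - exists (x - Rmin (e / 2) ((b - a) / 4)).
      assert (0 < Rmin (e / 2) ((b - a) / 4)) by (apply Rmin_glb_lt; lra).
      pose proof (Rmin_l (e / 2) ((b - a) / 4)). pose proof (Rmin_r (e / 2) ((b - a) / 4)).
      split; [lra|]. rewrite Rabs_left; lra. }
  specialize (He y hye). rewrite (clamp_id a b y), (h y hy) in He by (unfold Icc; lra).
  replace (0 - f x) with (- f x) in He by ring. rewrite Rabs_Ropp in He. lra.
Qed.

Section TestFunctions.
Variables (a b : R).
Hypothesis hab : a < b.

Definition test_pair (p : (R -> R) * (R -> R)) : Prop :=
  smooth_on a b (fst p) /\ smooth_on a b (snd p) /\
  exists c d, a < c /\ c <= d /\ d < b /\
    forall x, Icc a b x -> x < c \/ d < x -> fst p x = 0 /\ snd p x = 0.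

(** This single operation expresses linearity: a set stable under it and a functional respecting it
    are all that the kernel arguments below need. *)
Definition pair_comb (k : R) (p q : (R -> R) * (R -> R)) : (R -> R) * (R -> R) :=
  (fun x => fst p x + k * fst q x, fun x => snd p x + k * snd q x).

Definition pairing (u p : (R -> R) * (R -> R)) : R :=
  RInt (fun x => fst p x * fst u x + snd p x * snd u x) a b.

Definition smooth_pair (p : (R -> R) * (R -> R)) : Prop :=
  smooth_on a b (fst p) /\ smooth_on a b (snd p).

Lemma smooth_pair_comb (k : R) (p q : (R -> R) * (R -> R)) :
  smooth_pair p -> smooth_pair q -> smooth_pair (pair_comb k p q).
Proof.
  intros [p1 p2] [q1 q2]. pose proof (smooth_on_const (V := R_NormedModule) a b k) as sk.
  split; apply smooth_on_plus; auto; now apply smooth_on_mult.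
Qed.

Lemma test_pair_smooth (p : (R -> R) * (R -> R)) : test_pair p -> smooth_pair p.
Proof. intros [p1 [p2 _]]. now split. Qed.

Lemma pairing_comm (u p : (R -> R) * (R -> R)) : pairing u p = pairing p u.
Proof. apply RInt_ext. intros x _. eq_in_R. ring. Qed.

Lemma test_pair_comb (k : R) (p q : (R -> R) * (R -> R)) :
  test_pair p -> test_pair q -> test_pair (pair_comb k p q).
Proof.
  intros [p1 [p2 [c [d [hc [hcd [hd hp]]]]]]] [q1 [q2 [c' [d' [hc' [hcd' [hd' hq]]]]]]].
  pose proof (smooth_on_const (V := R_NormedModule) a b k) as sk.
  split; [apply smooth_on_plus; [exact p1|now apply smooth_on_mult]|].
  split; [apply smooth_on_plus; [exact p2|now apply smooth_on_mult]|].
  exists (Rmin c c'), (Rmax d d').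
  pose proof (Rmin_l c c'). pose proof (Rmin_r c c').
  pose proof (Rmax_l d d'). pose proof (Rmax_r d d').
  split; [now apply Rmin_glb_lt|]. split; [lra|]. split; [now apply Rmax_lub_lt|].
  intros x hx h. simpl.
  destruct (hp x hx) as [-> ->]; [lra|]. destruct (hq x hx) as [-> ->]; [lra|]. split; ring.
Qed.

Lemma pairing_comb (k : R) (u p q : (R -> R) * (R -> R)) :
  smooth_pair u -> smooth_pair p -> smooth_pair q ->
  pairing u (pair_comb k p q) = pairing u p + k * pairing u q.
Proof.
  intros [u1 u2] [p1 p2] [q1 q2]. unfold pairing.
  assert (ep : ex_RInt (fun x => fst p x * fst u x + snd p x * snd u x) a b).
  { apply (ex_RInt_smooth a b hab). apply smooth_on_plus; now apply smooth_on_mult. }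
  assert (eq : ex_RInt (fun x => fst q x * fst u x + snd q x * snd u x) a b).
  { apply (ex_RInt_smooth a b hab). apply smooth_on_plus; now apply smooth_on_mult. }
  pose proof (is_RInt_plus _ _ a b _ _ (RInt_correct _ a b ep)
    (is_RInt_scal _ a b k _ (RInt_correct _ a b eq))) as H.
  apply is_RInt_unique in H. etransitivity; [|exact H].
  apply RInt_ext. intros x _. unfold plus, scal; simpl. unfold mult; simpl. ring.
Qed.

(** If [M p0] is nonzero, subtracting the right multiple of [p0] moves any [p] into the kernel of
    [M], where [L] is zero; this determines [L p]. *)
Lemma functional_multiple {E : Type} (S : E -> Prop) (comb : R -> E -> E -> E) (M L : E -> R) :
  (forall k p q, S p -> S q -> S (comb k p q)) ->
  (forall k p q, S p -> S q -> M (comb k p q) = M p + k * M q) ->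
  (forall k p q, S p -> S q -> L (comb k p q) = L p + k * L q) ->
  (forall p, S p -> M p = 0 -> L p = 0) ->
  exists c, forall p, S p -> L p = c * M p.
Proof.
  intros hS hM hL h.
  destruct (classic (exists p0, S p0 /\ M p0 <> 0)) as [[p0 [s0 n0]]|n].
  - exists (L p0 / M p0). intros p sp.
    assert (z : M (comb (- (M p / M p0)) p p0) = 0) by (rewrite hM by auto; field; exact n0).
    apply h in z; [|auto]. rewrite hL in z by auto.
    replace (L p) with (M p / M p0 * L p0) by lra. field. exact n0.
  - exists 0. intros p sp. rewrite Rmult_0_l. apply h; [exact sp|].
    destruct (Req_dec (M p) 0) as [e|ne]; [exact e|]. exfalso. apply n. now exists p.
Qed.

(** Lagrange multipliers in linear form: a functional vanishing on the common kernel of finitely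
    many others is a combination of them. *)
Lemma functional_span {E : Type} (S : E -> Prop) (comb : R -> E -> E -> E)
    (Ms : list (E -> R)) (L : E -> R) :
  (forall k p q, S p -> S q -> S (comb k p q)) ->
  (forall M, List.In M Ms -> forall k p q, S p -> S q -> M (comb k p q) = M p + k * M q) ->
  (forall k p q, S p -> S q -> L (comb k p q) = L p + k * L q) ->
  (forall p, S p -> (forall M, List.In M Ms -> M p = 0) -> L p = 0) ->
  exists cs : list R, List.length cs = List.length Ms /\
    forall p, S p ->
      L p = List.fold_right (fun cM s => fst cM * snd cM p + s) 0 (List.combine cs Ms).
Proof.
  intros hS. revert L. induction Ms as [|M Ms IH]; intros L hMs hL h.
  - exists nil. split; [reflexivity|]. intros p sp. apply h; [exact sp|contradiction].
  (* On the common kernel of the tail, [L] is a multiple [c] of the head [M]. Then [L - c M]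
     vanishes on that kernel, and the induction hypothesis applies to it with the tail alone. *)
  - destruct (functional_multiple (fun p => S p /\ forall M, List.In M Ms -> M p = 0) comb M L)
      as [c hc].
    + intros k p q [sp zp] [sq zq]. split; [auto|]. intros M' i.
      rewrite hMs, zp, zq by (auto || now right). ring.
    + intros k p q [sp _] [sq _]. apply hMs; auto. now left.
    + intros k p q [sp _] [sq _]. auto.
    + intros p [sp zp] z. apply h; [exact sp|]. intros M' [<-|i]; auto.
    + destruct (IH (fun p => L p - c * M p)) as [cs [hlen hcs]].
      * intros M' i. apply hMs. now right.
      * intros k p q sp sq. rewrite hL, (hMs M) by (auto || now left). ring.
      * intros p sp zp. rewrite hc by auto. ring.
      * exists (cons c cs). split; [simpl; now rewrite hlen|].
        intros p sp. specialize (hcs p sp). simpl. lra.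
Qed.

(** Testing with [u] times a bump around [x] makes the integrand a nonnegative multiple of the
    squared length of [u], so [u] vanishes inside the interval, and at the ends by continuity. *)
Lemma pairing_zero (u : (R -> R) * (R -> R)) :
  smooth_pair u -> (forall p, test_pair p -> pairing u p = 0) ->
  forall x, Icc a b x -> fst u x = 0 /\ snd u x = 0.
Proof.
  intros [u1 u2] H.
  assert (I : forall x, a < x < b -> fst u x * fst u x + snd u x * snd u x = 0).
  { intros x hx.
    destruct (smooth_bump a b ((a + x) / 2) ((x + b) / 2)) as [psi [spsi [psi0 [psip psiz]]]]; [lra|].
    set (f := fun y => psi y * (fst u y * fst u y + snd u y * snd u y)).
    assert (sf : smooth_on a b f).
    { apply smooth_on_mult; [exact spsi|]. apply smooth_on_plus; now apply smooth_on_mult. }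
    assert (fx : f x = 0).
    { apply (RInt_nonneg_eq_zero a b); [exact hab|exact sf| | |exact hx].
      - intros y _. apply Rmult_le_pos; [apply psi0|nra].
      - rewrite <- (H (fun y => psi y * fst u y, fun y => psi y * snd u y)).
        + apply RInt_ext. intros y _. unfold f. simpl. ring.
        + split; [now apply smooth_on_mult|]. split; [now apply smooth_on_mult|].
          exists ((a + x) / 2), ((x + b) / 2). split; [lra|]. split; [lra|]. split; [lra|].
          intros y _ hy. simpl. rewrite psiz by lra. split; ring. }
    assert (px : 0 < psi x) by (apply psip; lra).
    apply (Rmult_eq_reg_l (psi x)); [|lra]. rewrite Rmult_0_r. exact fx. }
  intros x hx. split; apply (smooth_on_zero_closure a b _ x hab); auto; intros y hy;
    specialize (I y hy); nra.
Qed.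

End TestFunctions.

(** * First variation *)

Section FramedCurve.
Variables (a b : R) (gamma N1 N2 : R -> R * R * R) (kappa : R -> R * R).
Hypotheses (hab : a < b) (hgamma : is_curve a b gamma).
Hypothesis harc : arc_length_parametrized a b gamma.
Hypothesis hN : parallel_frame a b gamma N1 N2.
Hypothesis hkappa : is_curvature_function a b gamma N1 N2 kappa.

Local Notation T := (Derive_on a b gamma).
Local Notation k1 := (fun x => fst (kappa x)).
Local Notation k2 := (fun x => snd (kappa x)).

Lemma smooth_on_T : smooth_on a b T.
Proof. apply smooth_on_Derive; [exact hab|apply hgamma]. Qed.

Lemma smooth_on_N1 : smooth_on a b N1.
Proof. apply hN. Qed.

Lemma smooth_on_N2 : smooth_on a b N2.
Proof. apply hN. Qed.

Lemma smooth_on_k1 : smooth_on a b k1.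
Proof. apply (smooth_on_fst a b kappa), hkappa. Qed.

Lemma smooth_on_k2 : smooth_on a b k2.
Proof. apply (smooth_on_snd a b kappa), hkappa. Qed.

Lemma tangent_arc_length (x : R) : Icc a b x -> tangent a b gamma x = T x.
Proof.
  intros hx. unfold tangent, dds. rewrite (harc x hx), Rinv_1. apply pair3_eq; vector_ring.
Qed.

Lemma T_unit (x : R) : Icc a b x -> dot3 (T x) (T x) = 1.
Proof. intros hx. apply norm3_eq_1, harc, hx. Qed.

Lemma N1_unit (x : R) : Icc a b x -> dot3 (N1 x) (N1 x) = 1.
Proof. intros hx. apply norm3_eq_1. now apply hN. Qed.

Lemma N2_unit (x : R) : Icc a b x -> dot3 (N2 x) (N2 x) = 1.
Proof. intros hx. apply norm3_eq_1. now apply hN. Qed.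

Lemma N1_T (x : R) : Icc a b x -> dot3 (N1 x) (T x) = 0.
Proof. intros hx. rewrite <- tangent_arc_length by exact hx. now apply hN. Qed.

Lemma N2_T (x : R) : Icc a b x -> dot3 (N2 x) (T x) = 0.
Proof. intros hx. rewrite <- tangent_arc_length by exact hx. now apply hN. Qed.

(** Equality case of Cauchy-Schwarz: the unit vectors [N2] and [T x N1] have inner product equal to
    the determinant, which is 1, so their difference has squared length 1 + 1 - 2. Orthogonality of
    [N1] and [N2] is a consequence. *)
Lemma N2_eq (x : R) : Icc a b x -> N2 x = cross (T x) (N1 x).
Proof.
  intros hx.
  assert (h : det3 (T x) (N1 x) (N2 x) = 1).
  { rewrite <- tangent_arc_length by exact hx. now apply hN. }
  pose proof (frame_dot_M2_M2 (T x) (N1 x) _ (T_unit x hx) (N1_unit x hx) (N1_T x hx) eq_refl)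
    as u.
  assert (h0 : dot3 (minus (N2 x) (cross (T x) (N1 x))) (minus (N2 x) (cross (T x) (N1 x))) = 0).
  { transitivity (dot3 (N2 x) (N2 x) + dot3 (cross (T x) (N1 x)) (cross (T x) (N1 x))
                  - 2 * det3 (T x) (N1 x) (N2 x)); [vector_ring|].
    rewrite u, h, N2_unit by exact hx. ring. }
  apply (minus_eq_zero_eq (G := prod_AbelianGroup (prod_AbelianGroup R_AbelianGroup R_AbelianGroup) R_AbelianGroup)).
  now apply dot3_self_eq_0.
Qed.

Lemma derive_T (x : R) : Icc a b x ->
  Derive_on a b T x = opp (plus (scal (k1 x) (N1 x)) (scal (k2 x) (N2 x))).
Proof.
  intros hx. transitivity (Derive_on a b (tangent a b gamma) x); [|exact (proj2 hkappa x hx)].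
  symmetry.
  apply Derive_on_eq; [exact hab|exact hx|].
  apply (is_derive_on_ext a b T); [exact hx| |].
  - intros y hy. symmetry. now apply tangent_arc_length.
  - apply smooth_on_is_derive; [exact smooth_on_T|exact hx].
Qed.

(** Differentiating [<Z, T> = 0] identifies the unspecified factor [lam] in the definition of
    parallel fields. *)
Lemma parallel_unit_derive (Z : R -> R * R * R) (x : R) :
  Icc a b x -> parallel_normal_field a b gamma Z ->
  Derive_on a b Z x = scal (- dot3 (Z x) (Derive_on a b T x)) (T x).
Proof.
  intros hx [[sZ hZ] [lam [_ hlam]]].
  assert (hZT : forall y, Icc a b y -> dot3 (Z y) (T y) = 0).
  { intros y hy. rewrite <- tangent_arc_length by exact hy. now apply hZ. }
  pose proof (is_derive_on_dot3_const a b hab Z T 0 x hx sZ smooth_on_T hZT) as h.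
  rewrite (hlam x hx), (tangent_arc_length x hx), dot3_scal_l, (T_unit x hx) in h.
  rewrite (hlam x hx), (tangent_arc_length x hx). f_equal. lra.
Qed.

Lemma derive_N1 (x : R) : Icc a b x -> Derive_on a b N1 x = scal (k1 x) (T x).
Proof.
  intros hx. rewrite parallel_unit_derive by (exact hx || apply hN).
  rewrite (derive_T x hx), dot3_opp_r, dot3_plus_r, !dot3_scal_r, N1_unit,
    (frame_dot_M1_M2 (T x) (N1 x) (N2 x) (N2_eq x hx)) by exact hx.
  f_equal. ring.
Qed.

Lemma derive_N2 (x : R) : Icc a b x -> Derive_on a b N2 x = scal (k2 x) (T x).
Proof.
  intros hx. rewrite parallel_unit_derive by (exact hx || apply hN).
  rewrite (derive_T x hx), dot3_opp_r, dot3_plus_r, !dot3_scal_r, N2_unit, (dot3_comm (N2 x)),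
    (frame_dot_M1_M2 (T x) (N1 x) (N2 x) (N2_eq x hx)) by exact hx.
  f_equal. ring.
Qed.

Section Variation.
Variables (v : R -> R * R * R) (eps : R) (G : R -> R -> R * R * R).
Hypotheses (sv : smooth_on a b v) (hG : is_variation a b gamma v eps G).
Hypothesis hv : forall x, Icc a b x -> dot3 (Derive_on a b v x) (T x) = 0.

Local Notation w := (Derive_on a b v).

(** [A] and [B] are the first and second space derivatives of the variation, [dA] and [dB] their
    parameter derivatives. Both densities are built from [A], [B] and fixed fields, so this is all
    that is needed from the variation. The open range of [t] makes parameter derivatives
    two-sided. *)
Definition is_jet (A B dA dB : R -> R -> R * R * R) : Prop :=
  (forall t x, Rabs t < eps -> Icc a b x ->
     Derive_on a b (G t) x = A t x /\ Derive_on a b (Derive_on a b (G t)) x = B t x) /\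
  param_derive3 a b eps A dA /\ param_derive3 a b eps B dB /\
  (forall x, Icc a b x ->
     A 0 x = T x /\ B 0 x = Derive_on a b T x /\ dA 0 x = w x /\ dB 0 x = Derive_on a b w x).

Lemma exists_jet : exists A B dA dB, is_jet A B dA dB.
Proof.
  destruct hG as [heps [[F [F0 HF]] [_ [G0 [_ hvG]]]]].
  assert (it : forall t, Rabs t < eps -> Icc (- eps) eps t).
  { intros t ht. apply Rabs_def2 in ht. unfold Icc. lra. }
  assert (h0 : Rabs 0 < eps) by (rewrite Rabs_R0; exact heps).
  assert (DG : forall t x, Rabs t < eps -> Icc a b x -> Derive_on a b (G t) x = F 0%nat 1%nat t x).
  { intros t x ht hx. apply Derive_on_eq; [exact hab|exact hx|].
    apply (is_derive_on_ext a b (F 0%nat 0%nat t)); [exact hx| |].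
    - intros y hy. apply F0; auto.
    - apply HF; auto. }
  assert (DG2 : forall t x, Rabs t < eps -> Icc a b x ->
    Derive_on a b (Derive_on a b (G t)) x = F 0%nat 2%nat t x).
  { intros t x ht hx. apply Derive_on_eq; [exact hab|exact hx|].
    apply (is_derive_on_ext a b (F 0%nat 1%nat t)); [exact hx| |].
    - intros y hy. symmetry. apply DG; auto.
    - apply HF; auto. }
  assert (Dg : forall x, Icc a b x -> T x = F 0%nat 1%nat 0 x).
  { intros x hx. apply Derive_on_eq; [exact hab|exact hx|].
    apply (is_derive_on_ext a b (F 0%nat 0%nat 0)); [exact hx| |].
    - intros y hy. rewrite F0, G0; auto.
    - apply HF; auto. }
  assert (Ev : forall x, Icc a b x -> F 1%nat 0%nat 0 x = v x).
  { intros x hx. assert (i0 : Icc (- eps) eps 0) by auto.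
    apply (is_derive_on_unique (- eps) eps ltac:(lra) (fun t => G t x) 0); [exact i0| |].
    - apply (is_derive_on_ext (- eps) eps (fun t => F 0%nat 0%nat t x)); [exact i0| |].
      + intros t ht. now apply F0.
      + now apply HF.
    - apply is_derive_on_of_is_derive; [exact i0|now apply hvG]. }
  (* Symmetry of mixed derivatives is built into the array [F]: its entry (1, 1) is the space
     derivative of [F 1 0], which is [v] at parameter 0, and also the parameter derivative of
     [F 0 1]. *)
  assert (Ew : forall x, Icc a b x -> w x = F 1%nat 1%nat 0 x).
  { intros x hx. apply Derive_on_eq; [exact hab|exact hx|].
    apply (is_derive_on_ext a b (F 1%nat 0%nat 0)); [exact hx|exact Ev|]. apply HF; auto. }
  exists (F 0%nat 1%nat), (F 0%nat 2%nat), (F 1%nat 1%nat), (F 1%nat 2%nat).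
  split; [intros t x ht hx; split; auto|].
  split; [now apply smooth_on2_param_derive3|]. split; [now apply smooth_on2_param_derive3|].
  intros x hx. split; [symmetry; auto|]. split; [|split; [symmetry; auto|]].
  - symmetry. apply Derive_on_eq; [exact hab|exact hx|].
    apply (is_derive_on_ext a b (F 0%nat 1%nat 0)); [exact hx| |].
    + intros y hy. symmetry. auto.
    + apply HF; auto.
  - symmetry. apply Derive_on_eq; [exact hab|exact hx|].
    apply (is_derive_on_ext a b (F 1%nat 1%nat 0)); [exact hx| |].
    + intros y hy. symmetry. auto.
    + apply HF; auto.
Qed.

Lemma is_bending_variation_formula (rho : R -> R) : smooth_on a b rho ->
  is_bending_variation a b rho G
    (RInt (fun x => rho x * dot3 (Derive_on a b T x) (Derive_on a b w x)) a b).
Proof.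
  intros srho. destruct exists_jet as [A [B [dA [dB [HD [PA [PB H0]]]]]]].
  pose proof (proj1 hG) as heps.
  pose proof (param_derive_dot3 a b eps _ _ _ _ PA PA) as Pq.
  pose proof (param_derive_dot3 a b eps _ _ _ _ PB PB) as Pr.
  pose proof (param_derive_dot3 a b eps _ _ _ _ PA PB) as Pm.
  assert (qpos : forall t x, Rabs t < eps -> Icc a b x -> 0 < dot3 (A t x) (A t x)).
  { intros t x ht hx. rewrite <- (proj1 (HD t x ht hx)). apply curve_dot_pos; [|exact hx].
    apply hG. apply Rabs_def2 in ht. unfold Icc. lra. }
  (* With q = [<A, A>], r = [<B, B>] and m = [<A, B>], the density is rho (q r - m^2) q^(-3) sqrt q,
     as in [bending_density]. *)
  pose proof (param_derive_mult a b eps _ _ _ _ (param_derive_const a b hab eps rho srho)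
    (param_derive_mult a b eps _ _ _ _
      (param_derive_mult a b eps _ _ _ _
        (param_derive_minus a b eps _ _ _ _ (param_derive_mult a b eps _ _ _ _ Pq Pr)
                                        (param_derive_mult a b eps _ _ _ _ Pm Pm))
        (param_derive_inv a b hab eps _ _ (fun t x ht hx => Rgt_not_eq _ _
           (Rmult_lt_0_compat _ _ (Rmult_lt_0_compat _ _ (qpos t x ht hx) (qpos t x ht hx))
              (qpos t x ht hx)))
           (param_derive_mult a b eps _ _ _ _ (param_derive_mult a b eps _ _ _ _ Pq Pq) Pq)))
      (param_derive_sqrt a b hab eps _ _ qpos Pq))) as P.
  pose proof (is_derive_RInt_smooth_param a b hab eps _ _ heps P) as D. clear P Pq Pr Pm.
  unfold is_bending_variation, bending_energy.
  match type of D with is_derive (fun t => RInt (@?f t) a b) _ (RInt ?df a b) =>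
    set (e := f) in D; set (de := df) in D end.
  apply (is_derive_ext_loc (fun t => 1 / 2 * RInt (e t) a b)).
  { apply (filter_imp (fun t => Rabs t < eps)).
    2:{ apply (locally_Rabs_lt eps 0). rewrite Rabs_R0. exact heps. }
    intros t ht. f_equal. apply RInt_ext. intros x.
    rewrite Rmin_left, Rmax_right by lra. intros hx.
    assert (ix : Icc a b x) by (unfold Icc; lra).
    assert (hc : is_curve a b (G t)).
    { apply hG. apply Rabs_def2 in ht. unfold Icc. lra. }
    rewrite Rmult_assoc, (bending_density a b (G t) hab hc x ix).
    destruct (HD t x ht ix) as [-> ->]. reflexivity. }
  replace (RInt (fun x => rho x * dot3 (Derive_on a b T x) (Derive_on a b w x)) a b)
    with (1 / 2 * RInt de a b).
  { apply (is_derive_scal (fun t => RInt (e t) a b) 0 (1 / 2)). exact D. }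
  (* At parameter 0 one has q = 1 and m = 0, and the derivative of q is 2 [<T, w>] = 0. Only the
     derivative 2 [<T', w'>] of r survives. *)
  assert (E : RInt de a b =
    RInt (fun x => scal 2 (rho x * dot3 (Derive_on a b T x) (Derive_on a b w x))) a b).
  { apply RInt_ext. intros x. rewrite Rmin_left, Rmax_right by lra. intros hx.
    assert (ix : Icc a b x) by (unfold Icc; lra).
    destruct (H0 x ix) as [E1 [E2 [E3 E4]]]. unfold de. rewrite E1, E2, E3, E4.
    pose proof (is_derive_on_dot3_const a b hab T T 1 x ix smooth_on_T smooth_on_T T_unit) as h.
    rewrite (dot3_comm (Derive_on a b T x) (T x)) in h.
    replace (dot3 (T x) (Derive_on a b T x)) with 0 by lra.
    rewrite (dot3_comm (T x) (w x)), hv, (T_unit x ix), sqrt_1 by exact ix.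
    rewrite (dot3_comm (Derive_on a b w x) (Derive_on a b T x)). unfold scal, mult; simpl; unfold mult; simpl. field. }
  rewrite E. rewrite (RInt_scal (V := R_CompleteNormedModule)).
  - unfold scal, mult; simpl; unfold mult; simpl. field.
  - apply (ex_RInt_smooth a b hab (fun x => rho x * dot3 (Derive_on a b T x) (Derive_on a b w x))).
    apply smooth_on_mult; [exact srho|]. apply smooth_on_dot3; apply smooth_on_Derive;
      try exact hab; [exact smooth_on_T|apply smooth_on_Derive; [exact hab|exact sv]].
Qed.

Lemma cross_N2_T (x : R) : Icc a b x -> cross (N2 x) (T x) = N1 x.
Proof.
  intros hx. rewrite (N2_eq x hx).
  transitivity (minus (scal (dot3 (T x) (T x)) (N1 x)) (scal (dot3 (N1 x) (T x)) (T x)));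
    [apply pair3_eq; vector_ring|].
  rewrite T_unit, N1_T by exact hx. apply pair3_eq; vector_ring.
Qed.

Lemma variation_end_derive (t x : R) : Icc (- eps) eps t -> x = a \/ x = b ->
  Derive_on a b (G t) x = T x.
Proof.
  intros ht hx. destruct hG as [_ [_ [_ [_ [[c [d [hc [hcd [hd hsupp]]]]] _]]]]].
  assert (ix : Icc a b x) by (unfold Icc; lra).
  apply Derive_on_eq; [exact hab|exact ix|].
  apply (is_derive_on_ext_loc a b gamma); [exact ix| |].
  - assert (hp : 0 < Rmin (c - a) (b - d)) by (apply Rmin_glb_lt; lra).
    exists (mkposreal _ hp). intros y hy iy. symmetry. apply hsupp; [exact ht|exact iy|].
    change (Rabs (y - x) < Rmin (c - a) (b - d)) in hy.
    pose proof (Rmin_l (c - a) (b - d)). pose proof (Rmin_r (c - a) (b - d)).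
    apply Rabs_def2 in hy. lra.
  - apply smooth_on_is_derive; [apply hgamma|exact ix].
Qed.

Lemma projected_frame_end (t x : R) : Icc (- eps) eps t -> x = a \/ x = b ->
  projected_normal a b (G t) N2 x = N1 x /\ projected_binormal a b (G t) N2 x = N2 x.
Proof.
  intros ht hx.
  assert (ix : Icc a b x) by (unfold Icc; lra).
  pose proof (variation_end_derive t x ht hx) as E.
  assert (e : projected_normal a b (G t) N2 x = N1 x).
  { unfold projected_normal, normal_cross. rewrite E, cross_N2_T, N1_unit, sqrt_1, Rinv_1 by exact ix.
    apply pair3_eq; vector_ring. }
  split; [exact e|]. unfold projected_binormal, tangent, dds, speed. rewrite e, E.
  fold (speed a b gamma x). rewrite (harc x ix), Rinv_1, (N2_eq x ix).
  apply pair3_eq; vector_ring.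
Qed.

(** [I t] is the total rotation, along [G t], of the frame projected from [N2]. As this frame is
    [(N1, N2)] at both ends, [alpha] and [beta] serve for all [t]. *)
Lemma holonomy_angle : exists (d : R) (I : R -> R),
  0 < d /\
  is_derive I 0 (RInt (fun x => k2 x * dot3 (w x) (N1 x) - k1 x * dot3 (w x) (N2 x)) a b) /\
  forall (Wa Wb : R * R * R) (alpha beta t theta : R), Rabs t < d ->
    Wa = plus (scal (cos alpha) (N1 a)) (scal (sin alpha) (N2 a)) ->
    Wb = plus (scal (cos beta) (N1 b)) (scal (sin beta) (N2 b)) ->
    is_holonomy a b (G t) Wa Wb theta <->
    cos (theta + beta) = cos (alpha - I t) /\ sin (theta + beta) = sin (alpha - I t).
Proof.
  destruct exists_jet as [A [B [dA [dB [HD [PA [PB H0]]]]]]].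
  pose proof (proj1 hG) as heps.
  assert (hcurve : forall t, Rabs t < eps -> is_curve a b (G t)).
  { intros t ht. apply hG. apply Rabs_def2 in ht. unfold Icc. lra. }
  assert (sDN2 : smooth_on a b (Derive_on a b N2)) by (apply smooth_on_Derive; [exact hab|exact smooth_on_N2]).
  pose proof (param_derive3_const a b hab eps N2 smooth_on_N2) as PN.
  pose proof (param_derive3_const a b hab eps _ sDN2) as PDN.
  pose proof (param_derive3_cross a b eps _ _ _ _ PN PA) as PQ.
  pose proof (param_derive3_plus a b eps _ _ _ _ (param_derive3_cross a b eps _ _ _ _ PDN PA)
    (param_derive3_cross a b eps _ _ _ _ PN PB)) as PQ'.
  pose proof (param_derive_dot3 a b eps _ _ _ _ PQ PQ) as Pn.
  (* At parameter 0 the squared length of [N2 x A] is that of [N1], namely 1; [d] is a radius on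
     which it stays positive. *)
  destruct (jointly_continuous_pos a b eps _ heps (proj1 Pn)) as [d [hd [hde npos]]].
  { intros x hx. cbv beta. rewrite (proj1 (H0 x hx)), (cross_N2_T x hx). now apply N1_unit. }
  assert (qpos : forall t x, Rabs t < d -> Icc a b x -> 0 < dot3 (A t x) (A t x)).
  { intros t x ht hx. rewrite <- (proj1 (HD t x ltac:(lra) hx)). apply curve_dot_pos; [|exact hx].
    apply hcurve. lra. }
  pose proof (param_derive_dot3 a b eps _ _ _ _ PA PA) as Pq.
  pose proof (param_derive_dot3 a b eps _ _ _ _ PQ' (param_derive3_cross a b eps _ _ _ _ PA PQ)) as Px.
  apply (param_derive_weaken a b eps d _ _ hde) in Pn.
  apply (param_derive_weaken a b eps d _ _ hde) in Pq.
  apply (param_derive_weaken a b eps d _ _ hde) in Px.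
  pose proof (param_derive_mult a b d _ _ _ _
    (param_derive_mult a b d _ _ _ _ Px
      (param_derive_inv a b hab d _ _
        (fun t x ht hx => Rgt_not_eq _ _ (sqrt_lt_R0 _ (qpos t x ht hx)))
        (param_derive_sqrt a b hab d _ _ qpos Pq)))
    (param_derive_inv a b hab d _ _ (fun t x ht hx => Rgt_not_eq _ _ (npos t x ht hx)) Pn)) as P.
  pose proof (is_derive_RInt_smooth_param a b hab d _ _ hd P) as D. clear P Px Pq Pn.
  match type of D with is_derive (fun t => RInt (@?f t) a b) _ (RInt ?df a b) =>
    set (e := f) in D; set (de := df) in D end.
  exists d, (fun t => RInt (e t) a b). split; [exact hd|]. split.
  - replace (RInt (fun x => k2 x * dot3 (w x) (N1 x) - k1 x * dot3 (w x) (N2 x)) a b)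
      with (RInt de a b); [exact D|].
    apply RInt_ext. intros x. rewrite Rmin_left, Rmax_right by lra. intros hx.
    assert (ix : Icc a b x) by (unfold Icc; lra).
    destruct (H0 x ix) as [E1 [E2 [E3 E4]]]. unfold de. rewrite E1, E2, E3, E4.
    rewrite (cross_N2_T x ix), <- (N2_eq x ix), (derive_N2 x ix), (derive_T x ix).
    (* At parameter 0 the derivative of [N2 x T] along the curve is [N1' = k1 T]. It is orthogonal
       to [T x N1 = N2], so the numerator of the rotation density is zero there and the variations
       of the two normalizing factors do not contribute. *)
    assert (EQ : plus (cross (scal (k2 x) (T x)) (T x))
        (cross (N2 x) (opp (plus (scal (k1 x) (N1 x)) (scal (k2 x) (N2 x))))) = scal (k1 x) (T x)).
    { transitivity (scal (k1 x) (cross (N1 x) (N2 x))); [apply pair3_eq; vector_ring|].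
      f_equal. rewrite (N2_eq x ix).
      transitivity (minus (scal (dot3 (N1 x) (N1 x)) (T x)) (scal (dot3 (N1 x) (T x)) (N1 x)));
        [apply pair3_eq; vector_ring|].
      rewrite N1_unit, N1_T by exact ix. apply pair3_eq; vector_ring. }
    rewrite EQ, (T_unit x ix), (N1_unit x ix), sqrt_1, Rinv_1, !dot3_scal_l,
      (dot3_comm (T x) (N2 x)), (N2_T x ix).
    eq_in_R.
    match goal with |- (?X * _ + _) * _ + _ = _ =>
      transitivity X; [rewrite !Rmult_0_r, !Rmult_0_l; ring|] end.
    (* The derivative of [w] enters only through its product with [N2], which is orthogonal to [N2],
       so the result is of order zero in [w]. *)
    transitivity (k2 x * dot3 (w x) (cross (N2 x) (T x)) + k1 x * dot3 (w x) (cross (N1 x) (T x))).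
    + vector_ring.
    + rewrite (cross_N2_T x ix).
      replace (cross (N1 x) (T x)) with (opp (N2 x))
        by (rewrite (N2_eq x ix); apply pair3_eq; vector_ring).
      rewrite dot3_opp_r. ring.
  - intros Wa Wb alpha beta t theta ht hWa hWb.
    assert (ht' : Rabs t < eps) by lra.
    assert (it : Icc (- eps) eps t) by (apply Rabs_def2 in ht'; unfold Icc; lra).
    pose proof (hcurve t ht') as hc.
    assert (hpos : forall x, Icc a b x ->
      0 < dot3 (normal_cross a b (G t) N2 x) (normal_cross a b (G t) N2 x)).
    { intros x hx. unfold normal_cross. rewrite (proj1 (HD t x ht' hx)). now apply npos. }
    destruct (projected_frame_end t a it (or_introl eq_refl)) as [ea1 ea2].
    destruct (projected_frame_end t b it (or_intror eq_refl)) as [eb1 eb2].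
    rewrite <- ea1, <- ea2 in hWa. rewrite <- eb1, <- eb2 in hWb.
    rewrite (is_holonomy_iff a b (G t) hab hc _ _
      (smooth_on_projected_normal a b (G t) N2 hab hc smooth_on_N2 hpos)
      (smooth_on_projected_binormal a b (G t) N2 hab hc smooth_on_N2 hpos)
      (projected_normal_unit a b (G t) N2 hpos)
      (projected_normal_tangent a b (G t) N2)
      (fun x _ => eq_refl) Wa Wb alpha beta theta hWa hWb).
    replace (RInt (fun x => dot3 (Derive_on a b (projected_normal a b (G t) N2) x)
      (projected_binormal a b (G t) N2 x)) a b) with (RInt (e t) a b); [reflexivity|].
    apply RInt_ext. intros x. rewrite Rmin_left, Rmax_right by lra. intros hx.
    assert (ix : Icc a b x) by (unfold Icc; lra).
    rewrite (projected_frame_rotation a b (G t) N2 hab hc smooth_on_N2 hpos x ix).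
    unfold normal_cross. destruct (HD t x ht' ix) as [-> ->]. reflexivity.
Qed.

(** A given lift [theta] is compared with the explicit lift [alpha - I t - beta] through the sine of
    their difference. It vanishes identically near 0, and its derivative at 0 is [l + L] because the
    cosine is 1 there. Hence all differentiable lifts have the same derivative, and the explicit one
    attains it. *)
Lemma holonomy_variation_iff (Wa Wb : R * R * R) (l : R) :
  unit_normal a b gamma a Wa -> unit_normal a b gamma b Wb ->
  is_holonomy_variation a b Wa Wb G l <->
  l = - RInt (fun x => k2 x * dot3 (w x) (N1 x) - k1 x * dot3 (w x) (N2 x)) a b.
Proof.
  intros [ua na] [ub nb].
  assert (ia : Icc a b a) by (unfold Icc; lra).
  assert (ib : Icc a b b) by (unfold Icc; lra).
  rewrite tangent_arc_length in na by exact ia. rewrite tangent_arc_length in nb by exact ib.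
  destruct (frame_unit_angle _ _ _ (T_unit a ia) (N1_unit a ia) (N1_T a ia) (N2_eq a ia) Wa
    (norm3_eq_1 _ ua) na) as [alpha hWa].
  destruct (frame_unit_angle _ _ _ (T_unit b ib) (N1_unit b ib) (N1_T b ib) (N2_eq b ib) Wb
    (norm3_eq_1 _ ub) nb) as [beta hWb].
  destruct holonomy_angle as [d [I [hd [dI hI]]]].
  set (L := RInt _ a b) in *.
  assert (h0 : Rabs 0 < d) by (rewrite Rabs_R0; exact hd).
  split.
  - intros [theta [hth dth]].
    assert (hloc : locally 0 (fun t => cos (theta t + beta) = cos (alpha - I t) /\
      sin (theta t + beta) = sin (alpha - I t))).
    { generalize (filter_and _ _ (locally_Rabs_lt d 0 h0) hth). apply filter_imp.
      intros t [ht hol]. now apply (hI Wa Wb). }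
    assert (dphi : is_derive (fun t => theta t + beta - (alpha - I t)) 0 (l + L)).
    { replace (l + L) with (plus (plus l 0) (opp (plus 0 (opp L))))
        by (unfold plus, opp; simpl; ring).
      apply (is_derive_minus (V := R_NormedModule) (fun t => theta t + beta) (fun t => alpha - I t)).
      - apply (is_derive_plus (V := R_NormedModule) theta (fun _ => beta)); [exact dth|].
        apply (is_derive_const (V := R_NormedModule)).
      - apply (is_derive_minus (V := R_NormedModule) (fun _ => alpha) I); [|exact dI].
        apply (is_derive_const (V := R_NormedModule)). }
    pose proof (is_derive_comp (V := R_NormedModule) sin _ 0 _ _ (is_derive_sin _) dphi) as ds.
    assert (z : is_derive (fun t => sin (theta t + beta - (alpha - I t))) 0 0).
    { apply (is_derive_ext_loc (fun _ => 0)); [|apply (is_derive_const (V := R_NormedModule))].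
      revert hloc. apply filter_imp. intros t [hc hs].
      eq_in_R.
      rewrite sin_minus, hc, hs. ring. }
    assert (e1 : 0 = (l + L) * cos (theta 0 + beta - (alpha - I 0)))
      by exact (eq_trans (eq_sym (is_derive_unique _ _ _ z)) (is_derive_unique _ _ _ ds)).
    destruct (locally_singleton _ _ hloc) as [hc hs].
    rewrite cos_minus, hc, hs in e1.
    pose proof (sin2_cos2 (alpha - I 0)) as p. unfold Rsqr in p.
    replace (cos (alpha - I 0) * cos (alpha - I 0) + sin (alpha - I 0) * sin (alpha - I 0)) with 1
      in e1 by lra. lra.
  - intros hl. exists (fun t => alpha - I t - beta). split.
    + generalize (locally_Rabs_lt d 0 h0). apply filter_imp. intros t ht.
      apply (hI Wa Wb alpha beta t _ ht hWa hWb).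
      replace (alpha - I t - beta + beta) with (alpha - I t) by ring. auto.
    + rewrite hl. replace (- L) with (minus (minus 0 L) 0)
        by (unfold minus, plus, opp; simpl; ring).
      apply (is_derive_minus (V := R_NormedModule) (fun t => alpha - I t) (fun _ => beta));
        [|apply (is_derive_const (V := R_NormedModule))].
      apply (is_derive_minus (V := R_NormedModule) (fun _ => alpha) I); [|exact dI].
      apply (is_derive_const (V := R_NormedModule)).
Qed.

End Variation.

(** * Euler-Lagrange equations *)

Section EulerLagrange.
Variable rho : R -> R.
Hypothesis srho : smooth_on a b rho.

Local Notation r1 := (fun x => rho x * fst (kappa x)).
Local Notation r2 := (fun x => rho x * snd (kappa x)).

Lemma smooth_on_r1 : smooth_on a b r1.
Proof. apply smooth_on_mult; [exact srho|exact smooth_on_k1]. Qed.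

Lemma smooth_on_r2 : smooth_on a b r2.
Proof. apply smooth_on_mult; [exact srho|exact smooth_on_k2]. Qed.

Lemma Derive_on_pair (f g : R -> R) (h : R -> R * R) (x : R) :
  smooth_on a b f -> smooth_on a b g -> Icc a b x ->
  (forall y, Icc a b y -> h y = (f y, g y)) ->
  Derive_on a b h x = (Derive_on a b f x, Derive_on a b g x).
Proof.
  intros sf sg hx e. apply Derive_on_eq; [exact hab|exact hx|].
  apply (is_derive_on_ext a b (fun y => (f y, g y))); [exact hx| |].
  - intros y hy. symmetry. now apply e.
  - apply is_derive_on_pair; [exact hx| |]; now apply smooth_on_is_derive.
Qed.

Lemma derive_kappa (x : R) : Icc a b x ->
  Derive_on a b kappa x = (Derive_on a b k1 x, Derive_on a b k2 x).
Proof.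
  intros hx. apply Derive_on_pair; [exact smooth_on_k1|exact smooth_on_k2|exact hx|].
  intros y _. now destruct (kappa y).
Qed.

Lemma derive_rho_kappa (x : R) : Icc a b x ->
  Derive_on a b (fun y => scal (rho y) (kappa y)) x = (Derive_on a b r1 x, Derive_on a b r2 x).
Proof.
  intros hx. apply Derive_on_pair; [exact smooth_on_r1|exact smooth_on_r2|exact hx|].
  intros y _. reflexivity.
Qed.

Lemma derive2_rho_kappa (x : R) : Icc a b x ->
  Derive_on a b (Derive_on a b (fun y => scal (rho y) (kappa y))) x =
  (Derive_on a b (Derive_on a b r1) x, Derive_on a b (Derive_on a b r2) x).
Proof.
  intros hx. apply Derive_on_pair; [| |exact hx|exact derive_rho_kappa].
  - apply smooth_on_Derive; [exact hab|exact smooth_on_r1].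
  - apply smooth_on_Derive; [exact hab|exact smooth_on_r2].
Qed.

Lemma derive_mult_on (f g : R -> R) (x : R) :
  smooth_on a b f -> smooth_on a b g -> Icc a b x ->
  Derive_on a b (fun y => f y * g y) x =
  Derive_on a b f x * g x + f x * Derive_on a b g x :> R.
Proof.
  intros sf sg hx. apply Derive_on_eq; [exact hab|exact hx|].
  apply is_derive_on_mult; [exact hx| |]; now apply smooth_on_is_derive.
Qed.

(** The vector equation of the system integrated once, with the two multipliers as constants of
    integration. *)
Definition first_integral (c : R * R * R) (mu : R) : Prop :=
  forall x, Icc a b x ->
    Derive_on a b r1 x = dot3 (N1 x) c + mu * snd (kappa x) /\
    Derive_on a b r2 x = dot3 (N2 x) c - mu * fst (kappa x).

Definition euler_lagrange (Lambda : R -> R) (mu : R) (x : R) : Prop :=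
  zero =
    minus
      (plus
        (plus
          (Derive_on a b (Derive_on a b (fun y : R => scal (rho y) (kappa y))) x)
          (scal (1 / 2 * rho x * dot2 (kappa x) (kappa x)) (kappa x)))
        (scal mu (J (Derive_on a b kappa x))))
      (scal (Lambda x) (kappa x))
  /\
  0 = Derive_on a b Lambda x
      + 1 / 2 * Derive_on a b rho x * dot2 (kappa x) (kappa x).

Lemma euler_lagrange_components (Lambda : R -> R) (mu x : R) : Icc a b x ->
  euler_lagrange Lambda mu x <->
  0 = Derive_on a b (Derive_on a b r1) x + 1 / 2 * rho x * dot2 (kappa x) (kappa x) * k1 x
      - mu * Derive_on a b k2 x - Lambda x * k1 x /\
  0 = Derive_on a b (Derive_on a b r2) x + 1 / 2 * rho x * dot2 (kappa x) (kappa x) * k2 x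
      + mu * Derive_on a b k1 x - Lambda x * k2 x /\
  0 = Derive_on a b Lambda x + 1 / 2 * Derive_on a b rho x * dot2 (kappa x) (kappa x).
Proof.
  intros hx. unfold euler_lagrange. rewrite (derive2_rho_kappa x hx), (derive_kappa x hx).
  generalize (Derive_on a b (Derive_on a b r1) x) (Derive_on a b (Derive_on a b r2) x)
    (Derive_on a b k1 x) (Derive_on a b k2 x) (1 / 2 * rho x * dot2 (kappa x) (kappa x)).
  intros p q k l m.
  match goal with |- (zero = ?X /\ _) <-> _ => assert (e : X =
    (p + m * k1 x - mu * l - Lambda x * k1 x, q + m * k2 x + mu * k - Lambda x * k2 x)) end.
  { apply injective_projections; unfold_vectors; ring. }
  rewrite e. split.
  - intros [h1 h2]. split; [exact (f_equal fst h1)|]. split; [exact (f_equal snd h1)|exact h2].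
  - intros [h1 [h2 h3]]. split; [|exact h3]. apply injective_projections; assumption.
Qed.

Definition curvature_energy (x : R) : R := 1 / 2 * rho x * (k1 x * k1 x + k2 x * k2 x).

Lemma smooth_on_curvature_energy : smooth_on a b curvature_energy.
Proof.
  apply smooth_on_mult.
  - apply smooth_on_mult; [exact (smooth_on_const (V := R_NormedModule) a b (1 / 2))|exact srho].
  - apply smooth_on_plus; apply smooth_on_mult; exact smooth_on_k1 || exact smooth_on_k2.
Qed.

Lemma is_derive_on_curvature_energy (x : R) : Icc a b x ->
  is_derive_on a b curvature_energy x
    (1 / 2 * Derive_on a b rho x * (k1 x * k1 x + k2 x * k2 x)
     + rho x * (k1 x * Derive_on a b k1 x + k2 x * Derive_on a b k2 x)).
Proof.
  intros hx. eapply is_derive_on_eq_R.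
  - apply is_derive_on_mult; [exact hx| |].
    + apply is_derive_on_mult; [exact hx|exact (is_derive_on_const (V := R_NormedModule) a b (1 / 2) x hx)|].
      now apply smooth_on_is_derive.
    + apply is_derive_on_plus_R; [exact hx| |]; apply is_derive_on_mult; try exact hx;
        apply smooth_on_is_derive; exact hx || exact smooth_on_k1 || exact smooth_on_k2.
  - unfold zero; simpl. field.
Qed.

Lemma derive_dot3_const (Z : R -> R * R * R) (c : R * R * R) (x : R) :
  smooth_on a b Z -> Icc a b x ->
  is_derive_on a b (fun y => dot3 (Z y) c) x (dot3 (Derive_on a b Z x) c).
Proof.
  intros sZ hx. eapply is_derive_on_eq_R.
  - apply (is_derive_on_dot3 a b Z (fun _ => c) x (Derive_on a b Z x) zero hx).
    + now apply smooth_on_is_derive.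
    + exact (is_derive_on_const a b c x hx).
  - vector_ring.
Qed.

(** In the derivative of [<T, c>] the terms with [mu] cancel, since [kappa] and [J kappa] are
    orthogonal. The remainder combines with the derivative of [curvature_energy] to the term with
    [rho'] alone. *)
Lemma euler_lagrange_of_first_integral (c : R * R * R) (mu : R) :
  first_integral c mu ->
  exists Lambda, smooth_on a b Lambda /\ forall x, Icc a b x -> euler_lagrange Lambda mu x.
Proof.
  intros H. exists (fun x => dot3 (T x) c + curvature_energy x).
  pose proof smooth_on_T as sT. pose proof smooth_on_k1 as s1. pose proof smooth_on_k2 as s2.
  split.
  { apply smooth_on_plus; [|exact smooth_on_curvature_energy].
    apply smooth_on_dot3; [exact sT|exact (smooth_on_const a b c)]. }
  intros x hx. apply euler_lagrange_components; [exact hx|].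
  assert (E1 : Derive_on a b (Derive_on a b r1) x = k1 x * dot3 (T x) c + mu * Derive_on a b k2 x).
  { apply Derive_on_eq; [exact hab|exact hx|].
    apply (is_derive_on_ext a b (fun y => dot3 (N1 y) c + mu * k2 y)); [exact hx| |].
    - intros y hy. symmetry. now apply H.
    - eapply is_derive_on_eq_R.
      + apply is_derive_on_plus_R; [exact hx|apply derive_dot3_const; [exact smooth_on_N1|exact hx]|].
        apply is_derive_on_mult; [exact hx|exact (is_derive_on_const (V := R_NormedModule) a b mu x hx)|].
        now apply smooth_on_is_derive.
      + rewrite (derive_N1 x hx), dot3_scal_l. unfold zero; simpl. ring. }
  assert (E2 : Derive_on a b (Derive_on a b r2) x = k2 x * dot3 (T x) c - mu * Derive_on a b k1 x).
  { apply Derive_on_eq; [exact hab|exact hx|].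
    apply (is_derive_on_ext a b (fun y => dot3 (N2 y) c + - mu * k1 y)); [exact hx| |].
    - intros y hy. rewrite (proj2 (H y hy)). simpl. ring.
    - eapply is_derive_on_eq_R.
      + apply is_derive_on_plus_R; [exact hx|apply derive_dot3_const; [exact smooth_on_N2|exact hx]|].
        apply is_derive_on_mult; [exact hx|exact (is_derive_on_const (V := R_NormedModule) a b (- mu) x hx)|].
        now apply smooth_on_is_derive.
      + rewrite (derive_N2 x hx), dot3_scal_l. unfold zero; simpl. ring. }
  assert (E3 : Derive_on a b (fun x => dot3 (T x) c + curvature_energy x) x =
    dot3 (Derive_on a b T x) c + (1 / 2 * Derive_on a b rho x * (k1 x * k1 x + k2 x * k2 x)
     + rho x * (k1 x * Derive_on a b k1 x + k2 x * Derive_on a b k2 x))).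
  { apply Derive_on_eq; [exact hab|exact hx|].
    apply is_derive_on_plus_R; [exact hx|now apply derive_dot3_const|].
    now apply is_derive_on_curvature_energy. }
  rewrite E1, E2, E3, (derive_T x hx), dot3_opp_l, dot3_plus_l, !dot3_scal_l.
  destruct (H x hx) as [H1 H2].
  rewrite (derive_mult_on rho k1 x srho s1 hx) in H1. rewrite (derive_mult_on rho k2 x srho s2 hx) in H2.
  unfold curvature_energy, dot2. cbv beta in *.
  split; [ring|]. split; [ring|].
  replace (dot3 (N1 x) c) with (Derive_on a b rho x * fst (kappa x) + rho x * Derive_on a b k1 x
    - mu * snd (kappa x)) by lra.
  replace (dot3 (N2 x) c) with (Derive_on a b rho x * snd (kappa x) + rho x * Derive_on a b k2 x
    + mu * fst (kappa x)) by lra.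
  field.
Qed.

Lemma first_integral_of_euler_lagrange (Lambda : R -> R) (mu : R) :
  smooth_on a b Lambda -> (forall x, Icc a b x -> euler_lagrange Lambda mu x) ->
  exists c, first_integral c mu.
Proof.
  intros sL H.
  pose proof smooth_on_T as sT. pose proof smooth_on_k1 as s1. pose proof smooth_on_k2 as s2.
  pose proof smooth_on_N1 as sN1. pose proof smooth_on_N2 as sN2.
  assert (sP1 : smooth_on a b (Derive_on a b r1)) by (apply smooth_on_Derive; [exact hab|exact smooth_on_r1]).
  assert (sP2 : smooth_on a b (Derive_on a b r2)) by (apply smooth_on_Derive; [exact hab|exact smooth_on_r2]).
  (* These are the frame coordinates that [c] must have: the normal ones are read off from
     [first_integral], the tangential one from the formula for [Lambda]. *)
  set (c1 := fun x => Derive_on a b r1 x + - mu * k2 x).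
  set (c2 := fun x => Derive_on a b r2 x + mu * k1 x).
  set (c0 := fun x => Lambda x + - curvature_energy x).
  set (V := fun x => plus (plus (scal (c1 x) (N1 x)) (scal (c2 x) (N2 x))) (scal (c0 x) (T x))).
  assert (D : forall x, Icc a b x -> is_derive_on a b V x zero).
  { intros x hx.
    assert (d1 : is_derive_on a b c1 x (Derive_on a b (Derive_on a b r1) x - mu * Derive_on a b k2 x)).
    { eapply is_derive_on_eq_R.
      - apply is_derive_on_plus_R; [exact hx|now apply smooth_on_is_derive|].
        apply is_derive_on_mult; [exact hx|exact (is_derive_on_const (V := R_NormedModule) a b (- mu) x hx)|].
        now apply smooth_on_is_derive.
      - unfold zero; simpl. ring. }
    assert (d2 : is_derive_on a b c2 x (Derive_on a b (Derive_on a b r2) x + mu * Derive_on a b k1 x)).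
    { eapply is_derive_on_eq_R.
      - apply is_derive_on_plus_R; [exact hx|now apply smooth_on_is_derive|].
        apply is_derive_on_mult; [exact hx|exact (is_derive_on_const (V := R_NormedModule) a b mu x hx)|].
        now apply smooth_on_is_derive.
      - unfold zero; simpl. ring. }
    pose proof (is_derive_on_plus_R a b _ _ x _ _ hx (smooth_on_is_derive a b Lambda x sL hx)
      (is_derive_on_opp_R a b _ x _ hx (is_derive_on_curvature_energy x hx))) as d0.
    pose proof (is_derive_on_plus a b _ _ x _ _ hx
      (is_derive_on_plus a b _ _ x _ _ hx
        (is_derive_on_scal a b _ _ x _ _ hx d1 (smooth_on_is_derive a b N1 x sN1 hx))
        (is_derive_on_scal a b _ _ x _ _ hx d2 (smooth_on_is_derive a b N2 x sN2 hx)))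
      (is_derive_on_scal a b _ _ x _ _ hx d0 (smooth_on_is_derive a b _ x sT hx))) as DV.
    rewrite (derive_N1 x hx), (derive_N2 x hx), (derive_T x hx) in DV.
    destruct (proj1 (euler_lagrange_components Lambda mu x hx) (H x hx)) as [e1 [e2 e0]].
    match type of DV with is_derive_on _ _ _ _ ?l =>
      assert (e : l = zero); [|exact (eq_rect l (is_derive_on a b V x) DV zero e)] end.
    (* Sorted by the frame, the derivative of [V] has normal coefficients that vanish by the vector
       equation and a tangential one that vanishes by the scalar equation. *)
    transitivity (plus (plus
      (scal (Derive_on a b (Derive_on a b r1) x - mu * Derive_on a b k2 x - c0 x * k1 x) (N1 x))
      (scal (Derive_on a b (Derive_on a b r2) x + mu * Derive_on a b k1 x - c0 x * k2 x) (N2 x)))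
      (scal (c1 x * k1 x + c2 x * k2 x + (Derive_on a b Lambda x
        - (1 / 2 * Derive_on a b rho x * (k1 x * k1 x + k2 x * k2 x)
           + rho x * (k1 x * Derive_on a b k1 x + k2 x * Derive_on a b k2 x)))) (T x))).
    { fold (c1 x) (c2 x) (c0 x). apply pair3_eq; vector_ring. }
    unfold dot2 in e1, e2, e0.
    replace (Derive_on a b (Derive_on a b r1) x - mu * Derive_on a b k2 x - c0 x * k1 x) with 0
      by (rewrite e1; unfold c0, curvature_energy; ring).
    replace (Derive_on a b (Derive_on a b r2) x + mu * Derive_on a b k1 x - c0 x * k2 x) with 0
      by (rewrite e2; unfold c0, curvature_energy; ring).
    match goal with |- plus _ (scal ?k _) = _ => replace k with 0 end.
    - apply pair3_eq; vector_ring.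
    - unfold c1, c2.
      rewrite (derive_mult_on rho k1 x srho s1 hx), (derive_mult_on rho k2 x srho s2 hx).
      replace (Derive_on a b Lambda x) with
        (- (1 / 2 * Derive_on a b rho x * (fst (kappa x) * fst (kappa x) + snd (kappa x) * snd (kappa x))))
        by lra.
      field. }
  exists (V a). intros x hx.
  assert (ia : Icc a b a) by (unfold Icc; lra).
  assert (E : V x = V a).
  { assert (C : forall y, Icc a b y -> _) by
      (intros y hy; exact (proj1 (is_derive_on_components a b V y zero hy) (D y hy))).
    apply pair3_eq.
    - apply (is_derive_on_zero_const a b hab (fun y => fst (fst (V y)))); auto. intros y hy. apply (C y hy).
    - apply (is_derive_on_zero_const a b hab (fun y => snd (fst (V y)))); auto. intros y hy. apply (C y hy).
    - apply (is_derive_on_zero_const a b hab (fun y => snd (V y))); auto. intros y hy. apply (C y hy). }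
  rewrite <- E. unfold V. rewrite !dot3_plus_r, !dot3_scal_r.
  rewrite (N1_unit x hx), (N2_unit x hx), (N1_T x hx), (N2_T x hx), (dot3_comm (N2 x) (N1 x)),
    (frame_dot_M1_M2 _ _ _ (N2_eq x hx)).
  unfold c1, c2. split; apply Rminus_diag_uniq; ring.
Qed.

End EulerLagrange.

(** * Admissible fields *)

Section TestFields.
Variable v : R -> R * R * R.
Hypotheses (sv : smooth_on a b v) (cv : compactly_supported a b v).
Hypothesis hv : forall x, Icc a b x -> dot3 (Derive_on a b v x) (T x) = 0.

Local Notation w := (Derive_on a b v).

Lemma smooth_on_w : smooth_on a b w.
Proof. now apply smooth_on_Derive. Qed.

Lemma test_field_end (x : R) : x = a \/ x = b -> v x = zero /\ w x = zero.
Proof.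
  intros hx. destruct cv as [c [d [hc [hcd [hd hsupp]]]]].
  assert (ix : Icc a b x) by (unfold Icc; lra).
  split; [apply hsupp; [exact ix|lra]|].
  apply Derive_on_eq; [exact hab|exact ix|].
  apply (is_derive_on_ext_loc a b (fun _ => zero)); [exact ix| |exact (is_derive_on_const a b zero x ix)].
  assert (hp : 0 < Rmin (c - a) (b - d)) by (apply Rmin_glb_lt; lra).
  exists (mkposreal _ hp). intros y hy iy. symmetry. apply hsupp; [exact iy|].
  change (Rabs (y - x) < Rmin (c - a) (b - d)) in hy.
  pose proof (Rmin_l (c - a) (b - d)). pose proof (Rmin_r (c - a) (b - d)).
  apply Rabs_def2 in hy. lra.
Qed.

(** The curves stay regular because [<T, w> = 0] makes the squared speed 1 + t^2 [<w, w>], which is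
    at least 1 for every [t]; the parameter range 1 is arbitrary. *)
Lemma linear_variation : is_variation a b gamma v 1 (fun t x => plus (gamma x) (scal t (v x))).
Proof.
  set (V3 := prod_NormedModule R_AbsRing
    (prod_NormedModule R_AbsRing R_NormedModule R_NormedModule) R_NormedModule).
  destruct (proj1 hgamma) as [g [g0 Hg]]. destruct sv as [u [u0 Hu]].
  split; [lra|]. split; [|split; [|split; [|split]]].
  - exists (fun i j t x => match i with
      | O => plus (g j x) (scal t (u j x)) | S O => u j x | _ => zero end).
    split; [intros t x _ hx; now rewrite g0, u0|].
    assert (Ds : forall (f : nat -> R -> R * R * R) j t x, Icc a b x ->
      (forall n x, Icc a b x -> is_derive_on a b (f n) x (f (S n) x)) ->
      filterlim (fun p : R * R => f j (snd p))
        (within (fun p : R * R => Icc (- (1)) 1 (fst p) /\ Icc a b (snd p)) (locally (t, x)))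
        (locally (f j x))).
    { intros f j t x hx Hf P HP.
      pose proof (is_derive_on_continuous a b (f j) x _ hx (Hf j x hx) P HP) as C.
      unfold filtermap, within in *.
      assert (C2 : locally (t, x) (fun p : R * R => Icc a b (snd p) -> P (f j (snd p))))
        by exact (continuous_snd t x _ C).
      revert C2. apply filter_imp. intros [s y] K [_ iy]. now apply K. }
    intros i j t x ht hx. destruct i as [|[|i]].
    + split; [|split].
      * apply is_derive_on_of_is_derive; [exact ht|].
        apply (is_derive_affine (g j x) (u j x)).
      * pose proof (is_derive_on_plus a b _ _ x _ _ hx (Hg j x hx)
          (is_derive_on_scal a b (fun _ => t) (u j) x 0 (u (S j) x) hx
            (is_derive_on_const (V := R_NormedModule) a b t x hx) (Hu j x hx))) as D.
        apply (is_derive_on_eq a b _ x _ _ D).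
        apply pair3_eq; vector_ring.
      * eapply filterlim_comp_2; [apply (Ds g j t x hx Hg)| |].
        -- eapply (filterlim_comp_2 (fun p : R * R => fst p) (fun p : R * R => u j (snd p)) scal).
           ++ intros P HP.
              assert (C : locally (t, x) (fun p : R * R => P (fst p)))
                by exact (continuous_fst t x P HP).
              unfold filtermap, within. revert C. apply filter_imp. auto.
           ++ apply (Ds u j t x hx Hu).
           ++ exact (filterlim_scal (K := R_AbsRing) (V := V3) t (u j x)).
        -- exact (filterlim_plus (K := R_AbsRing) (V := V3) (g j x) (scal t (u j x))).
    + split; [|split].
      * exact (is_derive_on_const (- (1)) 1 (u j x) t ht).
      * now apply Hu.
      * now apply (Ds u j t x hx Hu).
    + split; [|split].
      * exact (is_derive_on_const (- (1)) 1 zero t ht).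
      * exact (is_derive_on_const a b zero x hx).
      * apply filterlim_const.
  - intros t _. split.
    + apply smooth_on_plus3; [apply hgamma|]. apply smooth_on_scal; [|exact sv].
      exact (smooth_on_const (V := R_NormedModule) a b t).
    + intros x hx e.
      assert (D : Derive_on a b (fun x => plus (gamma x) (scal t (v x))) x = plus (T x) (scal t (w x))).
      { apply Derive_on_eq; [exact hab|exact hx|].
        pose proof (is_derive_on_plus a b _ _ x _ _ hx
          (smooth_on_is_derive a b gamma x (proj1 hgamma) hx)
          (is_derive_on_scal a b (fun _ => t) v x 0 (w x) hx
            (is_derive_on_const (V := R_NormedModule) a b t x hx)
            (smooth_on_is_derive a b v x sv hx))) as D.
        apply (is_derive_on_eq a b _ x _ _ D).
        apply pair3_eq; vector_ring. }
      rewrite D in e.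
      assert (h : dot3 (plus (T x) (scal t (w x))) (plus (T x) (scal t (w x))) = 0)
        by (rewrite e; vector_ring).
      rewrite !dot3_plus_l, !dot3_plus_r, !dot3_scal_l, !dot3_scal_r, (T_unit x hx),
        (dot3_comm (T x) (w x)), (hv x hx) in h.
      pose proof (dot3_self_ge_0 (w x)). nra.
  - intros x _. apply pair3_eq; vector_ring.
  - destruct cv as [c [d [hc [hcd [hd hsupp]]]]]. exists c, d.
    split; [exact hc|]. split; [exact hcd|]. split; [exact hd|].
    intros t x _ hx h. rewrite (hsupp x hx h). apply pair3_eq; vector_ring.
  - intros x _. apply (is_derive_affine (gamma x) (v x)).
Qed.

(** Since [T' = - N kappa], the integrand is minus the sum of the terms [r_i <w', N_i>]. The
    derivatives of the [N_i] are tangential and [w] is normal, so [<w', N_i>] is the derivative of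
    [<w, N_i>]; the boundary terms vanish with [w]. *)
Lemma bending_by_parts (rho : R -> R) : smooth_on a b rho ->
  RInt (fun x => rho x * dot3 (Derive_on a b T x) (Derive_on a b w x)) a b =
  RInt (fun x => Derive_on a b (fun y => rho y * k1 y) x * dot3 (w x) (N1 x)
               + Derive_on a b (fun y => rho y * k2 y) x * dot3 (w x) (N2 x)) a b.
Proof.
  intros srho. pose proof smooth_on_w as sw.
  pose proof smooth_on_T as sT. pose proof smooth_on_N1 as s1. pose proof smooth_on_N2 as s2.
  pose proof (smooth_on_r1 rho srho) as sr1. pose proof (smooth_on_r2 rho srho) as sr2.
  set (r1 := fun y => rho y * k1 y) in *. set (r2 := fun y => rho y * k2 y) in *.
  set (f := fun x => rho x * dot3 (Derive_on a b T x) (Derive_on a b w x)).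
  set (h := fun x => r1 x * dot3 (w x) (N1 x) + r2 x * dot3 (w x) (N2 x)).
  set (k := fun x => Derive_on a b r1 x * dot3 (w x) (N1 x) + Derive_on a b r2 x * dot3 (w x) (N2 x)).
  assert (sf : smooth_on a b f).
  { apply smooth_on_mult; [exact srho|]. apply smooth_on_dot3; now apply smooth_on_Derive. }
  assert (sk : smooth_on a b k).
  { apply smooth_on_plus; apply smooth_on_mult;
      try (now apply smooth_on_Derive); now apply smooth_on_dot3. }
  assert (D : forall x, Icc a b x -> is_derive_on a b h x (k x + - f x)).
  { intros x hx. eapply is_derive_on_eq_R.
    - apply is_derive_on_plus_R; [exact hx| |]; apply is_derive_on_mult;
        [exact hx|now apply smooth_on_is_derive| |exact hx|now apply smooth_on_is_derive|];
        apply is_derive_on_dot3; try exact hx; now apply smooth_on_is_derive.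
    - unfold k, f. rewrite (derive_T x hx), (derive_N1 x hx), (derive_N2 x hx).
      rewrite !dot3_scal_r, (hv x hx), dot3_opp_l, dot3_plus_l, !dot3_scal_l.
      rewrite (dot3_comm (N1 x) (Derive_on a b w x)), (dot3_comm (N2 x) (Derive_on a b w x)).
      unfold r1 at 2, r2 at 2. apply Rminus_diag_uniq. ring. }
  assert (I : RInt (fun x => k x + - f x) a b = h b - h a).
  { apply RInt_derive_on; [exact hab|exact D|]. apply smooth_on_plus; [exact sk|].
    now apply smooth_on_opp. }
  assert (za : h a = 0).
  { unfold h. rewrite (proj2 (test_field_end a (or_introl eq_refl))), !dot3_zero_l. ring. }
  assert (zb : h b = 0).
  { unfold h. rewrite (proj2 (test_field_end b (or_intror eq_refl))), !dot3_zero_l. ring. }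
  pose proof (RInt_correct _ a b (ex_RInt_smooth a b hab f sf)) as If.
  pose proof (RInt_correct _ a b (ex_RInt_smooth a b hab k sk)) as Ik.
  pose proof (is_RInt_unique _ _ _ _ (is_RInt_minus _ _ a b _ _ Ik If)) as M.
  change (RInt (fun x => k x + - f x) a b = RInt k a b - RInt f a b) in M.
  rewrite I, za, zb in M. lra.
Qed.

End TestFields.

(** Pairing with it gives one coordinate of the integral of [p_1 N_1 + p_2 N_2]. *)
Local Notation component_pair c := ((fun x => c (N1 x)), (fun x => c (N2 x))).

(** [v] is the primitive of [p_1 N_1 + p_2 N_2], taken coordinatewise; the three vanishing integrals
    are what makes it vanish near both ends. *)
Lemma test_field_of_pair (p : (R -> R) * (R -> R)) : test_pair a b p ->
  pairing a b (component_pair (fun u => fst (fst u))) p = 0 ->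
  pairing a b (component_pair (fun u => snd (fst u))) p = 0 ->
  pairing a b (component_pair (fun u => snd u)) p = 0 ->
  exists v, smooth_on a b v /\ compactly_supported a b v /\
    forall x, Icc a b x ->
      Derive_on a b v x = plus (scal (fst p x) (N1 x)) (scal (snd p x) (N2 x)).
Proof.
  intros [s1 [s2 [c [d [hc [hcd [hd hp]]]]]]] z1 z2 z3.
  set (u := fun x => plus (scal (fst p x) (N1 x)) (scal (snd p x) (N2 x))).
  assert (su : smooth_on a b u).
  { apply smooth_on_plus3; apply smooth_on_scal; auto; [exact smooth_on_N1|exact smooth_on_N2]. }
  assert (hu : forall x, Icc a b x -> x < c \/ d < x -> u x = zero).
  { intros x hx h. unfold u. destruct (hp x hx h) as [-> ->]. apply pair3_eq; vector_ring. }
  apply smooth_on_components in su. destruct su as [su1 [su2 su3]].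
  destruct (smooth_on_compact_primitive a b c d _ hc hd hcd su1) as [F1 [sF1 [dF1 zF1]]];
    [intros x hx h; now rewrite (hu x hx h)|exact z1|].
  destruct (smooth_on_compact_primitive a b c d _ hc hd hcd su2) as [F2 [sF2 [dF2 zF2]]];
    [intros x hx h; now rewrite (hu x hx h)|exact z2|].
  destruct (smooth_on_compact_primitive a b c d _ hc hd hcd su3) as [F3 [sF3 [dF3 zF3]]];
    [intros x hx h; now rewrite (hu x hx h)|exact z3|].
  exists (fun x => (F1 x, F2 x, F3 x)). split; [|split].
  - now apply smooth_on_components.
  - exists c, d. split; [exact hc|]. split; [exact hcd|]. split; [exact hd|].
    intros x hx h. rewrite zF1, zF2, zF3 by assumption. reflexivity.
  - intros x hx. apply Derive_on_eq; [exact hab|exact hx|].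
    apply is_derive_on_components; [exact hx|].
    split; [exact (dF1 x hx)|]. split; [exact (dF2 x hx)|exact (dF3 x hx)].
Qed.

(** * Equivalence of elasticity with the first integral *)

Section Characterization.
Variables (rho : R -> R) (Wa Wb : R * R * R).
Hypothesis srho : smooth_on a b rho.
Hypotheses (hWa : unit_normal a b gamma a Wa) (hWb : unit_normal a b gamma b Wb).

Local Notation r1 := (fun y => rho y * fst (kappa y)).
Local Notation r2 := (fun y => rho y * snd (kappa y)).

Lemma first_integral_of_elastic :
  holonomy_constrained_elastic a b rho Wa Wb gamma -> exists c mu, first_integral rho c mu.
Proof.
  intros H.
  set (L := (Derive_on a b r1, Derive_on a b r2)).
  set (U1 := component_pair (fun u : R * R * R => fst (fst u))).
  set (U2 := component_pair (fun u : R * R * R => snd (fst u))).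
  set (U3 := component_pair (fun u : R * R * R => snd u)).
  (* [U4] is [- J kappa]; its pairing with [p] is minus the variation of the holonomy. *)
  set (U4 := (k2, fun x => - k1 x)).
  assert (sL : smooth_pair a b L).
  { split; apply smooth_on_Derive; try exact hab; [exact (smooth_on_r1 rho srho)|exact (smooth_on_r2 rho srho)]. }
  pose proof (proj1 (smooth_on_components a b N1) smooth_on_N1) as [n11 [n12 n13]].
  pose proof (proj1 (smooth_on_components a b N2) smooth_on_N2) as [n21 [n22 n23]].
  assert (sU1 : smooth_pair a b U1) by (split; assumption).
  assert (sU2 : smooth_pair a b U2) by (split; assumption).
  assert (sU3 : smooth_pair a b U3) by (split; assumption).
  assert (sU4 : smooth_pair a b U4).
  { split; [exact smooth_on_k2|apply smooth_on_opp; exact smooth_on_k1]. }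
  assert (lin : forall u, smooth_pair a b u -> forall k p q, test_pair a b p -> test_pair a b q ->
    pairing a b u (pair_comb k p q) = pairing a b u p + k * pairing a b u q).
  { intros u su k p q tp tq. apply pairing_comb; auto; now apply test_pair_smooth. }
  destruct (functional_span (test_pair a b) pair_comb
    (cons (pairing a b U1) (cons (pairing a b U2) (cons (pairing a b U3) (cons (pairing a b U4) nil))))
    (pairing a b L)) as [cs [hlen hcs]].
  - apply test_pair_comb.
  - intros M [<-|[<-|[<-|[<-|[]]]]]; now apply lin.
  - now apply lin.
  - intros p tp hM.
    destruct (test_field_of_pair p tp) as [v [sv [cv dv]]];
      [apply hM; simpl; auto|apply hM; simpl; auto|apply hM; simpl; auto|].
    assert (hv : forall x, Icc a b x -> dot3 (Derive_on a b v x) (T x) = 0).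
    { intros x hx. rewrite (dv x hx), dot3_plus_l, !dot3_scal_l, N1_T, N2_T by exact hx. ring. }
    assert (p1 : forall x, Icc a b x -> dot3 (Derive_on a b v x) (N1 x) = fst p x).
    { intros x hx. rewrite (dv x hx), dot3_plus_l, !dot3_scal_l, N1_unit, (dot3_comm (N2 x)),
        (frame_dot_M1_M2 _ _ _ (N2_eq x hx)) by exact hx. ring. }
    assert (p2 : forall x, Icc a b x -> dot3 (Derive_on a b v x) (N2 x) = snd p x).
    { intros x hx. rewrite (dv x hx), dot3_plus_l, !dot3_scal_l, N2_unit,
        (frame_dot_M1_M2 _ _ _ (N2_eq x hx)) by exact hx. ring. }
    pose proof (linear_variation v sv cv hv) as hG.
    assert (hol : is_holonomy_variation a b Wa Wb (fun t x => plus (gamma x) (scal t (v x))) 0).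
    { apply (holonomy_variation_iff v 1 _ hG); [exact hWa|exact hWb|].
      assert (z : pairing a b U4 p = 0) by (apply hM; simpl; auto).
      rewrite <- Ropp_0. f_equal. rewrite <- z. apply RInt_ext. intros x.
      rewrite Rmin_left, Rmax_right by lra. intros hx.
      rewrite p1, p2 by (unfold Icc; lra). simpl. eq_in_R. ring. }
    pose proof (H v sv cv hv 1 _ hG hol) as B.
    pose proof (is_bending_variation_formula v 1 _ sv hG hv rho srho) as B'.
    rewrite (bending_by_parts v sv cv hv rho srho) in B'.
    transitivity (RInt (fun x => Derive_on a b r1 x * dot3 (Derive_on a b v x) (N1 x)
               + Derive_on a b r2 x * dot3 (Derive_on a b v x) (N2 x)) a b).
    + apply RInt_ext. intros x. rewrite Rmin_left, Rmax_right by lra. intros hx.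
      rewrite p1, p2 by (unfold Icc; lra). simpl. apply Rminus_diag_uniq. ring.
    + exact (eq_trans (eq_sym (is_derive_unique _ _ _ B')) (is_derive_unique _ _ _ B)).
  - destruct cs as [|c1 [|c2 [|c3 [|mu [|? ?]]]]]; try discriminate hlen.
    exists (c1, c2, c3), mu.
    (* [hcs] expresses the pairing with [L] through the four constraint pairings. Hence [u], the
       corresponding difference of functions, pairs to zero with every test pair and vanishes
       pointwise. *)
    set (u := pair_comb (- mu) (pair_comb (- c3) (pair_comb (- c2) (pair_comb (- c1) L U1) U2) U3) U4).
    assert (s1 : smooth_pair a b (pair_comb (- c1) L U1)) by now apply smooth_pair_comb.
    assert (s2 : smooth_pair a b (pair_comb (- c2) (pair_comb (- c1) L U1) U2)) by now apply smooth_pair_comb.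
    assert (s3 : smooth_pair a b (pair_comb (- c3) (pair_comb (- c2) (pair_comb (- c1) L U1) U2) U3))
      by now apply smooth_pair_comb.
    assert (su : smooth_pair a b u) by now apply smooth_pair_comb.
    intros x hx.
    destruct (pairing_zero a b hab u su) with (x := x) as [e1 e2]; [|exact hx|].
    + intros p tp. pose proof (test_pair_smooth a b p tp) as sp. specialize (hcs p tp). simpl in hcs.
      unfold u. rewrite pairing_comm, !pairing_comb, !(pairing_comm a b p) by assumption. lra.
    + unfold u, L, U1, U2, U3, U4 in e1, e2. simpl in e1, e2. unfold dot3. simpl.
      cbv beta in *. split; lra.
Qed.

(** Substituting the first integral, the bending variation becomes the integral of [<w, c>], zero
    because [v] vanishes at both ends, plus [mu] times an integral that is zero by the holonomy
    constraint. *)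
Lemma elastic_of_first_integral (c : R * R * R) (mu : R) :
  first_integral rho c mu -> holonomy_constrained_elastic a b rho Wa Wb gamma.
Proof.
  intros HI v sv cv hv eps G hG hol.
  apply (holonomy_variation_iff v eps G hG Wa Wb 0 hWa hWb) in hol.
  pose proof (is_bending_variation_formula v eps G sv hG hv rho srho) as B.
  rewrite (bending_by_parts v sv cv hv rho srho) in B.
  set (w := Derive_on a b v) in *.
  pose proof (smooth_on_w v sv) as sw.
  set (f := fun x => dot3 (w x) c).
  set (h := fun x => k2 x * dot3 (w x) (N1 x) - k1 x * dot3 (w x) (N2 x)) in *.
  assert (sf : smooth_on a b f) by (apply smooth_on_dot3; [exact sw|exact (smooth_on_const a b c)]).
  assert (sh : smooth_on a b h).
  { apply smooth_on_minus; apply smooth_on_mult; try apply smooth_on_dot3;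
      exact smooth_on_k1 || exact smooth_on_k2 || exact sw || exact smooth_on_N1 || exact smooth_on_N2. }
  assert (If : RInt f a b = 0).
  { rewrite (RInt_derive_on a b hab (fun x => dot3 (v x) c) f).
    - rewrite (proj1 (test_field_end v cv a (or_introl eq_refl))),
        (proj1 (test_field_end v cv b (or_intror eq_refl))), !dot3_zero_l. eq_in_R. ring.
    - intros x hx. now apply derive_dot3_const.
    - exact sf. }
  pose proof (is_RInt_plus _ _ a b _ _ (RInt_correct _ a b (ex_RInt_smooth a b hab f sf))
    (is_RInt_scal _ a b mu _ (RInt_correct _ a b (ex_RInt_smooth a b hab h sh)))) as Q.
  apply is_RInt_unique in Q.
  match type of B with is_bending_variation _ _ _ _ ?l => replace l with 0 in B; [exact B|] end.
  assert (Z : plus (RInt f a b) (scal mu (RInt h a b)) = 0).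
  { rewrite If. replace (RInt h a b) with 0 by lra.
    unfold plus, scal; simpl. unfold mult; simpl. ring. }
  refine (eq_trans (eq_sym Z) (eq_trans (eq_sym Q) _)).
  apply RInt_ext. intros x. rewrite Rmin_left, Rmax_right by lra. intros hx.
  assert (ix : Icc a b x) by (unfold Icc; lra).
  destruct (HI x ix) as [-> ->]. unfold f, h.
  rewrite (frame_dot _ _ _ (T_unit x ix) (N1_unit x ix) (N1_T x ix) (N2_eq x ix) (w x) c).
  assert (hwT : dot3 (w x) (T x) = 0) by exact (hv x ix).
  rewrite hwT, (dot3_comm (N1 x) c), (dot3_comm (N2 x) c).
  unfold plus, scal; simpl. unfold mult; simpl. apply Rminus_diag_uniq. ring.
Qed.

End Characterization.
End FramedCurve.

Theorem theorem4p5 (a b : R) (gamma : R -> R * R * R) (rho : R -> R)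
    (Wa Wb : R * R * R) (N1 N2 : R -> R * R * R) (kappa : R -> R * R)
    (hab : a < b)
    (hgamma : is_curve a b gamma)
    (harc : arc_length_parametrized a b gamma)
    (hrho : smooth_on a b rho)
    (hrho_pos : forall x : R, Icc a b x -> 0 < rho x)
    (hWa : unit_normal a b gamma a Wa)
    (hWb : unit_normal a b gamma b Wb)
    (hN : parallel_frame a b gamma N1 N2)
    (hkappa : is_curvature_function a b gamma N1 N2 kappa) :
  holonomy_constrained_elastic a b rho Wa Wb gamma <->
  exists (Lambda : R -> R) (mu : R),
    smooth_on a b Lambda /\
    forall x : R, Icc a b x ->
      zero =
        minus
          (plus
            (plus
              (Derive_on a b (Derive_on a b (fun y : R => scal (rho y) (kappa y))) x)
              (scal (1 / 2 * rho x * dot2 (kappa x) (kappa x)) (kappa x)))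
            (scal mu (J (Derive_on a b kappa x))))
          (scal (Lambda x) (kappa x))
      /\
      0 = Derive_on a b Lambda x
          + 1 / 2 * Derive_on a b rho x * dot2 (kappa x) (kappa x).
Proof.
  split.
  - intros H.
    destruct (first_integral_of_elastic a b gamma N1 N2 kappa hab hgamma harc hN hkappa rho Wa Wb
      hrho hWa hWb H) as [c [mu HI]].
    destruct (euler_lagrange_of_first_integral a b gamma N1 N2 kappa hab hgamma harc hN hkappa rho
      hrho c mu HI) as [Lambda [sL HL]].
    now exists Lambda, mu.
  - intros [Lambda [mu [sL HL]]].
    destruct (first_integral_of_euler_lagrange a b gamma N1 N2 kappa hab hgamma harc hN hkappa rho
      hrho Lambda mu sL HL) as [c HI].
    exact (elastic_of_first_integral a b gamma N1 N2 kappa hab hgamma harc hN hkappa rho Wa Wb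
      hrho hWa hWb c mu HI).
Qed.
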